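(* Let $\varphi:\mathbb D\to\mathbb D$ be holomorphic and let $\sigma\in\partial\mathbb D$. Then $\varphi$ is conformal at $\sigma$ in the weak sense if and only if one (and hence each) of the following conditions holds; that is, each of the following conditions is equivalent to conformality of $\varphi$ at $\sigma$ in the weak sense: (a') There is a sequence $(z_n)\subseteq\mathbb D$ of bounded step converging non-tangentially to $\sigma$ such that $\lim_{n\to\infty}D_h\varphi(z_n)=1$. (b') There is a sequence $(z_n)\subseteq\mathbb D$ of bounded step converging non-tangentially to $\sigma$ such that $$\frac{\mathrm k_{\mathbb D}(\varphi(z_n),\varphi(z_{n+1}))}{\mathrm k_{\mathbb D}(z_n,z_{n+1})}\to1\quad\text{as } n\to+\infty.$$ (c') The following two angular limits exist: $$\angle\lim_{z\to\sigma}\varphi(z)\in\partial\mathbb D\quad\text{and}\quad\angle\lim_{z\to\sigma}\arg\varphi'(z)\in\mathbb R.$$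
   Context: $\mathbb D=\{z\in\mathbb C:|z|<1\}$. The hyperbolic distance is $\mathrm k_{\mathbb D}(z,w)=\log\frac{1+\varrho_{\mathbb D}(z,w)}{1-\varrho_{\mathbb D}(z,w)}$, where $\varrho_{\mathbb D}(z,w)=\left|\frac{z-w}{1-\overline w z}\right|$. For holomorphic $\varphi:\mathbb D\to\mathbb D$ the hyperbolic distortion is $D_h\varphi(z)=\lim_{w\to z}\frac{\mathrm k_{\mathbb D}(\varphi(z),\varphi(w))}{\mathrm k_{\mathbb D}(z,w)}=(1-|z|^2)\frac{|\varphi'(z)|}{1-|\varphi(z)|^2}$. Convention: for $w=z$ the quotient $\mathrm k_{\mathbb D}(\varphi(z),\varphi(w))/\mathrm k_{\mathbb D}(z,w)$ is understood as $D_h\varphi(z)$. For $\sigma\in\partial\mathbb D$ and $M>1$ let $S_M=\{z\in\mathbb D:|z-\sigma|<M(1-|z|)\}$ (Stolz region with vertex $\sigma$). $\angle\lim_{z\to\sigma}f(z)=\ell$ means that for every $M>1$, $f(z)\to\ell$ as $z\to\sigma$ with $z\in S_M$. A sequence converges non-tangentially to $\sigma$ if it converges to $\sigma$ and is contained in some $S_M$. A sequence $(z_n)$ in $\mathbb D$ is of bounded (hyperbolic) step if there is $M>0$ with $\mathrm k_{\mathbb D}(z_n,z_{n+1})\le M$ for all $n\in\mathbb N$. Existence of $\angle\lim_{z\to\sigma}\arg\varphi'(z)$ means: for each Stolz region $S\subseteq\mathbb D$ with vertex at $\sigma$ there exists $\varepsilon>0$ such that $\varphi'(z)\ne0$ for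 all $z\in S_\varepsilon:=\{z\in S:|z-\sigma|<\varepsilon\}$, and the limit of $\arg\varphi'(z)$ as $S_\varepsilon\ni z\to\sigma$ exists in the topology of $\mathbb R/(2\pi\mathbb Z)$. $\varphi$ is called conformal at $\sigma$ in the weak sense if the angular limit $\varphi(\sigma):=\angle\lim_{z\to\sigma}\varphi(z)$ exists and belongs to $\partial\mathbb D$, and $\angle\lim_{z\to\sigma}\arg\frac{1-\overline{\varphi(\sigma)}\varphi(z)}{1-\overline\sigma z}=0$. *)

(* Defs.v *)
From Stdlib Require Import Reals Lra Psatz.
From Coquelicot Require Import Coquelicot.
Open Scope R_scope.

Definition in_disk (z : C) : Prop := Cmod z < 1.

(* Self-maps of the disk are represented by total functions C -> C; their values
   outside the disk are irrelevant. *)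
Definition holomorphic_self_map (phi : C -> C) : Prop :=
  forall z : C, in_disk z ->
    @ex_derive C_AbsRing C_NormedModule phi z /\ in_disk (phi z).

Definition pseudo_hyp (z w : C) : R :=
  Cmod ((z - w) / (1 - Cconj w * z))%C.

Definition hyp_dist (z w : C) : R :=
  ln ((1 + pseudo_hyp z w) / (1 - pseudo_hyp z w)).

(* Closed form of the limit of hyp_dist (phi z) (phi w) / hyp_dist z w as w tends
   to z; see hyp_distortion_is_limit below. *)
Definition hyp_distortion (phi : C -> C) (z : C) : R :=
  (1 - Cmod z ^ 2) * (Cmod (C_derive phi z) / (1 - Cmod (phi z) ^ 2)).

(* Extended to the diagonal by the hyperbolic distortion. *)
Definition hyp_quotient (phi : C -> C) (z w : C) : R :=
  if Ceq_dec z w then hyp_distortion phi z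
  else hyp_dist (phi z) (phi w) / hyp_dist z w.

Definition stolz (sigma : C) (M : R) (z : C) : Prop :=
  in_disk z /\ Cmod (z - sigma) < M * (1 - Cmod z).

Definition stolz_filter (sigma : C) (M : R) : (C -> Prop) -> Prop :=
  within (stolz sigma M) (locally sigma).

Definition angular_lim (f : C -> C) (sigma l : C) : Prop :=
  forall M : R, 1 < M -> filterlim f (stolz_filter sigma M) (locally l).

(* The class of t in R / 2 pi Z is the argument of w; zero has no argument. *)
Definition is_arg (w : C) (t : R) : Prop :=
  w <> RtoC 0 /\ w = (Cmod w * cos t, Cmod w * sin t).

(* Convergence of arg (f z) to the class of theta in R / 2 pi Z: the basic
   neighbourhoods of that class are the images of the intervals
   (theta - eps, theta + eps) under the quotient map. *)
Definition arg_lim (f : C -> C) (F : (C -> Prop) -> Prop) (theta : R) : Prop :=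
  forall eps : posreal,
    F (fun z => exists t : R, is_arg (f z) t /\ Rabs (t - theta) < eps).

Definition angular_arg_lim (f : C -> C) (sigma : C) (theta : R) : Prop :=
  forall M : R, 1 < M -> arg_lim f (stolz_filter sigma M) theta.

Definition ex_angular_arg_lim (f : C -> C) (sigma : C) : Prop :=
  forall M : R, 1 < M ->
    exists eps : R, 0 < eps /\
      (forall z : C, stolz sigma M z -> Cmod (z - sigma) < eps ->
         f z <> RtoC 0) /\
      exists theta : R, arg_lim f (stolz_filter sigma M) theta.

Definition weakly_conformal (phi : C -> C) (sigma : C) : Prop :=
  exists tau : C,
    angular_lim phi sigma tau /\ Cmod tau = 1 /\
    angular_arg_lim
      (fun z => (1 - Cconj tau * phi z) / (1 - Cconj sigma * z))%C sigma 0.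

Definition bounded_step (z : nat -> C) : Prop :=
  exists M : R, 0 < M /\ forall n : nat, hyp_dist (z n) (z (S n)) <= M.

Definition nontangential_cv (z : nat -> C) (sigma : C) : Prop :=
  filterlim z eventually (locally sigma) /\
  exists M : R, 1 < M /\ forall n : nat, stolz sigma M (z n).

Lemma disk_one_minus (a b : C) :
  in_disk a -> in_disk b -> (1 - Cconj b * a)%C <> RtoC 0.
Proof.
intros Ha Hb H.
assert (H1 : (Cconj b * a)%C = RtoC 1).
{ replace (Cconj b * a)%C with (1 - (1 - Cconj b * a))%C by ring.
  rewrite H; ring. }
apply (f_equal Cmod) in H1.
rewrite Cmod_mult, Cmod_conj, Cmod_1 in H1.
unfold in_disk in *.
pose proof (Cmod_ge_0 a); pose proof (Cmod_ge_0 b); nra.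
Qed.

Lemma pseudo_hyp_lt1 (a b : C) :
  in_disk a -> in_disk b -> 0 <= pseudo_hyp a b < 1.
Proof.
intros Ha Hb.
split; [apply Cmod_ge_0|].
pose proof (disk_one_minus a b Ha Hb) as Hne.
unfold pseudo_hyp; rewrite Cmod_div by exact Hne.
apply Cmod_gt_0 in Hne.
apply Rlt_div_l; [exact Hne|]; rewrite Rmult_1_l.
apply Rsqr_incrst_0; try apply Cmod_ge_0.
rewrite !Rsqr_pow2, !Cmod2_alt.
unfold in_disk in *.
assert (Ka : Cmod a ^ 2 < 1) by (pose proof (Cmod_ge_0 a); nra).
assert (Kb : Cmod b ^ 2 < 1) by (pose proof (Cmod_ge_0 b); nra).
rewrite Cmod2_alt in Ka, Kb.
destruct a as [a1 a2], b as [b1 b2]; simpl in *.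
nra.
Qed.

Definition log_slope (t : R) : R :=
  if Req_EM_T t 0 then 2 else ln ((1 + t) / (1 - t)) / t.

Lemma hyp_dist_slope (z w : C) :
  hyp_dist z w = log_slope (pseudo_hyp z w) * pseudo_hyp z w.
Proof.
unfold hyp_dist, log_slope.
destruct (Req_EM_T (pseudo_hyp z w) 0) as [E|E].
- rewrite E; replace ((1 + 0) / (1 - 0)) with 1 by field.
  rewrite ln_1; ring.
- field; exact E.
Qed.

Lemma log_slope_continuous0 : filterlim log_slope (locally 0) (locally 2).
Proof.
assert (D : is_derive (fun t => ln ((1 + t) / (1 - t))) 0 2).
{ auto_derive.
  - rewrite Ropp_0, !Rplus_0_r, Rinv_1; repeat split; lra.
  - rewrite Ropp_0, !Rplus_0_r; field. }
apply is_derive_Reals in D.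
intros P [eps HP].
destruct (D eps (cond_pos eps)) as [d Hd].
exists d; intros t Ht; apply HP.
change (Rabs (t - 0) < d) in Ht; rewrite Rminus_0_r in Ht.
change (Rabs (log_slope t - 2) < eps).
unfold log_slope; destruct (Req_EM_T t 0) as [E|E].
- rewrite Rminus_diag, Rabs_R0; apply cond_pos.
- specialize (Hd t E Ht).
  rewrite Rplus_0_l in Hd.
  replace ((1 + 0) / (1 - 0)) with 1 in Hd by field.
  rewrite ln_1, Rminus_0_r in Hd; exact Hd.
Qed.

Lemma Cmod_filterlim (f : C -> C) (F : (C -> Prop) -> Prop) (l : C) :
  filterlim f F (locally l) -> filterlim (fun w => Cmod (f w)) F (locally (Cmod l)).
Proof.
intros H.
apply (filterlim_comp _ _ _ f Cmod F (locally l)); [exact H|].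
exact (@filterlim_norm C_AbsRing C_NormedModule l).
Qed.

Lemma Cmod_quotient_limit (phi : C -> C) (z l : C) :
  @is_derive C_AbsRing C_NormedModule phi z l ->
  filterlim (fun w => Cmod ((phi z - phi w) / (z - w))%C)
    (locally' z) (locally (Cmod l)).
Proof.
intros [_ H].
specialize (H z (fun P HP => HP)).
intros P [eps HP].
specialize (H (pos_div_2 eps)).
apply locally_C in H.
unfold filtermap, locally', within.
revert H; apply filter_imp; intros w Hw Hne.
apply HP.
change (Cmod (minus (minus (phi w) (phi z)) (scal (minus w z) l))
  <= eps / 2 * Cmod (minus w z)) in Hw.
change (Cmod ((phi w - phi z) - (w - z) * l)%C
  <= eps / 2 * Cmod (w - z)%C) in Hw.
assert (Hwz : (w - z)%C <> RtoC 0) by (apply Cminus_eq_contra; exact Hne).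
change (Rabs (Cmod ((phi z - phi w) / (z - w))%C - Cmod l) < eps).
replace ((phi z - phi w) / (z - w))%C with ((phi w - phi z) / (w - z))%C.
2: { field; split; [|exact Hwz]; apply Cminus_eq_contra; intros E; apply Hne; now symmetry. }
assert (Hd : Cmod ((phi w - phi z) / (w - z) - l)%C <= eps / 2).
{ replace ((phi w - phi z) / (w - z) - l)%C
    with (((phi w - phi z) - (w - z) * l) / (w - z))%C by (field; exact Hwz).
  rewrite Cmod_div by exact Hwz.
  apply Cmod_gt_0 in Hwz.
  apply Rle_div_l; [exact Hwz|exact Hw]. }
pose proof (cond_pos eps).
apply Rle_lt_trans with (eps / 2); [|lra].
apply Rle_trans with (2 := Hd).
exact (@norm_triangle_inv C_AbsRing C_NormedModule _ _).
Qed.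

Lemma locally'_locally (z : C) (f : C -> R) (l : R) :
  filterlim f (locally z) (locally l) -> filterlim f (locally' z) (locally l).
Proof.
intros H P HP; specialize (H P HP).
unfold filtermap, locally', within in *.
revert H; apply filter_imp; auto.
Qed.

Lemma Cmod_one_minus_limit (f : C -> C) (z a : C) :
  @continuous C_UniformSpace C_UniformSpace f z ->
  filterlim (fun w => Cmod (1 - Cconj (f w) * a)%C)
    (locally z) (locally (Cmod (1 - Cconj (f z) * a)%C)).
Proof.
intros Hf.
assert (E : forall b, Cmod (1 - Cconj b * a)%C = Cmod (1 - Cconj a * b)%C).
{ intros b; rewrite <- Cmod_conj.
  f_equal; rewrite Cminus_conj, Cmult_conj, Cconj_conj.
  replace (Cconj 1) with (RtoC 1) by (unfold Cconj; simpl; now rewrite Ropp_0).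
  ring. }
rewrite E.
apply filterlim_ext with (fun w => Cmod (1 - Cconj a * f w)%C).
{ intros w; symmetry; apply E. }
assert (Hg : @continuous C_UniformSpace C_UniformSpace
               (fun w => 1 - Cconj a * f w)%C z).
{ apply (@continuous_minus C_UniformSpace C_AbsRing C_NormedModule
           (fun _ => RtoC 1) (fun w => Cconj a * f w)%C).
  - apply continuous_const.
  - apply (@continuous_scal_r C_UniformSpace C_AbsRing C_NormedModule (Cconj a) f).
    exact Hf. }
apply Cmod_filterlim; exact Hg.
Qed.

Lemma filterlim_mult_R {T : Type} (F : (T -> Prop) -> Prop) {FF : Filter F}
  (f g : T -> R) (a b : R) :
  filterlim f F (locally a) -> filterlim g F (locally b) ->
  filterlim (fun x => f x * g x) F (locally (a * b)).
Proof.
intros Hf Hg.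
apply (filterlim_comp_2 f g Rmult Hf Hg).
exact (@filterlim_mult R_AbsRing a b).
Qed.

Lemma filterlim_inv_R {T : Type} (F : (T -> Prop) -> Prop) (f : T -> R) (a : R) :
  a <> 0 -> filterlim f F (locally a) ->
  filterlim (fun x => / f x) F (locally (/ a)).
Proof.
intros Ha Hf.
apply (filterlim_comp _ _ _ f Rinv F (locally a)); [exact Hf|].
exact (continuous_Rinv a Ha).
Qed.

Lemma filter_locally' (z : C) : Filter (@locally' C_UniformSpace z).
Proof. apply within_filter, locally_filter. Qed.

Lemma in_disk_near (z : C) :
  in_disk z -> locally z in_disk.
Proof.
intros Hz.
refine (Cmod_filterlim (fun w => w) (locally z) z (fun P HP => HP)
  (fun u => u < 1) _).
exact (open_lt 1 (Cmod z) Hz).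
Qed.

Lemma pseudo_hyp_limit (f : C -> C) (z : C) :
  @continuous C_UniformSpace C_UniformSpace f z ->
  in_disk (f z) -> locally z (fun w => in_disk (f w)) ->
  filterlim (fun w => pseudo_hyp (f z) (f w)) (locally' z) (locally 0).
Proof.
intros Hf Hfz Hfw.
apply locally'_locally.
apply (@filterlim_ext_loc C R (locally z) (locally 0) _
  (fun w => Cmod (f z - f w)%C * / Cmod (1 - Cconj (f w) * f z)%C)).
{ revert Hfw; apply filter_imp; intros w Hw.
  unfold pseudo_hyp; rewrite Cmod_div; [reflexivity|].
  now apply disk_one_minus. }
replace 0 with (Cmod (f z - f z)%C * / Cmod (1 - Cconj (f z) * f z)%C).
2: { replace (f z - f z)%C with (RtoC 0) by ring; rewrite Cmod_0; ring. }
apply filterlim_mult_R.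
- apply locally_filter.
- apply Cmod_filterlim.
  apply (@continuous_minus C_UniformSpace C_AbsRing C_NormedModule
           (fun _ => f z) f); [apply continuous_const|exact Hf].
- apply filterlim_inv_R.
  + apply Rgt_not_eq, Cmod_gt_0; now apply disk_one_minus.
  + now apply Cmod_one_minus_limit.
Qed.

Lemma Cmod_one_minus_diag (a : C) :
  in_disk a -> Cmod (1 - Cconj a * a)%C = 1 - Cmod a ^ 2.
Proof.
intros Ha; unfold in_disk in Ha.
replace (1 - Cconj a * a)%C with (RtoC (1 - Cmod a ^ 2)).
- rewrite Cmod_R; apply Rabs_pos_eq; pose proof (Cmod_ge_0 a); nra.
- rewrite RtoC_minus, Cmod2_conj; ring.
Qed.

Lemma hyp_distortion_is_limit (phi : C -> C) (z : C) :
  holomorphic_self_map phi -> in_disk z ->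
  filterlim (fun w => hyp_dist (phi z) (phi w) / hyp_dist z w)
    (locally' z) (locally (hyp_distortion phi z)).
Proof.
intros Hphi Hz.
destruct (Hphi z Hz) as [Hd Hpz].
assert (Hc : @continuous C_UniformSpace C_UniformSpace phi z).
{ apply ex_derive_continuous in Hd.
  intros P HP; apply locally_C; apply Hd; exact HP. }
assert (Hnear : locally z (fun w => in_disk (phi w))).
{ generalize (in_disk_near z Hz); apply filter_imp; intros w Hw.
  now apply Hphi. }
pose proof (filter_locally' z) as HF.
apply (@filterlim_ext_loc C R (locally' z) (locally (hyp_distortion phi z)) _
  (fun w => (log_slope (pseudo_hyp (phi z) (phi w)) * / log_slope (pseudo_hyp z w)) *
     (Cmod ((phi z - phi w) / (z - w))%C *
       (Cmod (1 - Cconj w * z)%C * / Cmod (1 - Cconj (phi w) * phi z)%C)))).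
{ unfold locally', within.
  generalize (in_disk_near z Hz); apply filter_imp; intros w Hw Hne.
  rewrite !hyp_dist_slope; unfold Rdiv; rewrite Rinv_mult.
  destruct (Hphi w Hw) as [_ Hpw].
  assert (Hzw : (z - w)%C <> RtoC 0).
  { apply Cminus_eq_contra; intros E; apply Hne; now symmetry. }
  pose proof (disk_one_minus z w Hz Hw) as H1.
  pose proof (disk_one_minus _ _ Hpz Hpw) as H2.
  transitivity ((log_slope (pseudo_hyp (phi z) (phi w)) * / log_slope (pseudo_hyp z w)) *
    (pseudo_hyp (phi z) (phi w) * / pseudo_hyp z w)); [|ring].
  f_equal.
  unfold pseudo_hyp; rewrite !Cmod_div by assumption.
  apply Cmod_gt_0 in Hzw; apply Cmod_gt_0 in H1; apply Cmod_gt_0 in H2.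
  field; repeat split; lra. }
replace (hyp_distortion phi z) with ((2 * / 2) *
  (Cmod (C_derive phi z) *
    (Cmod (1 - Cconj z * z)%C * / Cmod (1 - Cconj (phi z) * phi z)%C))).
2: { unfold hyp_distortion; rewrite !Cmod_one_minus_diag by assumption.
     assert (1 - Cmod (phi z) ^ 2 <> 0).
     { unfold in_disk in Hpz; pose proof (Cmod_ge_0 (phi z)); nra. }
     field; assumption. }
repeat apply filterlim_mult_R; try exact HF.
- apply (filterlim_comp _ _ _ _ log_slope _ (locally 0));
    [|apply log_slope_continuous0].
  now apply pseudo_hyp_limit.
- apply filterlim_inv_R; [lra|].
  apply (filterlim_comp _ _ _ _ log_slope _ (locally 0));
    [|apply log_slope_continuous0].
  apply (pseudo_hyp_limit (fun w => w)); [|exact Hz|now apply in_disk_near].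
  intros P HP; exact HP.
- apply Cmod_quotient_limit.
  destruct Hd as [l Hl].
  now rewrite (is_C_derive_unique _ _ _ Hl).
- apply locally'_locally, (Cmod_one_minus_limit (fun w => w)).
  intros P HP; exact HP.
- apply filterlim_inv_R.
  + apply Rgt_not_eq, Cmod_gt_0; now apply disk_one_minus.
  + now apply locally'_locally, Cmod_one_minus_limit.
Qed.

(* Main.v *)
Require Import Defs.
From Stdlib Require Import Reals Psatz Classical ClassicalEpsilon.
From Coquelicot Require Import Coquelicot.
Open Scope R_scope.

(* For a self-map phi of the disk and a point a, the hyperbolic difference quotient
   b -> T_{phi a} (phi b) / T_a b (T_a the disk automorphism sending a to 0) maps the disk to
   its closure, and its modulus at b = a is the hyperbolic distortion.  By Schwarz-Pick, once
   its modulus is near 1 at one point, the quotient is nearly constant on hyperbolic disks of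
   fixed radius.  As this modulus is symmetric in a and b, near-isometry propagates along a
   sequence of bounded step, so (a') and (b') are equivalent for a given sequence and both
   imply that the distortion tends to 1 along the radial points x_n with
   (sigma + x_n) / (sigma - x_n) = 3^n.

   Along these points the images p_n form an almost geodesic: for every boundary point tau the
   reciprocals s_n of the Poisson kernel satisfy s_{n+2}/s_{n+1} + s_n/s_{n+1} -> 10/3.  If tau is
   a cluster point of p_n / |p_n|, then s_n cannot grow, so s_{n+1}/s_n -> 1/3; in the
   half-plane with tau at infinity this makes phi asymptotic to a dilation, uniformly on
   hyperbolic disks around x_n, which is weak conformality.

   Conversely, weak conformality confines (1 - conj(tau) phi) / (1 - conj(sigma) z) to thin
   sectors, and the Schwarz lemma bounds its logarithmic derivative; this gives (a') and (c').
   For (c'), integrating phi' along segments ending at sigma confines tau - phi(z) to a thin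
   sector around e (sigma - z) with |e| = 1, and Re (1 - conj(tau) phi) > 0 on wide Stolz
   regions forces e = tau conj(sigma). *)

(** * Limits and complex derivatives *)

(** Weak conformality leaves the modulus of the boundary quotient free: near the radial point x_n
    that quotient is the positive number [3 ^ n / height n] times a factor tending to 1, and this
    number may be unbounded. No finite angular derivative can therefore be used, and all conclusions
    are phrased with sectors, which ignore positive factors. The spacing [3 ^ n] puts consecutive
    radial points at pseudo-hyperbolic distance exactly 1/2, that is at hyperbolic distance [ln 3];
    an exact dilation has the ratios 3 and 1/3, whence 10/3. The obstacle in (a') is that the image
    orbit is not known to converge, so no boundary point is given in advance. The recurrence is
    therefore proved with an error independent of tau, which makes it possible to compare a cluster
    point with the boundary points near it. All function theory rests on a maximum principle that
    tolerates isolated points of mere continuity: difference quotients are fed back into the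
    Schwarz-Pick lemma without removing their singularity. *)

Definition tends {T : Type} (F : (T -> Prop) -> Prop) (f : T -> C) (l : C) : Prop :=
  forall eps, 0 < eps -> F (fun x => Cmod (f x - l)%C < eps).

Section Tends.
Context {T : Type} {F : (T -> Prop) -> Prop} {FF : Filter F}.

Lemma tends_ext (f g : T -> C) l :
  (forall x, f x = g x) -> tends F f l -> tends F g l.
Proof.
intros E H eps He; generalize (H eps He); apply filter_imp.
intros x Hx; now rewrite <- E.
Qed.

Lemma tends_ext_loc (f g : T -> C) l :
  F (fun x => f x = g x) -> tends F f l -> tends F g l.
Proof.
intros E H eps He; generalize (filter_and _ _ E (H eps He)); apply filter_imp.
intros x [Ex Hx]; now rewrite <- Ex.
Qed.

Lemma tends_const c : tends F (fun _ => c) c.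
Proof.
intros eps He; apply filter_forall; intros _.
replace (c - c)%C with (RtoC 0) by ring; now rewrite Cmod_0.
Qed.

Lemma tends_le (f : T -> C) (u : T -> C) l :
  tends F u 0 -> F (fun x => Cmod (f x - l)%C <= Cmod (u x)) -> tends F f l.
Proof.
intros Hu Hf eps He; generalize (filter_and _ _ Hf (Hu eps He)); apply filter_imp.
intros x [H1 H2]; replace (u x - 0)%C with (u x) in H2 by ring; lra.
Qed.

Lemma tends_plus f g a b :
  tends F f a -> tends F g b -> tends F (fun x => f x + g x)%C (a + b)%C.
Proof.
intros Hf Hg eps He.
assert (He2 : 0 < eps / 2) by lra.
generalize (filter_and _ _ (Hf _ He2) (Hg _ He2)); apply filter_imp.
intros x [H1 H2].
replace (f x + g x - (a + b))%C with ((f x - a) + (g x - b))%C by ring.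
pose proof (Cmod_triangle (f x - a)%C (g x - b)%C); lra.
Qed.

Lemma tends_bounded_mult f g K :
  tends F f 0 -> F (fun x => Cmod (g x) <= K) -> tends F (fun x => f x * g x)%C 0.
Proof.
intros Hf Hg eps He.
assert (HK : 0 < Rabs K + 1) by (pose proof (Rabs_pos K); lra).
assert (He2 : 0 < eps / (Rabs K + 1)) by (now apply Rdiv_lt_0_compat).
generalize (filter_and _ _ (Hf _ He2) Hg); apply filter_imp.
intros x [H1 H2].
replace (f x * g x - 0)%C with ((f x - 0) * g x)%C by ring.
rewrite Cmod_mult.
apply Rle_lt_trans with (Cmod (f x - 0)%C * (Rabs K + 1)).
- apply Rmult_le_compat_l; [apply Cmod_ge_0|].
  pose proof (Rle_abs K); lra.
- now apply Rlt_div_r in H1.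
Qed.

Lemma tends_bound f a : tends F f a -> F (fun x => Cmod (f x) <= Cmod a + 1).
Proof.
intros H; generalize (H 1 Rlt_0_1); apply filter_imp; intros x Hx.
replace (f x) with ((f x - a) + a)%C by ring.
pose proof (Cmod_triangle (f x - a)%C a); lra.
Qed.

Lemma tends_sub0 f a : tends F f a -> tends F (fun x => f x - a)%C 0.
Proof.
intros H eps He; generalize (H eps He); apply filter_imp; intros x Hx.
replace (f x - a - 0)%C with (f x - a)%C by ring; exact Hx.
Qed.

Lemma tends_mult f g a b :
  tends F f a -> tends F g b -> tends F (fun x => f x * g x)%C (a * b)%C.
Proof.
intros Hf Hg.
apply tends_ext with (fun x => (f x - a) * g x + ((g x - b) * a + a * b))%C;
  [intros x; ring|].
apply (eq_ind (0 + (0 + a * b))%C (fun l => tends F _ l)); [|ring].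
apply tends_plus; [|apply tends_plus].
- apply tends_bounded_mult with (Cmod b + 1); [now apply tends_sub0|now apply tends_bound].
- apply tends_bounded_mult with (Cmod a); [now apply tends_sub0|].
  apply filter_forall; intros; lra.
- apply tends_const.
Qed.

Lemma tends_opp f a : tends F f a -> tends F (fun x => - f x)%C (- a)%C.
Proof.
intros H eps He; generalize (H eps He); apply filter_imp; intros x Hx.
replace (- f x - - a)%C with (- (f x - a))%C by ring; now rewrite Cmod_opp.
Qed.

Lemma tends_minus f g a b :
  tends F f a -> tends F g b -> tends F (fun x => f x - g x)%C (a - b)%C.
Proof. intros Hf Hg; apply tends_plus; [exact Hf|now apply tends_opp]. Qed.

Lemma tends_nonzero f a :
  a <> RtoC 0 -> tends F f a -> F (fun x => Cmod a / 2 <= Cmod (f x)).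
Proof.
intros Ha H; apply Cmod_gt_0 in Ha.
assert (He : 0 < Cmod a / 2) by lra.
generalize (H _ He); apply filter_imp; intros x Hx.
pose proof (Cmod_triangle (a - f x)%C (f x)) as K.
replace (a - f x + f x)%C with a in K by ring.
replace (a - f x)%C with (- (f x - a))%C in K by ring.
rewrite Cmod_opp in K; lra.
Qed.

Lemma tends_inv f a :
  a <> RtoC 0 -> tends F f a -> tends F (fun x => / f x)%C (/ a)%C.
Proof.
intros Ha H.
pose proof (tends_nonzero f a Ha H) as Hn.
pose proof Ha as Ha'; apply Cmod_gt_0 in Ha'.
assert (Hnz : forall w, Cmod a / 2 <= Cmod w -> w <> RtoC 0).
{ intros w Hw; apply Cmod_gt_0; lra. }
assert (H0 : tends F (fun x => / f x - / a)%C 0).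
{ apply tends_ext_loc with (fun x => (f x - a) * (- / (f x * a)))%C.
  - revert Hn; apply filter_imp; intros x Hx; field; split; [exact Ha|now apply Hnz].
  - apply tends_bounded_mult with (/ (Cmod a / 2 * Cmod a)); [now apply tends_sub0|].
    revert Hn; apply filter_imp; intros x Hx.
    rewrite Cmod_opp, Cmod_inv, Cmod_mult;
      [|apply Cmult_neq_0; [now apply Hnz|exact Ha]].
    apply Rinv_le_contravar; [nra|].
    apply Rmult_le_compat_r; lra. }
intros eps He; generalize (H0 eps He); apply filter_imp; intros x Hx.
replace (/ f x - / a)%C with (/ f x - / a - 0)%C by ring; exact Hx.
Qed.

Lemma tends_div f g a b :
  b <> RtoC 0 -> tends F f a -> tends F g b -> tends F (fun x => f x / g x)%C (a / b)%C.
Proof. intros Hb Hf Hg; apply tends_mult; [exact Hf|now apply tends_inv]. Qed.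

Lemma tends_conj f a : tends F f a -> tends F (fun x => Cconj (f x)) (Cconj a).
Proof.
intros H eps He; generalize (H eps He); apply filter_imp; intros x Hx.
now rewrite <- Cminus_conj, Cmod_conj.
Qed.

Lemma Cmod_diff_le (a b : C) : Rabs (Cmod a - Cmod b) <= Cmod (a - b)%C.
Proof. exact (@norm_triangle_inv C_AbsRing C_NormedModule a b). Qed.

Lemma tends_Cmod f a : tends F f a -> tends F (fun x => RtoC (Cmod (f x))) (RtoC (Cmod a)).
Proof.
intros H eps He; generalize (H eps He); apply filter_imp; intros x Hx.
rewrite <- RtoC_minus, Cmod_R.
pose proof (Cmod_diff_le (f x) a); lra.
Qed.

Lemma Re_minus (a b : C) : Re (a - b)%C = Re a - Re b.
Proof. destruct a, b; simpl; ring. Qed.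

Lemma Im_minus (a b : C) : Im (a - b)%C = Im a - Im b.
Proof. destruct a, b; simpl; ring. Qed.

Lemma im_le_Cmod (c : C) : Rabs (Im c) <= Cmod c.
Proof.
replace (Im c) with (- Re (c * Ci)%C) by (rewrite re_mult_Ci; ring).
rewrite Rabs_Ropp.
apply Rle_trans with (1 := re_le_Cmod _).
rewrite Cmod_mult; replace (Cmod Ci) with 1; [lra|].
unfold Cmod, Ci; simpl; rewrite <- sqrt_1 at 1; f_equal; ring.
Qed.

Lemma tends_Re f a : tends F f a -> tends F (fun x => RtoC (Re (f x))) (RtoC (Re a)).
Proof.
intros H eps He; generalize (H eps He); apply filter_imp; intros x Hx.
rewrite <- RtoC_minus, Cmod_R, <- Re_minus.
apply Rle_lt_trans with (2 := Hx); apply re_le_Cmod.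
Qed.

Lemma tends_Im f a : tends F f a -> tends F (fun x => RtoC (Im (f x))) (RtoC (Im a)).
Proof.
intros H eps He; generalize (H eps He); apply filter_imp; intros x Hx.
rewrite <- RtoC_minus, Cmod_R, <- Im_minus.
apply Rle_lt_trans with (2 := Hx); apply im_le_Cmod.
Qed.

(** Real limits are embedded by [RtoC], so that a single limit calculus serves moduli, real parts
    and complex values. *)
Lemma tends_R (f : T -> R) (l : R) :
  tends F (fun x => RtoC (f x)) (RtoC l) <->
  forall eps, 0 < eps -> F (fun x => Rabs (f x - l) < eps).
Proof.
split; intros H eps He; generalize (H eps He); apply filter_imp; intros x Hx.
- now rewrite <- RtoC_minus, Cmod_R in Hx.
- now rewrite <- RtoC_minus, Cmod_R.
Qed.

End Tends.

Lemma tends_comp {T U : Type} (F : (T -> Prop) -> Prop) (G : (U -> Prop) -> Prop) {FF : Filter F}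
  (h : T -> U) f l :
  filterlim h F G -> tends G f l -> tends F (fun x => f (h x)) l.
Proof. intros Hh Hf eps He; exact (Hh _ (Hf eps He)). Qed.

(** * Neighbourhoods, continuity and the complex derivative *)

Definition ball_filter (z : C) (P : C -> Prop) : Prop :=
  exists d, 0 < d /\ forall w, Cmod (w - z)%C < d -> P w.

Lemma ball_filter_locally (z : C) P : ball_filter z P <-> locally z P.
Proof.
split.
- intros (d & Hd & H); apply locally_C.
  exists (mkposreal d Hd); intros w Hw; apply H; exact Hw.
- intros H; apply locally_C in H; destruct H as [d H].
  exists d; split; [apply cond_pos|]; intros w Hw; apply H; exact Hw.
Qed.

Global Instance ball_filter_filter z : Filter (ball_filter z).
Proof.
split.
- exists 1; split; [lra|trivial].
- intros P Q (d & Hd & H) (d' & Hd' & H').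
  exists (Rmin d d'); split; [now apply Rmin_pos|]; intros w Hw.
  split; [apply H|apply H']; apply Rlt_le_trans with (1 := Hw);
    [apply Rmin_l|apply Rmin_r].
- intros P Q HPQ (d & Hd & H); exists d; split; [exact Hd|]; intros w Hw; auto.
Qed.

Lemma tends_filterlim {T} (F : (T -> Prop) -> Prop) {FF : Filter F} (f : T -> C) (l : C) :
  filterlim f F (locally l) <-> tends F f l.
Proof.
split.
- intros H eps He; refine (H (fun y => Cmod (y - l)%C < eps) _).
  apply ball_filter_locally; exists eps; split; [exact He|trivial].
- intros H P HP; apply ball_filter_locally in HP; destruct HP as (d & Hd & HP).
  unfold filtermap; generalize (H d Hd); apply filter_imp; intros x Hx; now apply HP.
Qed.

Definition cont (f : C -> C) (z : C) : Prop := tends (ball_filter z) f (f z).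

Lemma tends_id z : tends (ball_filter z) (fun w => w) z.
Proof. intros eps He; exists eps; split; [exact He|trivial]. Qed.

Lemma cont_comp (f g : C -> C) z : cont g z -> cont f (g z) -> cont (fun w => f (g w)) z.
Proof.
intros Hg Hf eps He.
destruct (Hf eps He) as (d & Hd & H).
generalize (Hg d Hd); apply filter_imp; intros w Hw; now apply H.
Qed.

Lemma cont_ext_loc (f g : C -> C) z :
  ball_filter z (fun w => f w = g w) -> cont f z -> cont g z.
Proof.
intros E H; unfold cont.
assert (E0 : f z = g z).
{ destruct E as (d & Hd & E); apply E.
  replace (z - z)%C with (RtoC 0) by ring; now rewrite Cmod_0. }
rewrite <- E0; now apply tends_ext_loc with f.
Qed.

(* Caratheodory's form of the complex derivative: it turns the rules of calculus into
   algebraic identities between slope functions. *)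
Definition cderiv (f : C -> C) (z l : C) : Prop :=
  exists q : C -> C, cont q z /\ q z = l /\ forall w, f w = (f z + q w * (w - z))%C.

Definition cdiff (f : C -> C) (z : C) : Prop := exists l, cderiv f z l.

Lemma cderiv_of_bound (f : C -> C) z l :
  (forall eps, 0 < eps -> ball_filter z (fun w =>
    Cmod (f w - f z - l * (w - z))%C <= eps * Cmod (w - z)%C)) -> cderiv f z l.
Proof.
intros H.
exists (fun w => if Ceq_dec w z then l else ((f w - f z) / (w - z))%C).
destruct (Ceq_dec z z) as [_|N]; [|now elim N].
split; [|split; [reflexivity|]].
- unfold cont; destruct (Ceq_dec z z) as [_|N]; [|now elim N].
  intros eps He.
  assert (He2 : 0 < eps / 2) by lra.
  generalize (H _ He2); apply filter_imp; intros w Hw.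
  destruct (Ceq_dec w z) as [E|N].
  + replace (l - l)%C with (RtoC 0) by ring; now rewrite Cmod_0.
  + apply Cminus_eq_contra in N.
    replace ((f w - f z) / (w - z) - l)%C
      with ((f w - f z - l * (w - z)) / (w - z))%C by (field; exact N).
    rewrite Cmod_div by exact N.
    apply Cmod_gt_0 in N.
    apply Rle_lt_trans with (eps / 2); [|lra].
    apply Rle_div_l; [exact N|exact Hw].
- intros w; destruct (Ceq_dec w z) as [->|N]; [ring|].
  apply Cminus_eq_contra in N; field; exact N.
Qed.

Lemma cderiv_bound (f : C -> C) z l :
  cderiv f z l -> forall eps, 0 < eps -> ball_filter z (fun w =>
    Cmod (f w - f z - l * (w - z))%C <= eps * Cmod (w - z)%C).
Proof.
intros (q & Hq & <- & E) eps He; generalize (Hq eps He); apply filter_imp; intros w Hw.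
rewrite (E w).
replace (f z + q w * (w - z) - f z - q z * (w - z))%C with ((q w - q z) * (w - z))%C by ring.
rewrite Cmod_mult; apply Rmult_le_compat_r; [apply Cmod_ge_0|lra].
Qed.

Lemma cderiv_is_derive f z l :
  cderiv f z l <-> @is_derive C_AbsRing C_NormedModule f z l.
Proof.
split.
- intros H; split; [apply is_linear_scal_l|].
  intros x Hx.
  assert (Hzx : z = x) by exact (is_filter_lim_locally_unique _ _ Hx).
  subst x; intros eps; apply locally_C.
  generalize (proj1 (ball_filter_locally z _) (cderiv_bound f z l H eps (cond_pos eps))).
  apply filter_imp; intros w Hw.
  change (Cmod ((f w - f z) - (w - z) * l)%C <= eps * Cmod (w - z)%C).
  now rewrite (Cmult_comm (w - z)).
- intros [_ H]; specialize (H z (fun P HP => HP)).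
  apply cderiv_of_bound; intros eps He.
  specialize (H (mkposreal eps He)); apply locally_C in H.
  apply ball_filter_locally in H; revert H; apply filter_imp; intros w Hw.
  change (Cmod ((f w - f z) - (w - z) * l)%C <= eps * Cmod (w - z)%C) in Hw.
  now rewrite (Cmult_comm (w - z)) in Hw.
Qed.

Lemma cderiv_C_derive f z l : cderiv f z l -> C_derive f z = l.
Proof. intros H; apply is_C_derive_unique; now apply cderiv_is_derive. Qed.

Lemma cdiff_C_derive f z : cdiff f z -> cderiv f z (C_derive f z).
Proof. intros (l & H); now rewrite (cderiv_C_derive _ _ _ H). Qed.

Lemma cdiff_ex_derive f z :
  @ex_derive C_AbsRing C_NormedModule f z <-> cdiff f z.
Proof. split; intros (l & H); exists l; now apply cderiv_is_derive. Qed.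

Lemma cderiv_cont f z l : cderiv f z l -> cont f z.
Proof.
intros (q & Hq & Eq & E).
unfold cont; apply tends_ext with (fun w => f z + q w * (w - z))%C; [intros w; symmetry; apply E|].
apply (eq_ind (f z + q z * (z - z))%C (fun m => tends _ _ m)); [|ring].
apply tends_plus; [apply tends_const|].
apply tends_mult; [exact Hq|].
apply tends_minus; [apply tends_id|apply tends_const].
Qed.

Lemma cdiff_cont f z : cdiff f z -> cont f z.
Proof. intros (l & H); exact (cderiv_cont _ _ _ H). Qed.

Lemma cderiv_ext f g z l : (forall w, f w = g w) -> cderiv f z l -> cderiv g z l.
Proof.
intros E (q & Hq & Eq & H); exists q; repeat split; trivial.
intros w; rewrite <- !E; apply H.
Qed.

(** The slope identity in [cderiv] is global, so the slope function of [f] cannot be reused for a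
    [g] that agrees with [f] only near [z]; passing through [is_derive] builds a new one. *)
Lemma cderiv_ext_loc f g z l :
  ball_filter z (fun w => f w = g w) -> cderiv f z l -> cderiv g z l.
Proof.
intros E H; apply cderiv_is_derive; apply cderiv_is_derive in H.
apply (is_derive_ext_loc f); [|exact H].
apply ball_filter_locally in E; apply locally_C; exact E.
Qed.

Lemma cderiv_const c z : cderiv (fun _ => c) z 0.
Proof.
exists (fun _ => RtoC 0); split; [apply tends_const|split; [reflexivity|intros; ring]].
Qed.

Lemma cderiv_id z : cderiv (fun w => w) z 1.
Proof.
exists (fun _ => RtoC 1); split; [apply tends_const|split; [reflexivity|intros; ring]].
Qed.

Lemma cderiv_plus f g z l m :
  cderiv f z l -> cderiv g z m -> cderiv (fun w => f w + g w)%C z (l + m)%C.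
Proof.
intros (q & Hq & <- & E) (r & Hr & <- & E').
exists (fun w => q w + r w)%C; split; [now apply tends_plus|split; [reflexivity|]].
intros w; rewrite (E w), (E' w); ring.
Qed.

Lemma cderiv_mult f g z l m :
  cderiv f z l -> cderiv g z m ->
  cderiv (fun w => f w * g w)%C z (l * g z + f z * m)%C.
Proof.
intros Hf Hg; pose proof (cderiv_cont _ _ _ Hg) as Cg.
destruct Hf as (q & Hq & <- & E), Hg as (r & Hr & <- & E').
exists (fun w => q w * g w + f z * r w)%C; split; [|split; [reflexivity|]].
- apply tends_plus; apply tends_mult; trivial; apply tends_const.
- intros w; rewrite (E w), (E' w); ring.
Qed.

Lemma cderiv_inv f z l :
  f z <> RtoC 0 -> cderiv f z l -> cderiv (fun w => / f w)%C z (- l / (f z * f z))%C.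
Proof.
intros Hz Hf; pose proof (cderiv_cont _ _ _ Hf) as Cf.
destruct Hf as (q & Hq & <- & E).
(* The slope identity must also hold at the zeros of [f], where the usual formula fails; there the
   raw quotient is taken. Continuity at [z] is not affected, since [f z <> 0] keeps these zeros away
   from [z]. *)
exists (fun w => if Ceq_dec (f w) 0 then ((/ f w - / f z) / (w - z))%C
                 else (- q w / (f w * f z))%C).
destruct (Ceq_dec (f z) 0) as [N|_]; [now elim Hz|].
split; [|split; [reflexivity|]].
- unfold cont; destruct (Ceq_dec (f z) 0) as [N|_]; [now elim Hz|].
  apply tends_ext_loc with (fun w => - q w / (f w * f z))%C.
  + generalize (tends_nonzero f (f z) Hz Cf); apply filter_imp; intros w Hw.
    destruct (Ceq_dec (f w) 0) as [N|_]; [|reflexivity].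
    apply Cmod_gt_0 in Hz; rewrite N, Cmod_0 in Hw; lra.
  + apply tends_div; [now apply Cmult_neq_0|now apply tends_opp|].
    apply tends_mult; [exact Cf|apply tends_const].
- intros w; destruct (Ceq_dec w z) as [->|N].
  + destruct (Ceq_dec (f z) 0); ring.
  + apply Cminus_eq_contra in N.
    destruct (Ceq_dec (f w) 0) as [_|Hw].
    * unfold Cdiv; rewrite <- Cmult_assoc, Cinv_l by exact N; ring.
    * rewrite (E w) in Hw |- *; field; split; trivial.
Qed.

Lemma cderiv_comp f g z l m :
  cderiv g z m -> cderiv f (g z) l -> cderiv (fun w => f (g w)) z (l * m)%C.
Proof.
intros Hg; pose proof (cderiv_cont _ _ _ Hg) as Cg; revert Hg.
intros (r & Hr & <- & E') (q & Hq & <- & E).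
exists (fun w => q (g w) * r w)%C; split; [|split; [reflexivity|]].
- apply tends_mult; [exact (cont_comp _ _ _ Cg Hq)|exact Hr].
- intros w; rewrite (E (g w)), (E' w); ring.
Qed.

Lemma cdiff_const c z : cdiff (fun _ => c) z.
Proof. eexists; apply cderiv_const. Qed.
Lemma cdiff_id z : cdiff (fun w => w) z.
Proof. eexists; apply cderiv_id. Qed.
Lemma cdiff_plus f g z : cdiff f z -> cdiff g z -> cdiff (fun w => f w + g w)%C z.
Proof. intros (l & H) (m & K); eexists; apply cderiv_plus; eassumption. Qed.
Lemma cdiff_mult f g z : cdiff f z -> cdiff g z -> cdiff (fun w => f w * g w)%C z.
Proof. intros (l & H) (m & K); eexists; apply cderiv_mult; eassumption. Qed.
Lemma cdiff_opp f z : cdiff f z -> cdiff (fun w => - f w)%C z.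
Proof.
intros (l & H); exists (RtoC 0 * f z + RtoC (-1) * l)%C.
apply cderiv_ext with (fun w => RtoC (-1) * f w)%C; [|apply cderiv_mult; [apply cderiv_const|exact H]].
intros w; replace (RtoC (-1)) with (- RtoC 1)%C by (now rewrite <- RtoC_opp); ring.
Qed.
Lemma cdiff_minus f g z : cdiff f z -> cdiff g z -> cdiff (fun w => f w - g w)%C z.
Proof. intros; apply cdiff_plus; [|apply cdiff_opp]; trivial. Qed.
Lemma cdiff_div f g z : g z <> RtoC 0 -> cdiff f z -> cdiff g z -> cdiff (fun w => f w / g w)%C z.
Proof.
intros Hz H (m & K); apply cdiff_mult; [exact H|].
eexists; apply cderiv_inv; eassumption.
Qed.

Lemma cont_div f g z : g z <> RtoC 0 -> cont f z -> cont g z -> cont (fun w => f w / g w)%C z.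
Proof. intros; now apply tends_div. Qed.
Lemma cont_mult f g z : cont f z -> cont g z -> cont (fun w => f w * g w)%C z.
Proof. intros; now apply tends_mult. Qed.
Lemma cont_minus f g z : cont f z -> cont g z -> cont (fun w => f w - g w)%C z.
Proof. intros; now apply tends_minus. Qed.
Lemma cont_plus f g z : cont f z -> cont g z -> cont (fun w => f w + g w)%C z.
Proof. intros; now apply tends_plus. Qed.

(** * Goursat's theorem and the mean value property *)

Lemma dependent_choice (A : Type) (P : nat -> A -> Prop) (Q : nat -> A -> A -> Prop) (a0 : A) :
  P O a0 -> (forall n a, P n a -> exists b, P (S n) b /\ Q n a b) ->
  exists f : nat -> A, f O = a0 /\ forall n, P n (f n) /\ Q n (f n) (f (S n)).
Proof.
intros H0 H.
assert (step : forall n (s : {a | P n a}), {b : {b | P (S n) b} | Q n (proj1_sig s) (proj1_sig b)}).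
{ intros n [a Ha].
  destruct (constructive_indefinite_description _ (H n a Ha)) as [b [Hb Hq]].
  now exists (exist _ b Hb). }
pose (g := fix g n : {a | P n a} :=
  match n with O => exist _ a0 H0 | S n => proj1_sig (step n (g n)) end).
exists (fun n => proj1_sig (g n)); split; [reflexivity|].
intros n; split; [exact (proj2_sig (g n))|].
exact (proj2_sig (step n (g n))).
Qed.

(* Real form of complex differentiability at x + i y of u + i v, with derivative p + i q. *)
Definition cauchy_riemann (u v : R -> R -> R) (x y : R) : Prop :=
  exists p q, forall eps, 0 < eps -> exists d, 0 < d /\
    forall x' y', Rabs (x' - x) < d -> Rabs (y' - y) < d ->
      Rabs (u x' y' - u x y - (p * (x' - x) - q * (y' - y)))
        <= eps * (Rabs (x' - x) + Rabs (y' - y)) /\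
      Rabs (v x' y' - v x y - (q * (x' - x) + p * (y' - y)))
        <= eps * (Rabs (x' - x) + Rabs (y' - y)).

Lemma continuous_of_affine_bound (f : R -> R) (x c : R) :
  (exists d, 0 < d /\ forall x', Rabs (x' - x) < d ->
    Rabs (f x' - f x - c * (x' - x)) <= 1 * Rabs (x' - x)) ->
  continuous f x.
Proof.
intros (d & Hd & H).
intros P [eps HP].
set (K := Rabs c + 1).
assert (HK : 0 < K) by (unfold K; pose proof (Rabs_pos c); lra).
assert (Hm : 0 < Rmin d (eps / K)).
{ apply Rmin_pos; [exact Hd|]; apply Rdiv_lt_0_compat; [apply cond_pos|exact HK]. }
exists (mkposreal _ Hm); intros x' Hx; apply HP.
change (Rabs (x' - x) < Rmin d (eps / K)) in Hx.
change (Rabs (f x' - f x) < eps).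
assert (H1 : Rabs (x' - x) < d) by (apply Rlt_le_trans with (1 := Hx), Rmin_l).
assert (H2 : Rabs (x' - x) < eps / K) by (apply Rlt_le_trans with (1 := Hx), Rmin_r).
specialize (H x' H1).
apply Rlt_div_r in H2; [|exact HK].
replace (f x' - f x) with ((f x' - f x - c * (x' - x)) + c * (x' - x)) by ring.
apply Rle_lt_trans with (1 := Rabs_triang _ _).
rewrite (Rabs_mult c); unfold K in H2; lra.
Qed.

Lemma cauchy_riemann_continuous (u v : R -> R -> R) (x y : R) :
  cauchy_riemann u v x y ->
  (continuous (fun t => u t y) x /\ continuous (u x) y) /\
  (continuous (fun t => v t y) x /\ continuous (v x) y).
Proof.
intros (p & q & H); destruct (H 1 Rlt_0_1) as (d & Hd & K).
repeat split;
  [apply continuous_of_affine_bound with p | apply continuous_of_affine_bound with (- q)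
  |apply continuous_of_affine_bound with q | apply continuous_of_affine_bound with p];
  exists d; split; trivial; intros t Ht.
- destruct (K t y Ht) as [A _]; [rewrite Rminus_diag, Rabs_R0; exact Hd|].
  rewrite Rminus_diag, Rabs_R0, Rmult_0_r, Rplus_0_r, Rminus_0_r in A; exact A.
- destruct (K x t) as [A _]; trivial; [rewrite Rminus_diag, Rabs_R0; exact Hd|].
  rewrite Rminus_diag, Rabs_R0, Rmult_0_r, Rplus_0_l in A.
  replace (- q * (t - y)) with (0 - q * (t - y)) by ring; exact A.
- destruct (K t y Ht) as [_ A]; [rewrite Rminus_diag, Rabs_R0; exact Hd|].
  rewrite Rminus_diag, Rabs_R0, Rmult_0_r, !Rplus_0_r in A; exact A.
- destruct (K x t) as [_ A]; trivial; [rewrite Rminus_diag, Rabs_R0; exact Hd|].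
  rewrite Rminus_diag, Rabs_R0, Rmult_0_r, !Rplus_0_l in A; exact A.
Qed.

(* Imaginary part of the integral of (u + i v) dz around the rectangle with lower left
   corner (x, y) and sides a, b. *)
Definition rect_int (u v : R -> R -> R) (x y a b : R) : R :=
  RInt (fun t => u (x + a) t - u x t) y (y + b) - RInt (fun t => v t (y + b) - v t y) x (x + a).

Section Goursat.
Variables (u v : R -> R -> R) (X : R).
Hypothesis Huv : forall x y, x < X -> cauchy_riemann u v x y.

Lemma ex_RInt_u x y1 y2 : x < X -> ex_RInt (u x) y1 y2.
Proof.
intros Hx; apply (@ex_RInt_continuous R_CompleteNormedModule); intros y _.
apply (cauchy_riemann_continuous _ _ _ _ (Huv x y Hx)).
Qed.

Lemma ex_RInt_v y x1 x2 : x1 < X -> x2 < X -> ex_RInt (fun t => v t y) x1 x2.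
Proof.
intros H1 H2; apply (@ex_RInt_continuous R_CompleteNormedModule); intros x Hx.
apply (cauchy_riemann_continuous _ _ _ _ (Huv x y (Rle_lt_trans _ _ _ (proj2 Hx) (Rmax_lub_lt _ _ _ H1 H2)))).
Qed.

Lemma ex_RInt_du x x' y1 y2 : x < X -> x' < X -> ex_RInt (fun t => u x' t - u x t) y1 y2.
Proof.
intros H H'; apply (@ex_RInt_minus R_NormedModule); now apply ex_RInt_u.
Qed.

Lemma ex_RInt_dv y y' x1 x2 : x1 < X -> x2 < X -> ex_RInt (fun t => v t y' - v t y) x1 x2.
Proof.
intros H H'; apply (@ex_RInt_minus R_NormedModule); now apply ex_RInt_v.
Qed.

Lemma rect_int_split_x x y a b :
  0 <= a -> x + (a + a) < X ->
  rect_int u v x y (a + a) b = rect_int u v x y a b + rect_int u v (x + a) y a b.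
Proof.
intros Ha Hx; unfold rect_int.
replace (x + a + a) with (x + (a + a)) by ring.
assert (E1 : RInt (fun t => u (x + (a + a)) t - u x t) y (y + b)
   = RInt (fun t => u (x + a) t - u x t) y (y + b)
     + RInt (fun t => u (x + (a + a)) t - u (x + a) t) y (y + b)).
{ rewrite <- (@RInt_plus R_CompleteNormedModule) by (apply ex_RInt_du; lra).
  apply RInt_ext; intros t _.
  change (u (x + (a + a)) t - u x t = (u (x + a) t - u x t) + (u (x + (a + a)) t - u (x + a) t)); ring. }
assert (E2 : RInt (fun t => v t (y + b) - v t y) x (x + (a + a))
   = RInt (fun t => v t (y + b) - v t y) x (x + a)
     + RInt (fun t => v t (y + b) - v t y) (x + a) (x + (a + a))).
{ symmetry; apply (@RInt_Chasles R_CompleteNormedModule); apply ex_RInt_dv; lra. }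
rewrite E1, E2; ring.
Qed.

Lemma rect_int_split_y x y a b :
  0 <= a -> x + a < X ->
  rect_int u v x y a (b + b) = rect_int u v x y a b + rect_int u v x (y + b) a b.
Proof.
intros Ha Hx; unfold rect_int.
replace (y + b + b) with (y + (b + b)) by ring.
assert (E1 : RInt (fun t => v t (y + (b + b)) - v t y) x (x + a)
   = RInt (fun t => v t (y + b) - v t y) x (x + a)
     + RInt (fun t => v t (y + (b + b)) - v t (y + b)) x (x + a)).
{ rewrite <- (@RInt_plus R_CompleteNormedModule) by (apply ex_RInt_dv; lra).
  apply RInt_ext; intros t _.
  change (v t (y + (b + b)) - v t y = (v t (y + b) - v t y) + (v t (y + (b + b)) - v t (y + b))); ring. }
assert (E2 : RInt (fun t => u (x + a) t - u x t) y (y + (b + b))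
   = RInt (fun t => u (x + a) t - u x t) y (y + b)
     + RInt (fun t => u (x + a) t - u x t) (y + b) (y + (b + b))).
{ symmetry; apply (@RInt_Chasles R_CompleteNormedModule); apply ex_RInt_du; lra. }
rewrite E1, E2; ring.
Qed.

Lemma RInt_near_const (f : R -> R) c x a K :
  0 <= a -> ex_RInt f x (x + a) ->
  (forall t, x <= t <= x + a -> Rabs (f t - c) <= K) ->
  Rabs (RInt f x (x + a) - c * a) <= K * a.
Proof.
intros Ha Hf HK.
replace (RInt f x (x + a) - c * a) with (RInt (fun t => f t - c) x (x + a)).
- replace (K * a) with ((x + a - x) * K) by ring.
  apply abs_RInt_le_const; [lra| |exact HK].
  apply (@ex_RInt_minus R_NormedModule); [exact Hf|apply ex_RInt_const].
- etransitivity; [apply (@RInt_minus R_CompleteNormedModule); [exact Hf|apply ex_RInt_const]|].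
  rewrite (@RInt_const R_CompleteNormedModule).
  change (RInt f x (x + a) - (x + a - x) * c = RInt f x (x + a) - c * a); ring.
Qed.

(** The affine part of u + i v contributes [p * a * b] to both integrals and cancels; what remains
    is at most [eps * (a + b)] on sides of total size [a + b]. *)
Lemma rect_int_small x0 y0 eps :
  0 < eps -> x0 < X ->
  exists d, 0 < d /\ forall x y a b,
    0 <= a < d -> 0 <= b < d -> x <= x0 <= x + a -> y <= y0 <= y + b -> x + a < X ->
    Rabs (rect_int u v x y a b) <= eps * (a + b) ^ 2.
Proof.
intros He Hx0; destruct (Huv x0 y0 Hx0) as (p & q & H).
destruct (H (eps / 2)) as (d & Hd & K); [lra|].
exists d; split; [exact Hd|].
intros x y a b Ha Hb Hx Hy HX; unfold rect_int.
assert (K' : forall x' y', x <= x' <= x + a -> y <= y' <= y + b ->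
  Rabs (u x' y' - u x0 y0 - (p * (x' - x0) - q * (y' - y0))) <= eps / 2 * (a + b) /\
  Rabs (v x' y' - v x0 y0 - (q * (x' - x0) + p * (y' - y0))) <= eps / 2 * (a + b)).
{ intros x' y' Hx' Hy'.
  assert (Rabs (x' - x0) <= a) by (apply Rabs_le; lra).
  assert (Rabs (y' - y0) <= b) by (apply Rabs_le; lra).
  destruct (K x' y'); [lra|lra|].
  assert (eps / 2 * (Rabs (x' - x0) + Rabs (y' - y0)) <= eps / 2 * (a + b))
    by (apply Rmult_le_compat_l; lra).
  split; lra. }
assert (B1 : Rabs (RInt (fun t => u (x + a) t - u x t) y (y + b) - (p * a) * b) <= eps * (a + b) * b).
{ apply RInt_near_const; [lra|apply ex_RInt_du; lra|].
  intros t Ht; destruct (K' (x + a) t) as [A _]; [lra|lra|].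
  destruct (K' x t) as [B _]; [lra|lra|].
  replace (u (x + a) t - u x t - p * a) with
    ((u (x + a) t - u x0 y0 - (p * (x + a - x0) - q * (t - y0)))
     - (u x t - u x0 y0 - (p * (x - x0) - q * (t - y0)))) by ring.
  apply Rle_trans with (1 := Rabs_triang _ _); rewrite Rabs_Ropp; lra. }
assert (B2 : Rabs (RInt (fun t => v t (y + b) - v t y) x (x + a) - (p * b) * a) <= eps * (a + b) * a).
{ apply RInt_near_const; [lra|apply ex_RInt_dv; lra|].
  intros t Ht; destruct (K' t (y + b)) as [_ A]; [lra|lra|].
  destruct (K' t y) as [_ B]; [lra|lra|].
  replace (v t (y + b) - v t y - p * b) with
    ((v t (y + b) - v x0 y0 - (q * (t - x0) + p * (y + b - y0)))
     - (v t y - v x0 y0 - (q * (t - x0) + p * (y - y0)))) by ring.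
  apply Rle_trans with (1 := Rabs_triang _ _); rewrite Rabs_Ropp; lra. }
match goal with |- Rabs (?A - ?B) <= _ =>
  replace (A - B) with ((A - p * a * b) - (B - p * b * a)) by ring end.
apply Rle_trans with (1 := Rabs_triang _ _); rewrite Rabs_Ropp.
replace (eps * (a + b) ^ 2) with (eps * (a + b) * b + eps * (a + b) * a) by ring; lra.
Qed.

Lemma nested_halves (s : nat -> R) (a : R) :
  0 <= a -> (forall n, s n <= s (S n) /\ s (S n) + a / 2 ^ S n <= s n + a / 2 ^ n) ->
  exists l, forall n, s n <= l <= s n + a / 2 ^ n.
Proof.
intros Ha H.
assert (Hp : forall n, 0 <= a / 2 ^ n).
{ intros n; apply Rmult_le_pos; [exact Ha|]; left; apply Rinv_0_lt_compat, pow_lt; lra. }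
assert (Hup : forall n k, s n <= s (n + k)%nat /\ s (n + k)%nat + a / 2 ^ (n + k) <= s n + a / 2 ^ n).
{ intros n k; induction k as [|k IH]; [rewrite Nat.add_0_r; lra|].
  rewrite Nat.add_succ_r; destruct (H (n + k)%nat); lra. }
destruct (completeness (fun x => exists n, x = s n)) as [l [Hl Hl']].
- exists (s O + a / 2 ^ 0); intros x [n ->].
  destruct (Hup O n) as [_ K]; specialize (Hp n); simpl (0 + n)%nat in K; lra.
- now exists (s O), O.
- exists l; intros n; split; [apply Hl; now exists n|].
  apply Hl'; intros x [m ->].
  destruct (Nat.le_ge_cases n m) as [L|L].
  + destruct (Hup n (m - n)%nat) as [_ K].
    replace (n + (m - n))%nat with m in K by lia.
    specialize (Hp m); lra.
  + destruct (Hup m (n - m)%nat) as [K _].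
    replace (m + (n - m))%nat with n in K by lia.
    specialize (Hp n); lra.
Qed.

(** Some quarter of a rectangle carries at least a quarter of the integral. Along the resulting
    nested rectangles both this lower bound and the bound of [rect_int_small] at the common point
    scale like 4^(-n), so a small [eps] gives a contradiction. *)
Theorem goursat x y a b : 0 <= a -> 0 <= b -> x + a < X -> rect_int u v x y a b = 0.
Proof.
intros Ha Hb HX.
destruct (Req_dec (rect_int u v x y a b) 0) as [E|E]; [exact E|exfalso].
set (eta := Rabs (rect_int u v x y a b)).
assert (Heta : 0 < eta) by now apply Rabs_pos_lt.
assert (Hpos : forall c n, 0 <= c -> 0 <= c / 2 ^ n).
{ intros c n Hc; apply Rmult_le_pos; [exact Hc|]; left; apply Rinv_0_lt_compat, pow_lt; lra. }
assert (Hhalf : forall c n, c / 2 ^ n = c / 2 ^ S n + c / 2 ^ S n).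
{ intros c n; simpl; field; apply pow_nonzero; lra. }
destruct (dependent_choice (R * R)
  (fun n c => eta / 4 ^ n <= Rabs (rect_int u v (fst c) (snd c) (a / 2 ^ n) (b / 2 ^ n))
     /\ fst c + a / 2 ^ n < X)
  (fun n c c' => (fst c <= fst c' /\ fst c' + a / 2 ^ S n <= fst c + a / 2 ^ n) /\
                 (snd c <= snd c' /\ snd c' + b / 2 ^ S n <= snd c + b / 2 ^ n)) (x, y))
  as (f & _ & Hf).
- simpl; rewrite !Rdiv_1_r; split; [apply Rle_refl|exact HX].
- intros n [x1 y1] [H1 H2]; simpl fst in *; simpl snd in *.
  pose proof (Hpos a (S n) Ha) as Pa; pose proof (Hpos b (S n) Hb) as Pb.
  assert (E4 : eta / 4 ^ n = 4 * (eta / 4 ^ S n)).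
  { simpl; field; apply pow_nonzero; lra. }
  rewrite E4 in H1; clear E4.
  rewrite (Hhalf a n) in H1, H2 |- *; rewrite (Hhalf b n) in H1 |- *.
  set (a' := a / 2 ^ S n) in *; set (b' := b / 2 ^ S n) in *; set (e := eta / 4 ^ S n) in *.
  rewrite rect_int_split_x in H1 by lra.
  rewrite !rect_int_split_y in H1 by lra.
  destruct (Rle_dec e (Rabs (rect_int u v x1 y1 a' b'))) as [L1|L1].
  { exists (x1, y1); simpl; repeat split; lra. }
  destruct (Rle_dec e (Rabs (rect_int u v x1 (y1 + b') a' b'))) as [L2|L2].
  { exists (x1, y1 + b'); simpl; repeat split; lra. }
  destruct (Rle_dec e (Rabs (rect_int u v (x1 + a') y1 a' b'))) as [L3|L3].
  { exists (x1 + a', y1); simpl; repeat split; lra. }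
  destruct (Rle_dec e (Rabs (rect_int u v (x1 + a') (y1 + b') a' b'))) as [L4|L4].
  { exists (x1 + a', y1 + b'); simpl; repeat split; lra. }
  exfalso.
  pose proof (Rabs_triang (rect_int u v x1 y1 a' b' + rect_int u v x1 (y1 + b') a' b')
    (rect_int u v (x1 + a') y1 a' b' + rect_int u v (x1 + a') (y1 + b') a' b')).
  pose proof (Rabs_triang (rect_int u v x1 y1 a' b') (rect_int u v x1 (y1 + b') a' b')).
  pose proof (Rabs_triang (rect_int u v (x1 + a') y1 a' b') (rect_int u v (x1 + a') (y1 + b') a' b')).
  lra.
- destruct (nested_halves (fun n => fst (f n)) a Ha (fun n => proj1 (proj2 (Hf n)))) as [x0 Hx0].
  destruct (nested_halves (fun n => snd (f n)) b Hb (fun n => proj2 (proj2 (Hf n)))) as [y0 Hy0].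
  assert (Hx0X : x0 < X).
  { destruct (Hf O) as [[_ H] _]; specialize (Hx0 O); lra. }
  (* This makes [eps * (a + b) ^ 2] smaller than [eta]; the summand 1 covers the degenerate
     rectangle with [a + b = 0]. *)
  set (eps := eta / (2 * ((a + b) ^ 2 + 1))).
  assert (Heps : 0 < eps) by (apply Rdiv_lt_0_compat; nra).
  destruct (rect_int_small x0 y0 eps Heps Hx0X) as (d & Hd & K).
  assert (Hn : exists n, a / 2 ^ n < d /\ b / 2 ^ n < d).
  { destruct (pow_lt_1_zero (/ 2)) with (y := d / (a + b + 1)) as [N HN].
    - rewrite Rabs_pos_eq; lra.
    - apply Rdiv_lt_0_compat; lra.
    - exists N; specialize (HN N (Nat.le_refl N)).
      assert (Hp : 0 < (/ 2) ^ N) by (apply pow_lt; lra).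
      rewrite Rabs_pos_eq in HN by lra.
      apply Rlt_div_r in HN; [|lra].
      unfold Rdiv; rewrite <- pow_inv; split; nra. }
  destruct Hn as (n & Hna & Hnb).
  destruct (Hf n) as [[H1 H2] _].
  specialize (K (fst (f n)) (snd (f n)) (a / 2 ^ n) (b / 2 ^ n)
    (conj (Hpos a n Ha) Hna) (conj (Hpos b n Hb) Hnb) (Hx0 n) (Hy0 n) H2).
  pose proof (Rle_trans _ _ _ H1 K) as L.
  assert (P2 : 0 < 2 ^ n) by (apply pow_lt; lra).
  replace (4 ^ n) with (2 ^ n * 2 ^ n) in L by (rewrite <- Rpow_mult_distr; f_equal; ring).
  replace (a / 2 ^ n + b / 2 ^ n) with ((a + b) / 2 ^ n) in L by (field; lra).
  replace (eps * ((a + b) / 2 ^ n) ^ 2) with (eps * (a + b) ^ 2 / (2 ^ n * 2 ^ n)) in L by (field; lra).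
  apply Rmult_le_reg_r in L; [|apply Rinv_0_lt_compat; nra].
  unfold eps in L.
  replace (eta / (2 * ((a + b) ^ 2 + 1)) * (a + b) ^ 2) with
    (eta * ((a + b) ^ 2 / (2 * ((a + b) ^ 2 + 1)))) in L by (field; nra).
  assert ((a + b) ^ 2 / (2 * ((a + b) ^ 2 + 1)) < 1) by (apply Rlt_div_l; nra).
  nra.
Qed.

(** Periodicity makes the two horizontal sides of the rectangle cancel. *)
Lemma periodic_strip_integral L x1 x2 :
  0 <= L -> (forall x, v x L = v x 0) -> x1 <= x2 -> x2 < X ->
  RInt (u x1) 0 L = RInt (u x2) 0 L.
Proof.
intros HL Hper Hx HX.
pose proof (goursat x1 0 (x2 - x1) L) as G; unfold rect_int in G.
replace (x1 + (x2 - x1)) with x2 in G by ring; rewrite !Rplus_0_l in G.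
rewrite (RInt_ext (fun t => v t L - v t 0) (fun _ => 0)) in G
  by (intros t _; change (v t L - v t 0 = 0); rewrite Hper; ring).
rewrite (@RInt_const R_CompleteNormedModule) in G.
assert (G' : RInt (fun t => u x2 t - u x1 t) 0 L = RInt (u x2) 0 L - RInt (u x1) 0 L).
{ apply (@RInt_minus R_CompleteNormedModule); apply ex_RInt_u; lra. }
rewrite G' in G.
assert (G0 : RInt (u x2) 0 L - RInt (u x1) 0 L - (x2 - x1) * 0 = 0) by (apply G; lra).
lra.
Qed.

End Goursat.

(** * The complex exponential and circular means *)

Lemma Cmod_le_sum (z : C) : Cmod z <= Rabs (Re z) + Rabs (Im z).
Proof.
pose proof (Rabs_pos (Re z)); pose proof (Rabs_pos (Im z)).
apply Rsqr_incr_0_var; [|lra].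
rewrite !Rsqr_pow2, Cmod2_alt.
rewrite <- (pow2_abs (Re z)), <- (pow2_abs (Im z)); nra.
Qed.

Definition cexp (z : C) : C := (exp (Re z) * cos (Im z), exp (Re z) * sin (Im z)).
Definition cis (t : R) : C := (cos t, sin t).

Lemma cexp_plus z w : cexp (z + w)%C = (cexp z * cexp w)%C.
Proof.
destruct z as [x y], w as [x' y']; unfold cexp; simpl.
rewrite exp_plus, cos_plus, sin_plus; unfold Cmult; simpl; f_equal; ring.
Qed.

Lemma Cmod_cis t : Cmod (cis t) = 1.
Proof.
unfold cis, Cmod; simpl.
replace (cos t * (cos t * 1) + sin t * (sin t * 1)) with 1; [apply sqrt_1|].
pose proof (sin2_cos2 t) as H; unfold Rsqr in H; lra.
Qed.

Lemma cexp_polar x y : cexp (x, y) = (RtoC (exp x) * cis y)%C.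
Proof. unfold cexp, cis, RtoC, Cmult; simpl; f_equal; ring. Qed.

Lemma Cmod_cexp z : Cmod (cexp z) = exp (Re z).
Proof.
destruct z as [x y]; rewrite cexp_polar, Cmod_mult, Cmod_cis, Cmod_R, Rabs_pos_eq; simpl; [ring|].
left; apply exp_pos.
Qed.

Lemma derivable_pt_lim_bound f x l :
  derivable_pt_lim f x l -> forall eps, 0 < eps ->
  exists d, 0 < d /\ forall h, Rabs h < d -> Rabs (f (x + h) - f x - l * h) <= eps * Rabs h.
Proof.
intros H eps He; destruct (H eps He) as [d Hd]; exists d; split; [apply cond_pos|].
intros h Hh; destruct (Req_dec h 0) as [->|N].
- rewrite Rplus_0_r, Rmult_0_r, Rabs_R0.
  replace (f x - f x - 0) with 0 by ring; rewrite Rabs_R0; lra.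
- specialize (Hd h N Hh).
  replace (f (x + h) - f x - l * h) with (((f (x + h) - f x) / h - l) * h) by (field; exact N).
  rewrite Rabs_mult; apply Rmult_le_compat_r; [apply Rabs_pos|lra].
Qed.

Lemma cexp_cderiv0 : cderiv cexp 0 1.
Proof.
apply cderiv_of_bound; intros eps He.
(* The error terms below add up to at most [9 * (e * m)], so [eps / 16] is ample; [e <= 1] bounds
   [exp x] by 3. *)
set (e := Rmin 1 (eps / 16)).
assert (He1 : 0 < e <= 1) by (split; [apply Rmin_pos; lra|apply Rmin_l]).
assert (He2 : e <= eps / 16) by apply Rmin_r.
destruct (derivable_pt_lim_bound _ _ _ (derivable_pt_lim_exp 0) e) as (d1 & Hd1 & K1); [lra|].
destruct (derivable_pt_lim_bound _ _ _ (derivable_pt_lim_sin 0) e) as (d2 & Hd2 & K2); [lra|].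
destruct (derivable_pt_lim_bound _ _ _ (derivable_pt_lim_cos 0) e) as (d3 & Hd3 & K3); [lra|].
rewrite exp_0 in K1; rewrite sin_0, cos_0 in K2; rewrite sin_0, cos_0 in K3.
set (d := Rmin e (Rmin d1 (Rmin d2 d3))).
assert (Hd : 0 < d) by (unfold d; repeat apply Rmin_pos; lra).
exists d; split; [exact Hd|].
intros [x y] Hw.
assert (E0 : forall c : C, (c - 0)%C = c) by (intros; ring).
rewrite E0 in Hw |- *.
pose proof (re_le_Cmod (x, y)) as Hx; pose proof (im_le_Cmod (x, y)) as Hy; simpl in Hx, Hy.
assert (Dx : d <= e) by apply Rmin_l.
assert (D1 : d <= d1) by (eapply Rle_trans; [apply Rmin_r|apply Rmin_l]).
assert (D2 : d <= d2).
{ eapply Rle_trans; [apply Rmin_r|]; eapply Rle_trans; [apply Rmin_r|apply Rmin_l]. }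
assert (D3 : d <= d3).
{ eapply Rle_trans; [apply Rmin_r|]; eapply Rle_trans; [apply Rmin_r|apply Rmin_r]. }
specialize (K1 x ltac:(lra)); specialize (K2 y ltac:(lra)); specialize (K3 y ltac:(lra)).
rewrite !Rplus_0_l in K1, K2, K3.
rewrite Ropp_0, Rmult_0_l, Rminus_0_r in K3.
rewrite Rminus_0_r in K2.
set (m := Cmod (x, y)) in *.
assert (Hm : 0 <= m) by apply Cmod_ge_0.
assert (Hxe : e * Rabs x <= e * m) by (apply Rmult_le_compat_l; lra).
assert (Hye : e * Rabs y <= e * m) by (apply Rmult_le_compat_l; lra).
assert (Hex : Rabs (exp x) <= 3).
{ replace (exp x) with ((exp x - 1 - 1 * x) + (1 + x)) by ring.
  apply Rle_trans with (1 := Rabs_triang _ _).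
  pose proof (Rabs_triang 1 x); rewrite Rabs_R1 in *.
  assert (e * Rabs x <= 1 * 1) by (apply Rmult_le_compat; try apply Rabs_pos; lra).
  lra. }
apply Rle_trans with (1 := Cmod_le_sum _).
replace (Re (cexp (x, y) - cexp 0 - 1 * (x, y))%C) with
  (exp x * (cos y - 1) + (exp x - 1 - 1 * x))
  by (unfold cexp; simpl; rewrite exp_0, cos_0; ring).
replace (Im (cexp (x, y) - cexp 0 - 1 * (x, y))%C) with
  (exp x * (sin y - 1 * y) + ((exp x - 1 - 1 * x) * y + x * y))
  by (unfold cexp; simpl; rewrite exp_0, sin_0; ring).
assert (A1 : Rabs (exp x * (cos y - 1)) <= 3 * (e * m)).
{ rewrite Rabs_mult; apply Rmult_le_compat; try apply Rabs_pos; lra. }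
assert (A2 : Rabs (exp x * (sin y - 1 * y)) <= 3 * (e * m)).
{ rewrite Rabs_mult; apply Rmult_le_compat; try apply Rabs_pos; lra. }
assert (A3 : Rabs ((exp x - 1 - 1 * x) * y) <= (e * m) * 1).
{ rewrite Rabs_mult; apply Rmult_le_compat; try apply Rabs_pos; lra. }
assert (A4 : Rabs (x * y) <= e * m).
{ rewrite Rabs_mult; apply Rmult_le_compat; try apply Rabs_pos; lra. }
pose proof (Rabs_triang (exp x * (cos y - 1)) (exp x - 1 - 1 * x)).
pose proof (Rabs_triang (exp x * (sin y - 1 * y)) ((exp x - 1 - 1 * x) * y + x * y)).
pose proof (Rabs_triang ((exp x - 1 - 1 * x) * y) (x * y)).
assert (16 * (e * m) <= eps * m) by nra.
assert (0 <= e * m) by (apply Rmult_le_pos; lra).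
lra.
Qed.

Lemma cexp_cderiv z : cderiv cexp z (cexp z).
Proof.
apply cderiv_ext with (fun w => cexp z * cexp (w - z))%C.
{ intros w; rewrite <- cexp_plus; f_equal; ring. }
apply (eq_ind (0 * cexp (z - z) + cexp z * (1 * (1 + 0)))%C (fun l => cderiv _ z l)); [|ring].
apply (cderiv_mult (fun _ => cexp z) (fun w => cexp (w - z)%C)); [apply cderiv_const|].
apply (cderiv_comp cexp (fun w => w - z)%C).
- apply (cderiv_plus (fun w => w) (fun _ => - z)%C); [apply cderiv_id|apply cderiv_const].
- replace (z - z)%C with (RtoC 0) by ring; apply cexp_cderiv0.
Qed.

Lemma cdiff_cauchy_riemann (h : C -> C) x y :
  cdiff h (x, y) ->
  cauchy_riemann (fun s t => Re (h (s, t))) (fun s t => Im (h (s, t))) x y.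
Proof.
intros [[p q] H]; exists p, q; intros eps He.
destruct (cderiv_bound _ _ _ H eps He) as (d & Hd & K).
exists (d / 2); split; [lra|]; intros x' y' Hx Hy.
assert (Hs : Cmod ((x', y') - (x, y))%C <= Rabs (x' - x) + Rabs (y' - y)).
{ apply (Rle_trans _ _ _ (Cmod_le_sum _)); apply Req_le; reflexivity. }
specialize (K (x', y')).
assert (K' := K ltac:(lra)).
assert (E : eps * Cmod ((x', y') - (x, y))%C <= eps * (Rabs (x' - x) + Rabs (y' - y)))
  by (apply Rmult_le_compat_l; lra).
pose proof (re_le_Cmod (h (x', y') - h (x, y) - (p, q) * ((x', y') - (x, y)))%C) as A.
pose proof (im_le_Cmod (h (x', y') - h (x, y) - (p, q) * ((x', y') - (x, y)))%C) as B.
split.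
- replace (Re (h (x', y')) - Re (h (x, y)) - (p * (x' - x) - q * (y' - y)))
    with (Re (h (x', y') - h (x, y) - (p, q) * ((x', y') - (x, y)))%C); [lra|].
  rewrite !Re_minus; simpl; ring.
- replace (Im (h (x', y')) - Im (h (x, y)) - (q * (x' - x) + p * (y' - y)))
    with (Im (h (x', y') - h (x, y) - (p, q) * ((x', y') - (x, y)))%C); [lra|].
  rewrite !Im_minus; simpl; ring.
Qed.

(* In the coordinates a + exp (s + i t) the punctured disk becomes a half-plane, circles
   become vertical segments, and Goursat's theorem for rectangles shows that the circular
   means do not depend on the radius. *)
Lemma mean_value (f : C -> C) (a : C) (r rho : R) :
  (forall z, 0 < Cmod (z - a)%C < r -> cdiff f z) -> cont f a -> 0 < rho < r ->
  ex_RInt (fun t => Re (f (a + RtoC rho * cis t)%C)) 0 (2 * PI) /\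
  RInt (fun t => Re (f (a + RtoC rho * cis t)%C)) 0 (2 * PI) = 2 * PI * Re (f a).
Proof.
intros Hf Ca Hrho.
set (h := fun z => f (a + cexp z)%C).
assert (HPI : 0 < 2 * PI) by (pose proof PI_RGT_0; lra).
assert (Hh : forall x y, x < ln r -> cauchy_riemann (fun s t => Re (h (s, t))) (fun s t => Im (h (s, t))) x y).
{ intros x y Hx; apply cdiff_cauchy_riemann.
  destruct (Hf (a + cexp (x, y))%C) as [l Hl].
  { replace (a + cexp (x, y) - a)%C with (cexp (x, y)) by ring.
    rewrite Cmod_cexp; simpl; split; [apply exp_pos|].
    rewrite <- (exp_ln r) by lra; now apply exp_increasing. }
  exists (l * (0 + cexp (x, y)))%C.
  apply (cderiv_comp f (fun z => a + cexp z)%C); [|exact Hl].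
  apply (cderiv_plus (fun _ => a) cexp); [apply cderiv_const|apply cexp_cderiv]. }
assert (Hhx : forall x y, h (x, y) = f (a + RtoC (exp x) * cis y)%C).
{ intros; unfold h; now rewrite cexp_polar. }
assert (Hln : ln rho < ln r) by (apply ln_increasing; lra).
assert (Hex : forall x, x < ln r -> ex_RInt (fun t => Re (h (x, t))) 0 (2 * PI)).
{ intros x Hx; exact (ex_RInt_u _ _ _ Hh x 0 (2 * PI) Hx). }
assert (Eh : forall t, h (ln rho, t) = f (a + RtoC rho * cis t)%C).
{ intros t; rewrite Hhx, exp_ln by lra; reflexivity. }
split.
{ apply ex_RInt_ext with (fun t => Re (h (ln rho, t))); [intros t _; now rewrite Eh|].
  now apply Hex. }
rewrite <- (RInt_ext (fun t => Re (h (ln rho, t)))) by (intros t _; now rewrite Eh).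
apply cond_eq; intros eps He.
assert (He' : 0 < eps / (2 * PI) / 2).
{ apply Rdiv_lt_0_compat; [apply Rdiv_lt_0_compat; lra|lra]. }
destruct (Ca _ He') as (d & Hd & K).
(* [exp s] is the radius of a circle so small that [f] differs from [f a] by less than eps / (4 pi)
   on it. Only continuity at [a] enters, so [a] may be a puncture. *)
set (s := Rmin (ln rho) (ln (d / 2))).
assert (Hs : s <= ln rho) by apply Rmin_l.
assert (Es : exp s < d).
{ apply Rle_lt_trans with (d / 2); [|lra].
  rewrite <- (exp_ln (d / 2)) by lra.
  destruct (Rle_lt_or_eq_dec s (ln (d / 2)) (Rmin_r _ _)) as [L|L].
  - left; now apply exp_increasing.
  - rewrite L; apply Rle_refl. }
assert (P := periodic_strip_integral _ _ _ Hh (2 * PI) s (ln rho) ltac:(lra)).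
assert (Per : forall x, Im (h (x, 2 * PI)) = Im (h (x, 0))).
{ intros x; rewrite !Hhx; unfold cis; now rewrite cos_2PI, sin_2PI, cos_0, sin_0. }
specialize (P Per Hs Hln); cbv beta in P.
rewrite <- P.
pose proof (RInt_near_const (fun t => Re (h (s, t))) (Re (f a)) 0 (2 * PI) (eps / (2 * PI) / 2)) as B.
rewrite Rplus_0_l in B.
replace (2 * PI * Re (f a)) with (Re (f a) * (2 * PI)) by ring.
apply Rle_lt_trans with (eps / (2 * PI) / 2 * (2 * PI)).
- apply B; [lra|apply Hex; lra|].
  intros t _; rewrite <- Re_minus.
  apply Rle_trans with (1 := re_le_Cmod _); left; rewrite Hhx; apply K.
  replace (a + RtoC (exp s) * cis t - a)%C with (RtoC (exp s) * cis t)%C by ring.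
  rewrite Cmod_mult, Cmod_cis, Cmod_R, Rabs_pos_eq; [lra|left; apply exp_pos].
- replace (eps / (2 * PI) / 2 * (2 * PI)) with (eps / 2) by (field; pose proof PI_RGT_0; lra); lra.
Qed.

(** * The maximum principle *)

Lemma real_cluster (u : nat -> R) (K : R) :
  (forall n, Rabs (u n) <= K) ->
  exists l, forall eps, 0 < eps -> forall N, exists n, (N <= n)%nat /\ Rabs (u n - l) < eps.
Proof.
intros H.
destruct (Bolzano_Weierstrass u (fun x => - K <= x <= K)) as [l Hl].
- apply compact_P3.
- intros n; specialize (H n); now apply Rabs_le_between in H.
- exists l; intros eps He N.
  destruct (Hl (disc l (mkposreal eps He)) N) as (n & Hn & D).
  + now exists (mkposreal eps He).
  + now exists n.
Qed.

Lemma complex_cluster (z : nat -> C) (K : R) :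
  (forall n, Cmod (z n) <= K) ->
  exists l, forall eps, 0 < eps -> forall N, exists n, (N <= n)%nat /\ Cmod (z n - l)%C < eps.
Proof.
intros H.
destruct (real_cluster (fun n => Re (z n)) K) as [a Ha].
{ intros n; apply Rle_trans with (1 := re_le_Cmod _); apply H. }
assert (Hs : forall k, exists n, (k <= n)%nat /\ Rabs (Re (z n) - a) < / INR (S k)).
{ intros k; apply Ha, Rinv_0_lt_compat, lt_0_INR; lia. }
apply choice in Hs; destruct Hs as [s Hs].
destruct (real_cluster (fun k => Im (z (s k))) K) as [b Hb].
{ intros n; apply Rle_trans with (1 := im_le_Cmod _); apply H. }
exists (a, b); intros eps He N.
destruct (archimed_cor1 (eps / 2)) as (m & Hm & Hm0); [lra|].
destruct (Hb (eps / 2) ltac:(lra) (max N m)) as (k & Hk & Hbk).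
exists (s k); destruct (Hs k) as [Hsk Hak]; split; [lia|].
apply Rle_lt_trans with (1 := Cmod_le_sum _).
rewrite Re_minus, Im_minus; simpl Re; simpl Im.
assert (/ INR (S k) <= / INR m).
{ apply Rinv_le_contravar; [now apply lt_0_INR|apply le_INR; lia]. }
lra.
Qed.

(** Composing with [atan] bounds the values, so their supremum exists before [U] is known to be
    bounded; strict monotonicity then carries the maximum back to [U]. *)
Lemma disk_max (U : C -> R) (r : R) :
  0 <= r ->
  (forall z, Cmod z <= r -> tends (ball_filter z) (fun w => RtoC (U w)) (RtoC (U z))) ->
  exists a, Cmod a <= r /\ forall z, Cmod z <= r -> U z <= U a.
Proof.
intros Hr HU.
destruct (completeness (fun x => exists z, Cmod z <= r /\ x = atan (U z))) as [m [Hm1 Hm2]].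
- exists (PI / 2); intros x (z & _ & ->); destruct (atan_bound (U z)); lra.
- exists (atan (U 0)), 0; split; [now rewrite Cmod_0|reflexivity].
- assert (Hs : forall n, exists z, Cmod z <= r /\ m - / INR (S n) < atan (U z)).
  { intros n; apply NNPP; intros N.
    assert (L : m <= m - / INR (S n)).
    { apply Hm2; intros x (z & Hz & ->).
      apply Rnot_lt_le; intros L; apply N; now exists z. }
    assert (0 < / INR (S n)) by (apply Rinv_0_lt_compat, lt_0_INR; lia); lra. }
  apply choice in Hs; destruct Hs as [s Hs].
  destruct (complex_cluster s r (fun n => proj1 (Hs n))) as [a Ha].
  assert (Hra : Cmod a <= r).
  { apply le_epsilon; intros eps He; destruct (Ha eps He O) as (n & _ & Hn).
    pose proof (proj1 (Hs n)); pose proof (Cmod_diff_le a (s n)) as D.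
    replace (a - s n)%C with (- (s n - a))%C in D by ring; rewrite Cmod_opp in D.
    apply Rabs_le_between in D; lra. }
  exists a; split; [exact Hra|].
  intros z Hz; apply Rnot_lt_le; intros L.
  set (c := (U a + U z) / 2).
  assert (Hc : atan c < atan (U z)) by (apply atan_increasing; unfold c; lra).
  assert (Hzm : atan (U z) <= m) by (apply Hm1; now exists z).
  pose proof (proj1 (tends_R _ _) (HU a Hra)) as T.
  destruct (T ((U z - U a) / 2)) as (d & Hd & K); [lra|].
  destruct (archimed_cor1 (m - atan c)) as (N & HN & HN0); [lra|].
  destruct (Ha d Hd N) as (n & Hn & Hna).
  specialize (K _ Hna).
  apply Rabs_def2 in K.
  assert (U (s n) < c) by (unfold c; lra).
  assert (atan (U (s n)) < atan c) by now apply atan_increasing.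
  assert (/ INR (S n) <= / INR N).
  { apply Rinv_le_contravar; [now apply lt_0_INR|apply le_INR; lia]. }
  pose proof (proj2 (Hs n)); lra.
Qed.

(* Holomorphic on the disk up to isolated points, where only continuity is known; such
   points are removable, but the maximum principle does not need this. *)
Definition almost_hol (g : C -> C) : Prop :=
  forall z, in_disk z -> cont g z /\
    exists d, 0 < d /\ forall w, w <> z -> Cmod (w - z)%C < d -> in_disk w -> cdiff g w.

Lemma Cmod_sub_sym (a b : C) : Cmod (a - b)%C = Cmod (b - a)%C.
Proof. rewrite <- Cmod_opp; f_equal; ring. Qed.

Lemma in_disk_ball z w : Cmod (w - z)%C < 1 - Cmod z -> in_disk w.
Proof.
unfold in_disk; intros H; pose proof (Cmod_diff_le w z) as D.
apply Rabs_le_between in D; lra.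
Qed.

(** The term [eps * Cmod w ^ 2] makes the function strictly subharmonic: an interior maximum
    contradicts the mean value property at once, without any connectedness argument. *)
Lemma max_principle_Re (g : C -> C) (r m : R) :
  almost_hol g -> 0 <= r < 1 -> (forall z, Cmod z = r -> Re (g z) <= m) ->
  forall z, Cmod z <= r -> Re (g z) <= m.
Proof.
intros Hg Hr Hm z Hz; apply le_epsilon; intros eps He.
destruct (disk_max (fun w => Re (g w) + eps * Cmod w ^ 2) r) as (a & Ha & Hmax).
{ lra. }
{ intros w Hw; destruct (Hg w) as [Cg _]; [unfold in_disk; lra|].
  apply tends_ext with (fun x => RtoC (Re (g x)) + RtoC eps * (RtoC (Cmod x) * RtoC (Cmod x)))%C.
  { intros x; rewrite RtoC_plus, RtoC_mult, RtoC_pow; ring. }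
  replace (RtoC (Re (g w) + eps * Cmod w ^ 2)) with
    (RtoC (Re (g w)) + RtoC eps * (RtoC (Cmod w) * RtoC (Cmod w)))%C
    by (rewrite RtoC_plus, RtoC_mult, RtoC_pow; ring).
  apply tends_plus; [apply tends_Re, Cg|].
  apply tends_mult; [apply tends_const|].
  apply tends_mult; apply tends_Cmod, tends_id. }
assert (Hz' := Hmax z Hz); cbv beta in Hz'.
pose proof (pow2_ge_0 (Cmod z)).
destruct (Rle_lt_or_eq_dec _ _ Ha) as [La|Ea].
2: { specialize (Hm a Ea); rewrite Ea in Hz'. assert (r ^ 2 <= 1) by nra. nra. }
exfalso.
destruct (Hg a) as [Ca (d & Hd & Da)]; [unfold in_disk; lra|].
set (rad := Rmin d (r - Cmod a)).
assert (Hrad : 0 < rad) by (apply Rmin_pos; lra).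
(* Expanding [Cmod w ^ 2] around [a], the linear term 2 Re (conj(a) w) is harmonic and is moved into
   [G]. Maximality at [a] then reads Re G(w) <= Re G(a) - eps |w - a|^2, and averaging over a circle
   contradicts the mean value property. *)
set (c := (RtoC (2 * eps) * Cconj a)%C).
set (G := fun w => (g w + c * w)%C).
destruct (mean_value G a rad (rad / 2)) as [Ex E].
- intros w [Hw1 Hw2].
  assert (w <> a).
  { intros ->; replace (a - a)%C with (RtoC 0) in Hw1 by ring; rewrite Cmod_0 in Hw1; lra. }
  apply cdiff_plus; [|apply cdiff_mult; [apply cdiff_const|apply cdiff_id]].
  apply Da; trivial.
  + apply Rlt_le_trans with (1 := Hw2), Rmin_l.
  + apply in_disk_ball with a; apply Rlt_le_trans with (1 := Hw2).
    apply Rle_trans with (1 := Rmin_r _ _); lra.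
- apply cont_plus; [exact Ca|]; apply cont_mult; [apply tends_const|apply tends_id].
- lra.
- assert (HPI := PI_RGT_0).
  assert (B : RInt (fun t => Re (G (a + RtoC (rad / 2) * cis t)%C)) 0 (2 * PI)
    <= RInt (fun _ => Re (G a) - eps * (rad / 2) ^ 2) 0 (2 * PI)).
  { apply RInt_le; [lra|exact Ex|apply ex_RInt_const|].
    intros t _.
    set (w := (a + RtoC (rad / 2) * cis t)%C).
    assert (Hw : Cmod (w - a)%C = rad / 2).
    { unfold w; replace (a + RtoC (rad / 2) * cis t - a)%C with (RtoC (rad / 2) * cis t)%C by ring.
      rewrite Cmod_mult, Cmod_cis, Cmod_R, Rabs_pos_eq; lra. }
    assert (Hwr : Cmod w <= r).
    { pose proof (Cmod_diff_le w a) as D; rewrite Hw in D; apply Rabs_le_between in D.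
      assert (rad <= r - Cmod a) by apply Rmin_r; lra. }
    specialize (Hmax w Hwr); cbv beta in Hmax.
    unfold G, c; rewrite <- Hw.
    rewrite !Cmod2_alt in *.
    rewrite !re_plus, Re_minus, Im_minus.
    destruct w as [w1 w2], a as [a1 a2]; simpl in *; nra. }
  rewrite E in B.
  rewrite (@RInt_const R_CompleteNormedModule) in B.
  assert (B' : 2 * PI * Re (G a) <= (2 * PI - 0) * (Re (G a) - eps * (rad / 2) ^ 2)) by exact B.
  assert (0 < eps * (rad / 2) ^ 2) by (apply Rmult_lt_0_compat; [exact He|apply pow_lt; lra]).
  nra.
Qed.

Lemma almost_hol_mult_const g c : almost_hol g -> almost_hol (fun w => c * g w)%C.
Proof.
intros H z Hz; destruct (H z Hz) as [Cg (d & Hd & D)]; split.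
- apply cont_mult; [apply tends_const|exact Cg].
- exists d; split; [exact Hd|]; intros w H1 H2 H3.
  apply cdiff_mult; [apply cdiff_const|now apply D].
Qed.

Lemma max_principle (g : C -> C) (r m : R) :
  almost_hol g -> 0 <= r < 1 -> (forall z, Cmod z = r -> Cmod (g z) <= m) ->
  forall z, Cmod z <= r -> Cmod (g z) <= m.
Proof.
intros Hg Hr Hm z Hz.
destruct (Ceq_dec (g z) 0) as [E|N].
- rewrite E, Cmod_0.
  apply Rle_trans with (Cmod (g (RtoC r))); [apply Cmod_ge_0|].
  apply Hm; rewrite Cmod_R; apply Rabs_pos_eq; lra.
- set (c := (Cconj (g z) / RtoC (Cmod (g z)))%C).
  assert (Nm : 0 < Cmod (g z)) by now apply Cmod_gt_0.
  assert (Nc : RtoC (Cmod (g z)) <> RtoC 0) by (intros E; apply RtoC_inj in E; lra).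
  assert (Hc : Cmod c = 1).
  { unfold c; rewrite Cmod_div by exact Nc.
    rewrite Cmod_conj, Cmod_R, Rabs_pos_eq by lra; field; lra. }
  replace (Cmod (g z)) with (Re (c * g z)%C).
  + apply (max_principle_Re (fun w => c * g w)%C r m); trivial.
    * now apply almost_hol_mult_const.
    * intros w Hw; specialize (Hm w Hw).
      apply Rle_trans with (Cmod (c * g w)%C).
      { apply Rle_trans with (2 := re_le_Cmod _), Rle_abs. }
      rewrite Cmod_mult, Hc; lra.
  + replace (c * g z)%C with (RtoC (Cmod (g z))); [reflexivity|].
    unfold c.
    replace (Cconj (g z) / RtoC (Cmod (g z)) * g z)%C with ((g z * Cconj (g z)) / RtoC (Cmod (g z)))%C
      by (field; exact Nc).
    rewrite <- Cmod2_conj, RtoC_pow; field; exact Nc.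
Qed.

(** * The Schwarz-Pick lemma and the hyperbolic difference quotient *)

Definition mob (a z : C) : C := ((z - a) / (1 - Cconj a * z))%C.

Lemma pseudo_hyp_mob z w : pseudo_hyp z w = Cmod (mob w z).
Proof. reflexivity. Qed.

Lemma Cmod_one_minus_sym (a z : C) : Cmod (1 - Cconj a * z)%C = Cmod (1 - Cconj z * a)%C.
Proof.
rewrite <- Cmod_conj; f_equal.
rewrite Cminus_conj, Cmult_conj, Cconj_conj.
replace (Cconj 1) with (RtoC 1) by (unfold Cconj; simpl; now rewrite Ropp_0); ring.
Qed.

Lemma pseudo_hyp_sym z w : in_disk z -> in_disk w -> pseudo_hyp z w = pseudo_hyp w z.
Proof.
intros Hz Hw; unfold pseudo_hyp.
rewrite !Cmod_div by (now apply disk_one_minus).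
now rewrite Cmod_one_minus_sym, Cmod_sub_sym.
Qed.

Lemma one_minus_conj_sq (a z : C) :
  Cmod (1 - Cconj a * z)%C ^ 2 = Cmod (z - a)%C ^ 2 + (1 - Cmod a ^ 2) * (1 - Cmod z ^ 2).
Proof. rewrite !Cmod2_alt; destruct a, z; simpl; ring. Qed.

Lemma mob_one_minus_sq (a z : C) :
  in_disk a -> in_disk z ->
  (1 - Cmod (mob a z) ^ 2) * Cmod (1 - Cconj a * z)%C ^ 2 = (1 - Cmod a ^ 2) * (1 - Cmod z ^ 2).
Proof.
intros Ha Hz; pose proof (disk_one_minus z a Hz Ha) as N.
unfold mob; rewrite Cmod_div by exact N.
pose proof (one_minus_conj_sq a z) as E.
apply Cmod_gt_0 in N.
replace ((1 - (Cmod (z - a) / Cmod (1 - Cconj a * z)) ^ 2) * Cmod (1 - Cconj a * z)%C ^ 2)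
  with (Cmod (1 - Cconj a * z)%C ^ 2 - Cmod (z - a)%C ^ 2) by (field; lra).
lra.
Qed.

Lemma mob_neq0 a z : in_disk a -> in_disk z -> z <> a -> mob a z <> RtoC 0.
Proof.
intros Ha Hz N E.
pose proof (disk_one_minus z a Hz Ha) as N1.
apply Cminus_eq_contra in N; apply N.
transitivity (mob a z * (1 - Cconj a * z))%C; [unfold mob; field; exact N1|].
rewrite E; ring.
Qed.

Lemma mob_cdiff a z : in_disk a -> in_disk z -> cdiff (mob a) z.
Proof.
intros Ha Hz; apply cdiff_div.
- now apply disk_one_minus.
- apply cdiff_minus; [apply cdiff_id|apply cdiff_const].
- apply cdiff_minus; [apply cdiff_const|].
  apply cdiff_mult; [apply cdiff_const|apply cdiff_id].
Qed.

Lemma cdiff_comp f g z : cdiff g z -> cdiff f (g z) -> cdiff (fun w => f (g w)) z.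
Proof. intros (m & Hm) (l & Hl); eexists; now apply cderiv_comp; [apply Hm|apply Hl]. Qed.

(* The hyperbolic difference quotient of Beardon and Minda. *)
Definition hyp_diff_quot (g : C -> C) (a b : C) : C :=
  if Ceq_dec b a
  then (C_derive g a * (RtoC (1 - Cmod a ^ 2) / RtoC (1 - Cmod (g a) ^ 2)))%C
  else (mob (g a) (g b) / mob a b)%C.

Lemma RtoC_one_minus_sq (a : C) : (1 - Cconj a * a)%C = RtoC (1 - Cmod a ^ 2).
Proof. rewrite RtoC_minus, Cmod2_conj; ring. Qed.

Section SelfMap.
Variable g : C -> C.
Hypothesis Hg : almost_hol g.
Hypothesis Hb : forall z, in_disk z -> in_disk (g z).

Lemma hyp_diff_quot_cdiff a b :
  in_disk a -> in_disk b -> b <> a -> cdiff g b -> cdiff (hyp_diff_quot g a) b.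
Proof.
intros Ha Hbb N D.
assert (H : cdiff (fun w => mob (g a) (g w) / mob a w)%C b).
{ apply cdiff_div; [now apply mob_neq0| |now apply mob_cdiff].
  apply (cdiff_comp (mob (g a)) g); [exact D|]; apply mob_cdiff; now apply Hb. }
destruct H as [l Hl]; exists l; revert Hl; apply cderiv_ext_loc.
exists (Cmod (b - a)%C); split; [apply Cmod_gt_0; now apply Cminus_eq_contra|].
intros w Hw; unfold hyp_diff_quot; destruct (Ceq_dec w a) as [E|_]; [|reflexivity].
subst w; rewrite Cmod_sub_sym in Hw; lra.
Qed.

Lemma hyp_diff_quot_cont_off a b :
  in_disk a -> in_disk b -> b <> a -> cont (hyp_diff_quot g a) b.
Proof.
intros Ha Hbb N.
apply cont_ext_loc with (fun w => mob (g a) (g w) / mob a w)%C.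
- exists (Cmod (b - a)%C); split; [apply Cmod_gt_0; now apply Cminus_eq_contra|].
  intros w Hw; unfold hyp_diff_quot; destruct (Ceq_dec w a) as [E|_]; [|reflexivity].
  subst w; rewrite Cmod_sub_sym in Hw; lra.
- apply cont_div; [now apply mob_neq0| |now apply cdiff_cont, mob_cdiff].
  apply (cont_comp (mob (g a)) g); [now apply Hg|].
  apply cdiff_cont, mob_cdiff; now apply Hb.
Qed.

Lemma hyp_diff_quot_cont_at a : in_disk a -> cdiff g a -> cont (hyp_diff_quot g a) a.
Proof.
intros Ha D.
pose proof (cdiff_C_derive _ _ D) as D'.
destruct D' as (q & Cq & Eq & E).
apply cont_ext_loc with (fun b => q b * ((1 - Cconj a * b) / (1 - Cconj (g a) * g b)))%C.
- exists (1 - Cmod a); split; [unfold in_disk in Ha; lra|].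
  intros b Hbb; apply in_disk_ball in Hbb.
  pose proof (disk_one_minus b a Hbb Ha) as N1.
  pose proof (disk_one_minus (g b) (g a) (Hb b Hbb) (Hb a Ha)) as N2.
  unfold hyp_diff_quot; destruct (Ceq_dec b a) as [->|N].
  + rewrite <- Eq, !RtoC_one_minus_sq; reflexivity.
  + pose proof (Cminus_eq_contra _ _ N) as N3.
    unfold mob; replace (g b - g a)%C with (q b * (b - a))%C by (rewrite (E b); ring).
    field; auto.
- apply cont_mult; [exact Cq|]; apply cont_div.
  + apply disk_one_minus; now apply Hb.
  + apply cont_minus; [apply tends_const|].
    apply cont_mult; [apply tends_const|apply tends_id].
  + apply cont_minus; [apply tends_const|].
    apply cont_mult; [apply tends_const|now apply Hg].
Qed.

Lemma hyp_diff_quot_almost_hol a : in_disk a -> cdiff g a -> almost_hol (hyp_diff_quot g a).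
Proof.
intros Ha D z Hz; split.
- destruct (Ceq_dec z a) as [->|N]; [now apply hyp_diff_quot_cont_at|now apply hyp_diff_quot_cont_off].
- destruct (Hg z Hz) as [_ (d & Hd & Dd)].
  destruct (Ceq_dec z a) as [->|N].
  + exists d; split; [exact Hd|]; intros w N1 N2 N3; apply hyp_diff_quot_cdiff; auto.
  + exists (Rmin d (Cmod (z - a)%C)); split.
    { apply Rmin_pos; [exact Hd|]; apply Cmod_gt_0; now apply Cminus_eq_contra. }
    intros w N1 N2 N3; apply hyp_diff_quot_cdiff; trivial.
    * intros ->; rewrite Cmod_sub_sym in N2; pose proof (Rmin_r d (Cmod (z - a)%C)); lra.
    * apply Dd; trivial; apply Rlt_le_trans with (1 := N2), Rmin_l.
Qed.

(** For given moduli the pseudo-hyperbolic distance is least when both points lie on one radius. The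
    bound tends to 1 as [Cmod w] does, which controls the denominator of the difference quotient
    near the unit circle. *)
Lemma mob_lower_bound a w :
  in_disk a -> Cmod a < Cmod w < 1 ->
  (Cmod w - Cmod a) / (1 - Cmod w * Cmod a) <= Cmod (mob a w).
Proof.
intros Ha Hw; unfold in_disk in Ha.
pose proof (Cmod_ge_0 a) as Pa.
assert (P : 0 < 1 - Cmod w * Cmod a) by nra.
apply Rle_div_l; [exact P|].
assert (Hwd : in_disk w) by (unfold in_disk; lra).
pose proof (mob_one_minus_sq a w Ha Hwd) as E.
assert (L : 1 - Cmod w * Cmod a <= Cmod (1 - Cconj a * w)%C).
{ pose proof (Cmod_diff_le 1 (Cconj a * w)%C) as D.
  rewrite Cmod_1, Cmod_mult, Cmod_conj in D; apply Rabs_le_between in D; nra. }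
assert (M1 : 0 <= Cmod (mob a w) < 1) by (now apply pseudo_hyp_lt1).
apply Rsqr_incr_0_var; [|nra].
rewrite !Rsqr_pow2.
assert (L2 : (1 - Cmod w * Cmod a) ^ 2 <= Cmod (1 - Cconj a * w)%C ^ 2) by (apply pow_incr; lra).
assert (0 <= 1 - Cmod (mob a w) ^ 2) by nra.
assert ((1 - Cmod (mob a w) ^ 2) * (1 - Cmod w * Cmod a) ^ 2 <= (1 - Cmod a ^ 2) * (1 - Cmod w ^ 2)).
{ rewrite <- E; now apply Rmult_le_compat_l. }
rewrite Rpow_mult_distr; nra.
Qed.

Lemma hyp_diff_quot_le1 a z :
  in_disk a -> cdiff g a -> in_disk z -> Cmod (hyp_diff_quot g a z) <= 1.
Proof.
intros Ha D Hz; apply Rnot_lt_le; intros L.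
set (eta := Cmod (hyp_diff_quot g a z) - 1) in *.
assert (Heta : 0 < eta) by (unfold eta; lra).
unfold in_disk in Ha, Hz.
pose proof (Cmod_ge_0 a) as Pa; pose proof (Cmod_ge_0 z) as Pz.
set (s := Cmod a) in *.
(* With r = 1 - t the first bound gives (1 - r s) / (r - s) < 1 + eta; the second keeps the circle
   of radius r outside both [a] and [z]. *)
set (t := Rmin ((1 - s) * eta / (4 + eta)) ((1 - Rmax s (Cmod z)) / 2)).
assert (Hmax : Rmax s (Cmod z) < 1) by (now apply Rmax_lub_lt).
pose proof (Rmax_l s (Cmod z)); pose proof (Rmax_r s (Cmod z)).
assert (T0 : 0 < t).
{ apply Rmin_pos; [apply Rdiv_lt_0_compat; nra|lra]. }
assert (T1 : t * (4 + eta) <= (1 - s) * eta).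
{ apply Rle_div_r; [lra|apply Rmin_l]. }
assert (T2 : t <= (1 - Rmax s (Cmod z)) / 2) by apply Rmin_r.
set (r := 1 - t).
assert (Hr : 0 <= r < 1) by (unfold r; lra).
assert (Hrs : s < r) by (unfold r; lra).
assert (Hm : Cmod (hyp_diff_quot g a z) <= (1 - r * s) / (r - s)).
{ apply (max_principle _ r); trivial.
  - now apply hyp_diff_quot_almost_hol.
  - intros w Hw.
    assert (Hwd : in_disk w) by (unfold in_disk; lra).
    assert (N : w <> a) by (intros ->; fold s in Hw; lra).
    unfold hyp_diff_quot; destruct (Ceq_dec w a) as [E|_]; [now elim N|].
    rewrite Cmod_div by (now apply mob_neq0).
    pose proof (mob_lower_bound a w Ha) as LB; fold s in LB; rewrite Hw in LB.
    specialize (LB ltac:(lra)).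
    assert (P1 : 0 < (r - s) / (1 - r * s)) by (apply Rdiv_lt_0_compat; nra).
    assert (M1 : Cmod (mob (g a) (g w)) < 1) by (apply pseudo_hyp_lt1; now apply Hb).
    pose proof (Cmod_ge_0 (mob (g a) (g w))) as M0.
    replace ((1 - r * s) / (r - s)) with (1 * / ((r - s) / (1 - r * s))) by (field; split; nra).
    apply Rmult_le_compat; [exact M0| |lra|].
    + left; apply Rinv_0_lt_compat; lra.
    + apply Rinv_le_contravar; lra.
  - unfold r; lra. }
apply Rle_div_r in Hm; [|lra].
unfold r in Hm; replace (Cmod (hyp_diff_quot g a z)) with (1 + eta) in Hm by (unfold eta; ring).
nra.
Qed.

End SelfMap.

Lemma schwarz_pick_at (g : C -> C) a z :
  almost_hol g -> (forall z, in_disk z -> in_disk (g z)) ->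
  in_disk a -> cdiff g a -> in_disk z ->
  Cmod (g z - g a)%C <= pseudo_hyp z a * Cmod (1 - Cconj (g a) * g z)%C.
Proof.
intros Hg Hb Ha D Hz.
pose proof (hyp_diff_quot_le1 g Hg Hb a z Ha D Hz) as L.
pose proof (Cmod_ge_0 (mob a z)) as P0.
pose proof (disk_one_minus (g z) (g a) (Hb z Hz) (Hb a Ha)) as N2.
destruct (Ceq_dec z a) as [->|N].
{ replace (g a - g a)%C with (RtoC 0) by ring; rewrite Cmod_0.
  apply Rmult_le_pos; [exact P0|apply Cmod_ge_0]. }
unfold hyp_diff_quot in L; destruct (Ceq_dec z a) as [E|_]; [now elim N|].
pose proof (mob_neq0 a z Ha Hz N) as N3.
rewrite Cmod_div in L by exact N3.
apply Cmod_gt_0 in N3.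
apply Rle_div_l in L; [|exact N3]; rewrite Rmult_1_l in L.
change (mob (g a) (g z)) with ((g z - g a) / (1 - Cconj (g a) * g z))%C in L.
rewrite Cmod_div in L by exact N2; apply Cmod_gt_0 in N2.
now apply Rle_div_l in L.
Qed.

(** Difference quotients take values in the closed disk only. Scaling by [1 - e] brings them into
    the open disk, and the loss vanishes with [e]. *)
Lemma schwarz_pick_closed_at (g : C -> C) a z :
  almost_hol g -> (forall z, in_disk z -> Cmod (g z) <= 1) ->
  in_disk a -> cdiff g a -> in_disk z ->
  Cmod (g z - g a)%C <= pseudo_hyp z a * Cmod (1 - Cconj (g a) * g z)%C.
Proof.
intros Hg Hb Ha D Hz; apply le_epsilon; intros eps He.
set (A := Cmod (g z - g a)%C).
assert (A0 : 0 <= A) by apply Cmod_ge_0.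
set (e := Rmin (1 / 2) (eps / (2 + A))).
assert (E0 : 0 < e) by (apply Rmin_pos; [lra|apply Rdiv_lt_0_compat; lra]).
assert (E1 : e <= 1 / 2) by apply Rmin_l.
assert (E2 : e * (2 + A) <= eps) by (apply Rle_div_r; [lra|apply Rmin_r]).
set (t := 1 - e).
assert (K := schwarz_pick_at (fun w => RtoC t * g w)%C a z).
cbv beta in K.
assert (K' : Cmod (RtoC t * g z - RtoC t * g a)%C <=
  pseudo_hyp z a * Cmod (1 - Cconj (RtoC t * g a) * (RtoC t * g z))%C).
{ apply K; trivial.
  - now apply almost_hol_mult_const.
  - intros w Hw; unfold in_disk; rewrite Cmod_mult, Cmod_R, Rabs_pos_eq by (unfold t; lra).
    specialize (Hb w Hw); pose proof (Cmod_ge_0 (g w)); unfold t; nra.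
  - apply cdiff_mult; [apply cdiff_const|exact D]. }
clear K.
replace (RtoC t * g z - RtoC t * g a)%C with (RtoC t * (g z - g a))%C in K' by ring.
rewrite Cmod_mult, Cmod_R, Rabs_pos_eq in K' by (unfold t; lra); fold A in K'.
assert (Ec : Cconj (RtoC t * g a)%C = (RtoC t * Cconj (g a))%C).
{ rewrite Cmult_conj; f_equal; unfold Cconj; simpl; now rewrite Ropp_0. }
rewrite Ec in K'.
set (w := (Cconj (g a) * g z)%C) in *.
replace (1 - RtoC t * Cconj (g a) * (RtoC t * g z))%C with ((1 - w) + RtoC (1 - t * t) * w)%C in K'
  by (unfold w; rewrite RtoC_minus, RtoC_mult; ring).
pose proof (Cmod_triangle (1 - w)%C (RtoC (1 - t * t) * w)%C) as Tr.
rewrite (Cmod_mult (RtoC (1 - t * t))), Cmod_R, Rabs_pos_eq in Tr by (unfold t; nra).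
assert (W : Cmod w <= 1).
{ unfold w; rewrite Cmod_mult, Cmod_conj.
  pose proof (Hb a Ha); pose proof (Hb z Hz).
  pose proof (Cmod_ge_0 (g a)); pose proof (Cmod_ge_0 (g z)); nra. }
pose proof (pseudo_hyp_lt1 z a Hz Ha) as R1.
pose proof (Cmod_ge_0 w); pose proof (Cmod_ge_0 (1 - w)%C).
assert (F1 : (1 - t * t) * Cmod w <= 2 * e).
{ apply Rle_trans with ((1 - t * t) * 1); [apply Rmult_le_compat_l; [unfold t; nra|exact W]|unfold t; nra]. }
assert (F2 : pseudo_hyp z a * Cmod (1 - w + RtoC (1 - t * t) * w)%C
  <= pseudo_hyp z a * (Cmod (1 - w)%C + 2 * e)).
{ apply Rmult_le_compat_l; lra. }
assert (F3 : pseudo_hyp z a * e <= 1 * e) by (apply Rmult_le_compat_r; lra).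
assert (F4 : t * A = A - e * A) by (unfold t; ring).
lra.
Qed.

(** Both sides are continuous in the base point, and every neighbourhood of [a] contains points of
    differentiability. The case of interest is the quotient [hyp_diff_quot phi a] based at [a]
    itself, where only continuity has been established. *)
Theorem schwarz_pick (g : C -> C) a z :
  almost_hol g -> (forall z, in_disk z -> Cmod (g z) <= 1) ->
  in_disk a -> in_disk z ->
  Cmod (g z - g a)%C <= pseudo_hyp z a * Cmod (1 - Cconj (g a) * g z)%C.
Proof.
intros Hg Hb Ha Hz; apply Rnot_lt_le; intros L.
destruct (Hg a Ha) as [Ca (d & Hd & D)].
set (F := fun b => Cmod (g z - g b)%C - Cmod (mob b z) * Cmod (1 - Cconj (g b) * g z)%C).
assert (T : tends (ball_filter a) (fun b => RtoC (F b)) (RtoC (F a))).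
{ apply tends_ext with (fun b => RtoC (Cmod (g z - g b)) - RtoC (Cmod (mob b z)) * RtoC (Cmod (1 - Cconj (g b) * g z)))%C.
  { intros b; unfold F; now rewrite RtoC_minus, RtoC_mult. }
  unfold F; rewrite RtoC_minus, RtoC_mult.
  apply tends_minus; [|apply tends_mult]; apply tends_Cmod.
  - apply tends_minus; [apply tends_const|exact Ca].
  - apply tends_div; [now apply disk_one_minus| |].
    + apply tends_minus; [apply tends_const|apply tends_id].
    + apply tends_minus; [apply tends_const|].
      apply tends_mult; [apply tends_conj, tends_id|apply tends_const].
  - apply tends_minus; [apply tends_const|].
    apply tends_mult; [apply tends_conj, Ca|apply tends_const]. }
assert (Fa : 0 < F a) by (unfold F; change (Cmod (mob a z)) with (pseudo_hyp z a); lra).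
destruct (proj1 (tends_R _ _) T (F a) Fa) as (d' & Hd' & K).
set (e := Rmin (Rmin d d') (1 - Cmod a)).
assert (He : 0 < e) by (apply Rmin_pos; [now apply Rmin_pos|unfold in_disk in Ha; lra]).
set (b := (a + RtoC (e / 2))%C).
assert (Eb : Cmod (b - a)%C = e / 2).
{ unfold b; replace (a + RtoC (e / 2) - a)%C with (RtoC (e / 2)) by ring.
  rewrite Cmod_R; apply Rabs_pos_eq; lra. }
assert (e <= d) by (eapply Rle_trans; [apply Rmin_l|apply Rmin_l]).
assert (e <= d') by (eapply Rle_trans; [apply Rmin_l|apply Rmin_r]).
assert (e <= 1 - Cmod a) by apply Rmin_r.
assert (Hbd : in_disk b) by (apply in_disk_ball with a; lra).
assert (N : b <> a).
{ intros E; apply Ceq_minus in E; rewrite E, Cmod_0 in Eb; lra. }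
specialize (K b ltac:(lra)); apply Rabs_def2 in K.
assert (S := schwarz_pick_closed_at g b z Hg Hb Hbd (D b N ltac:(lra) Hbd) Hz).
assert (Fb : F b <= 0) by (unfold F; change (Cmod (mob b z)) with (pseudo_hyp z b); lra).
lra.
Qed.

(** With A = |g z - g a|, the denominator in Schwarz-Pick is at most 1 - |g a|^2 + A; solving the
    inequality for A yields the bound. It is a quantitative rigidity: where |g| is close to 1, g is
    almost constant on hyperbolic disks. *)
Lemma schwarz_pick_stable (g : C -> C) a z r :
  almost_hol g -> (forall z, in_disk z -> Cmod (g z) <= 1) ->
  in_disk a -> in_disk z -> pseudo_hyp z a <= r -> r < 1 ->
  Cmod (g z - g a)%C <= 2 * r / (1 - r) * (1 - Cmod (g a)).
Proof.
intros Hg Hb Ha Hz Hr R1.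
pose proof (schwarz_pick g a z Hg Hb Ha Hz) as S.
pose proof (pseudo_hyp_lt1 z a Hz Ha) as P.
pose proof (Hb a Ha) as Ga; pose proof (Cmod_ge_0 (g a)) as Ga0.
set (A := Cmod (g z - g a)%C) in *.
assert (A0 : 0 <= A) by apply Cmod_ge_0.
assert (B : Cmod (1 - Cconj (g a) * g z)%C <= (1 - Cmod (g a) ^ 2) + A).
{ replace (1 - Cconj (g a) * g z)%C with ((1 - Cconj (g a) * g a) - Cconj (g a) * (g z - g a))%C by ring.
  apply Rle_trans with (1 := Cmod_triangle _ _).
  rewrite Cmod_opp, Cmod_mult, Cmod_conj; fold A.
  rewrite RtoC_one_minus_sq, Cmod_R, Rabs_pos_eq by nra; nra. }
pose proof (Cmod_ge_0 (1 - Cconj (g a) * g z)%C) as B0.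
assert (S2 : A <= r * ((1 - Cmod (g a) ^ 2) + A)).
{ apply Rle_trans with (1 := S); apply Rmult_le_compat; lra. }
replace (2 * r / (1 - r) * (1 - Cmod (g a))) with (2 * r * (1 - Cmod (g a)) / (1 - r)) by (field; lra).
apply Rle_div_r; [lra|].
assert (0 <= r) by lra.
assert (1 - Cmod (g a) ^ 2 <= 2 * (1 - Cmod (g a))) by nra.
nra.
Qed.

(** * The contraction ratio of a self-map *)

Section Phi.
Variable phi : C -> C.
Hypothesis hphi : holomorphic_self_map phi.

Lemma self_map_cdiff z : in_disk z -> cdiff phi z.
Proof. intros Hz; apply cdiff_ex_derive; now apply hphi. Qed.

Lemma self_map_disk z : in_disk z -> in_disk (phi z).
Proof. intros Hz; now apply hphi. Qed.

Lemma self_map_almost_hol : almost_hol phi.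
Proof.
intros z Hz; split; [now apply cdiff_cont, self_map_cdiff|].
exists 1; split; [lra|]; intros w _ _ Hw; now apply self_map_cdiff.
Qed.

Definition contraction (a b : C) : R := Cmod (hyp_diff_quot phi a b).

Lemma contraction_bounds a b : in_disk a -> in_disk b -> 0 <= contraction a b <= 1.
Proof.
intros Ha Hb; split; [apply Cmod_ge_0|].
apply hyp_diff_quot_le1; trivial;
  [exact self_map_almost_hol|exact self_map_disk|now apply self_map_cdiff].
Qed.

Lemma hyp_diff_quot_stable a b b' r :
  in_disk a -> in_disk b -> in_disk b' -> pseudo_hyp b' b <= r -> r < 1 ->
  Cmod (hyp_diff_quot phi a b' - hyp_diff_quot phi a b)%C <= 2 * r / (1 - r) * (1 - contraction a b).
Proof.
intros Ha Hb Hb' Hr R1; apply schwarz_pick_stable; trivial.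
- apply hyp_diff_quot_almost_hol; trivial;
  [exact self_map_almost_hol|exact self_map_disk|now apply self_map_cdiff].
- intros z Hz; now apply contraction_bounds.
Qed.

Lemma contraction_transfer a b b' r :
  in_disk a -> in_disk b -> in_disk b' -> pseudo_hyp b' b <= r -> r < 1 ->
  1 - contraction a b' <= (1 + r) / (1 - r) * (1 - contraction a b).
Proof.
intros Ha Hb Hb' Hr R1.
pose proof (hyp_diff_quot_stable a b b' r Ha Hb Hb' Hr R1) as S.
pose proof (Cmod_diff_le (hyp_diff_quot phi a b') (hyp_diff_quot phi a b)) as D.
apply Rabs_le_between in D; fold (contraction a b) (contraction a b') in D.
replace ((1 + r) / (1 - r)) with (1 + 2 * r / (1 - r)) by (field; lra).
lra.
Qed.

Lemma mob_hyp_diff_quot a b :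
  in_disk a -> in_disk b ->
  mob (phi a) (phi b) = (hyp_diff_quot phi a b * mob a b)%C.
Proof.
intros Ha Hb; unfold hyp_diff_quot; destruct (Ceq_dec b a) as [->|N].
- unfold mob; replace (a - a)%C with (RtoC 0) by ring.
  replace (phi a - phi a)%C with (RtoC 0) by ring; unfold Cdiv; ring.
- field; now apply mob_neq0.
Qed.

Lemma pseudo_hyp_contraction a b :
  in_disk a -> in_disk b ->
  pseudo_hyp (phi b) (phi a) = contraction a b * pseudo_hyp b a.
Proof.
intros Ha Hb; rewrite !pseudo_hyp_mob, mob_hyp_diff_quot by trivial.
apply Cmod_mult.
Qed.

Lemma contraction_sym a b : in_disk a -> in_disk b -> contraction a b = contraction b a.
Proof.
intros Ha Hb; destruct (Ceq_dec b a) as [->|N]; [reflexivity|].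
assert (P : 0 < pseudo_hyp b a) by (apply Cmod_gt_0; now apply mob_neq0).
apply Rmult_eq_reg_r with (pseudo_hyp b a); [|lra].
rewrite <- pseudo_hyp_contraction by trivial.
rewrite (pseudo_hyp_sym b a), <- pseudo_hyp_contraction by trivial.
apply pseudo_hyp_sym; now apply self_map_disk.
Qed.

Lemma hyp_distortion_contraction a : in_disk a -> hyp_distortion phi a = contraction a a.
Proof.
intros Ha; pose proof (self_map_disk a Ha) as Hpa.
unfold hyp_distortion, contraction, hyp_diff_quot.
destruct (Ceq_dec a a) as [_|N]; [|now elim N].
unfold in_disk in *; pose proof (Cmod_ge_0 a); pose proof (Cmod_ge_0 (phi a)).
assert (0 < 1 - Cmod a ^ 2) by nra; assert (0 < 1 - Cmod (phi a) ^ 2) by nra.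
rewrite Cmod_mult, <- RtoC_div, Cmod_R, Rabs_pos_eq; [field; lra| |lra].
apply Rlt_le, Rdiv_lt_0_compat; lra.
Qed.

(** The pair (a, a) is moved to (a, b), swapped by symmetry, and moved to (b, b); each move costs a
    factor (1 + r) / (1 - r), hence the square. *)
Lemma contraction_diag_transfer a b r :
  in_disk a -> in_disk b -> pseudo_hyp b a <= r -> r < 1 ->
  1 - contraction b b <= ((1 + r) / (1 - r)) ^ 2 * (1 - contraction a a).
Proof.
intros Ha Hb Hr R1.
pose proof (pseudo_hyp_lt1 b a Hb Ha) as P.
assert (K0 : 0 < (1 + r) / (1 - r)) by (apply Rdiv_lt_0_compat; lra).
pose proof (contraction_transfer a a b r Ha Ha Hb Hr R1) as S1.
rewrite contraction_sym in S1 by trivial.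
assert (Hr' : pseudo_hyp a b <= r) by (now rewrite pseudo_hyp_sym).
assert (Hbb : pseudo_hyp b a <= r) by trivial.
pose proof (contraction_transfer b a b r Hb Ha Hb Hbb R1) as S2.
apply Rle_trans with (1 := S2).
rewrite <- Rsqr_pow2; unfold Rsqr; rewrite Rmult_assoc.
now apply Rmult_le_compat_l; [lra|].
Qed.

End Phi.

(** * From pseudo-hyperbolic to hyperbolic ratios *)

Lemma artanh_deriv c : -1 < c < 1 ->
  derivable_pt_lim (fun t => ln ((1 + t) / (1 - t))) c (2 / (1 - c ^ 2)).
Proof.
intros Hc; apply is_derive_Reals; auto_derive.
- repeat split; [lra|apply Rdiv_lt_0_compat; lra].
- field; repeat split; nra.
Qed.

(** With h(t) = ln ((1 + t) / (1 - t)), the upper bound is convexity of h together with h(0) = 0.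
    The lower one compares h(p) - h(g p) <= 2 (1 - g) p / (1 - r^2) with h(p) >= 2 p. *)
Lemma artanh_quotient_bounds g p r :
  0 <= g <= 1 -> 0 < p <= r -> r < 1 ->
  1 - (1 - g) / (1 - r ^ 2) <=
    ln ((1 + g * p) / (1 - g * p)) / ln ((1 + p) / (1 - p)) <= g.
Proof.
intros Hg Hp Hr.
set (h := fun t => ln ((1 + t) / (1 - t))).
change (1 - (1 - g) / (1 - r ^ 2) <= h (g * p) / h p <= g).
assert (Hh0 : h 0 = 0).
{ unfold h; replace ((1 + 0) / (1 - 0)) with 1 by field; apply ln_1. }
assert (Hmv : forall a b, 0 <= a < b -> b < 1 ->
  exists c, h b - h a = 2 / (1 - c ^ 2) * (b - a) /\ a < c < b).
{ intros a b Hab Hb.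
  destruct (MVT_cor2 h (fun c => 2 / (1 - c ^ 2)) a b) as (c & Ec & Hc); [lra| |].
  - intros c Hc; apply artanh_deriv; lra.
  - now exists c. }
assert (Hr2 : 0 < 1 - r ^ 2) by nra.
assert (Hhp : 2 * p <= h p).
{ destruct (Hmv 0 p) as (c & Ec & Hc); [lra|lra|].
  rewrite Hh0, !Rminus_0_r in Ec; rewrite Ec.
  apply Rmult_le_compat_r; [lra|]; apply Rle_div_r; nra. }
destruct (Rle_lt_or_eq_dec g 1 (proj2 Hg)) as [G1| ->].
2: { rewrite Rmult_1_l; replace (h p / h p) with 1 by (field; lra).
     replace ((1 - 1) / (1 - r ^ 2)) with 0 by (field; lra); lra. }
destruct (Rle_lt_or_eq_dec 0 g (proj1 Hg)) as [G0| <-].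
2: { rewrite Rmult_0_l, Hh0; replace (0 / h p) with 0 by (field; lra).
     assert (1 <= (1 - 0) / (1 - r ^ 2)) by (apply Rle_div_r; nra); lra. }
assert (Hgp : 0 < g * p < p) by nra.
destruct (Hmv 0 (g * p)) as (c1 & E1 & C1); [lra|lra|].
destruct (Hmv (g * p) p) as (c2 & E2 & C2); [lra|lra|].
rewrite Hh0, !Rminus_0_r in E1.
assert (L12 : 2 / (1 - c1 ^ 2) <= 2 / (1 - c2 ^ 2)).
{ unfold Rdiv; apply Rmult_le_compat_l; [lra|]; apply Rinv_le_contravar; nra. }
assert (L2r : 2 / (1 - c2 ^ 2) <= 2 / (1 - r ^ 2)).
{ unfold Rdiv; apply Rmult_le_compat_l; [lra|]; apply Rinv_le_contravar; nra. }
set (A := 2 / (1 - c1 ^ 2)) in *; set (B := 2 / (1 - c2 ^ 2)) in *.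
split.
- apply Rle_div_r; [lra|].
  assert (Q : (1 - g) / (1 - r ^ 2) * h p >= (1 - g) / (1 - r ^ 2) * (2 * p)).
  { apply Rle_ge, Rmult_le_compat_l; [|exact Hhp].
    apply Rmult_le_pos; [lra|left; now apply Rinv_0_lt_compat]. }
  assert (Q2 : h p - h (g * p) <= 2 / (1 - r ^ 2) * (p - g * p)).
  { rewrite E2; apply Rmult_le_compat_r; lra. }
  replace (2 / (1 - r ^ 2) * (p - g * p)) with ((1 - g) / (1 - r ^ 2) * (2 * p)) in Q2 by (field; lra).
  lra.
- apply Rle_div_l; [lra|].
  assert (Q : g * (h p - h (g * p)) >= (1 - g) * h (g * p)).
  { rewrite E2, E1.
    replace (g * (B * (p - g * p))) with (B * (g * p * (1 - g))) by ring.
    replace ((1 - g) * (A * (g * p))) with (A * (g * p * (1 - g))) by ring.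
    apply Rle_ge, Rmult_le_compat_r; [nra|exact L12]. }
  lra.
Qed.

Lemma bounded_step_pseudo_hyp (z : nat -> C) :
  (forall n, in_disk (z n)) -> bounded_step z ->
  exists r, 0 < r < 1 /\ forall n, pseudo_hyp (z n) (z (S n)) <= r.
Proof.
intros Hz (M & HM & H).
assert (E1 : 1 < exp M) by (rewrite <- exp_0; now apply exp_increasing).
(* This is tanh (M / 2), the pseudo-hyperbolic distance that corresponds to the hyperbolic distance
   [M]. *)
exists ((exp M - 1) / (exp M + 1)); split.
- split; [apply Rdiv_lt_0_compat; lra|apply Rlt_div_l; lra].
- intros n; specialize (H n).
  pose proof (pseudo_hyp_lt1 _ _ (Hz n) (Hz (S n))) as P.
  unfold hyp_dist in H; set (p := pseudo_hyp (z n) (z (S n))) in *.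
  assert (Pq : 0 < (1 + p) / (1 - p)) by (apply Rdiv_lt_0_compat; lra).
  assert (L : (1 + p) / (1 - p) <= exp M).
  { rewrite <- (exp_ln _ Pq); destruct H as [H|H]; [left; now apply exp_increasing|rewrite H; lra]. }
  apply Rle_div_l in L; [|lra].
  apply Rle_div_r; lra.
Qed.

Lemma is_lim_seq_1_squeeze (u v : nat -> R) K :
  (forall n, 1 - K * (1 - u n) <= v n <= 1) -> is_lim_seq u 1 -> is_lim_seq v 1.
Proof.
intros H Hu.
apply (is_lim_seq_le_le (fun n => 1 - K * (1 - u n)) v (fun _ => 1)); [exact H| |apply is_lim_seq_const].
replace (Finite 1) with (Finite (1 - K * (1 - 1))) by (f_equal; ring).
apply is_lim_seq_minus'; [apply is_lim_seq_const|].
apply is_lim_seq_mult'; [apply is_lim_seq_const|].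
apply is_lim_seq_minus'; [apply is_lim_seq_const|exact Hu].
Qed.

(** Both sequences are compared with [contraction phi (z n) (z (S n))]: up to factors depending only
    on the step bound, all three have the same distance to 1. *)
Lemma distortion_quotient_equiv (phi : C -> C) (z : nat -> C) :
  holomorphic_self_map phi -> (forall n, in_disk (z n)) -> bounded_step z ->
  is_lim_seq (fun n => hyp_distortion phi (z n)) 1 <->
  is_lim_seq (fun n => hyp_quotient phi (z n) (z (S n))) 1.
Proof.
intros Hphi Hz Hb.
destruct (bounded_step_pseudo_hyp z Hz Hb) as (r & Hr & Hstep).
set (c := fun n => contraction phi (z n) (z (S n))).
assert (Hc : forall n, 0 <= c n <= 1) by (intros n; now apply contraction_bounds).
assert (Hq : forall n, 1 - / (1 - r ^ 2) * (1 - c n) <= hyp_quotient phi (z n) (z (S n)) <= c n).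
{ intros n; unfold hyp_quotient.
  assert (I1 : 1 <= / (1 - r ^ 2)) by (rewrite <- Rinv_1; apply Rinv_le_contravar; nra).
  destruct (Ceq_dec (z n) (z (S n))) as [E|N].
  - rewrite hyp_distortion_contraction by trivial.
    replace (contraction phi (z n) (z n)) with (c n) by (unfold c; now rewrite <- E).
    specialize (Hc n); nra.
  - unfold hyp_dist.
    rewrite (pseudo_hyp_sym (phi (z n))) by (now apply (self_map_disk phi)).
    rewrite (pseudo_hyp_contraction phi (z n) (z (S n))) by trivial.
    rewrite (pseudo_hyp_sym (z (S n)) (z n)) by trivial; fold (c n).
    replace (/ (1 - r ^ 2) * (1 - c n)) with ((1 - c n) / (1 - r ^ 2)) by (unfold Rdiv; ring).
    apply artanh_quotient_bounds; [apply Hc| |lra].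
    split; [|apply Hstep].
    apply Cmod_gt_0; now apply mob_neq0. }
assert (Hd : forall n, contraction phi (z n) (z n) <= 1) by (intros n; now apply contraction_bounds).
set (K := (1 + r) / (1 - r)).
assert (E1 : forall n, 1 - c n <= K * (1 - contraction phi (z n) (z n))).
{ intros n; apply contraction_transfer; trivial; [|lra].
  rewrite pseudo_hyp_sym by trivial; apply Hstep. }
assert (E2 : forall n, 1 - contraction phi (z n) (z n) <= K * (1 - c n)).
{ intros n; apply contraction_transfer; trivial; lra. }
split; intros H.
- apply is_lim_seq_1_squeeze with (u := c) (K := / (1 - r ^ 2)).
  + intros n; specialize (Hq n); specialize (Hc n); lra.
  + apply is_lim_seq_1_squeeze with (u := fun n => hyp_distortion phi (z n)) (K := K); [|exact H].
    intros n; rewrite hyp_distortion_contraction by trivial.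
    specialize (E1 n); specialize (Hc n); lra.
- apply is_lim_seq_ext with (fun n => contraction phi (z n) (z n)).
  { intros n; now rewrite hyp_distortion_contraction. }
  apply is_lim_seq_1_squeeze with (u := c) (K := K).
  { intros n; specialize (E2 n); specialize (Hd n); lra. }
  apply is_lim_seq_1_squeeze with (u := fun n => hyp_quotient phi (z n) (z (S n))) (K := 1); [|exact H].
  intros n; specialize (Hq n); specialize (Hc n); lra.
Qed.

(** * Sectors and Stolz regions *)

(** For eta > 0, a linear substitute for |arg w| < arctan eta. It excludes 0, is invariant under
    positive factors, and is the intersection of two half-planes, to each of which arguments about
    positive real parts apply. *)
Definition sector (eta : R) (w : C) : Prop := Rabs (Im w) < eta * Re w.

Lemma sector_Re eta w : 0 < eta -> sector eta w -> 0 < Re w.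
Proof. unfold sector; intros He H; pose proof (Rabs_pos (Im w)); nra. Qed.

Lemma sector_mono a b w : 0 < a -> a <= b -> sector a w -> sector b w.
Proof.
intros Ha Hab H; pose proof (sector_Re a w Ha H); unfold sector in *; nra.
Qed.

(** Addition theorem for the tangent: (a + b) / (1 - a b) is at most 2 (a + b) because a b <=
    1/2. *)
Lemma sector_mult a b z w :
  0 < a -> 0 < b -> a * b <= 1 / 2 -> sector a z -> sector b w -> sector (2 * (a + b)) (z * w)%C.
Proof.
intros Ha Hb Hab Hz Hw.
pose proof (sector_Re a z Ha Hz) as Rz; pose proof (sector_Re b w Hb Hw) as Rw.
unfold sector in *; rewrite re_mult, im_mult.
destruct z as [x y], w as [x' y']; simpl in *.
assert (A1 : Rabs (x * y') <= x * (b * x')).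
{ rewrite Rabs_mult, (Rabs_pos_eq x) by lra; apply Rmult_le_compat_l; lra. }
assert (A2 : Rabs (y * x') < (a * x) * x').
{ rewrite Rabs_mult, (Rabs_pos_eq x') by lra; apply Rmult_lt_compat_r; lra. }
assert (A3 : Rabs (y * y') <= (a * x) * (b * x')).
{ rewrite Rabs_mult; apply Rmult_le_compat; try apply Rabs_pos; lra. }
pose proof (Rabs_triang (x * y') (y * x')).
pose proof (Rle_abs (y * y')).
assert (0 < x * x') by nra.
assert ((a * x) * (b * x') <= 1 / 2 * (x * x')) by nra.
assert (1 / 2 * (x * x') <= x * x' - y * y') by lra.
assert (2 * (a + b) * (1 / 2 * (x * x')) <= 2 * (a + b) * (x * x' - y * y')).
{ apply Rmult_le_compat_l; lra. }
nra.
Qed.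

Lemma sector_near1 e w : 0 < e <= 1 / 2 -> Cmod (w - 1)%C < e -> sector (2 * e) w.
Proof.
intros He H.
pose proof (re_le_Cmod (w - 1)%C) as A; pose proof (im_le_Cmod (w - 1)%C) as B.
rewrite Re_minus in A; rewrite Im_minus in B; simpl in A, B; rewrite Rminus_0_r in B.
apply Rabs_le_between in A; unfold sector; nra.
Qed.

Lemma tends1_sector {T} (F : (T -> Prop) -> Prop) {FF : Filter F} (f : T -> C) eta :
  0 < eta -> tends F f 1 -> F (fun x => sector eta (f x)).
Proof.
intros He H.
set (e := Rmin (1 / 2) (eta / 2)).
assert (He1 : 0 < e <= 1 / 2) by (split; [apply Rmin_pos; lra|apply Rmin_l]).
assert (He2 : e <= eta / 2) by apply Rmin_r.
generalize (H e (proj1 He1)); apply filter_imp; intros x Hx.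
apply sector_mono with (2 * e); [lra|lra|now apply sector_near1].
Qed.

Lemma Rabs_sin_le x : Rabs (sin x) <= Rabs x.
Proof.
assert (H : forall y, 0 < y -> Rabs (sin y) <= y).
{ intros y Hy; destruct (MVT_cor2 sin cos 0 y Hy) as (c & E & _).
  { intros; apply derivable_pt_lim_sin. }
  rewrite sin_0, !Rminus_0_r in E; rewrite E, Rabs_mult, (Rabs_pos_eq y) by lra.
  pose proof (COS_bound c); assert (Rabs (cos c) <= 1) by (apply Rabs_le; lra); nra. }
destruct (Rtotal_order x 0) as [L|[->|L]].
- pose proof (H (- x) ltac:(lra)) as K; rewrite sin_neg, Rabs_Ropp in K.
  rewrite (Rabs_left x) by lra; exact K.
- rewrite sin_0; lra.
- rewrite (Rabs_pos_eq x) by lra; apply H; lra.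
Qed.

Lemma cos_ge x : 1 - x ^ 2 / 2 <= cos x.
Proof.
replace x with (2 * (x / 2)) at 2 by field.
rewrite cos_2a_sin.
pose proof (Rabs_sin_le (x / 2)) as H.
apply Rsqr_le_abs_1 in H; unfold Rsqr in H; nra.
Qed.

Lemma cis_plus s t : cis (s + t) = (cis s * cis t)%C.
Proof. unfold cis, Cmult; simpl; rewrite cos_plus, sin_plus; f_equal; ring. Qed.

Lemma cis_0 : cis 0 = RtoC 1.
Proof. unfold cis; now rewrite cos_0, sin_0. Qed.

Lemma is_arg_cis w t : is_arg w t <-> w <> RtoC 0 /\ w = (RtoC (Cmod w) * cis t)%C.
Proof.
unfold is_arg; replace (RtoC (Cmod w) * cis t)%C with ((Cmod w * cos t, Cmod w * sin t) : C);
  [reflexivity|].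
unfold cis, RtoC, Cmult; simpl; f_equal; ring.
Qed.

Lemma cis_conj t : Cconj (cis t) = cis (- t).
Proof. unfold cis, Cconj; simpl; now rewrite cos_neg, sin_neg. Qed.

Lemma sector_polar eta w : 0 < eta -> sector eta w -> w = (RtoC (Cmod w) * cis (atan (Im w / Re w)))%C.
Proof.
intros He H; pose proof (sector_Re eta w He H) as Hr.
destruct w as [x y]; unfold cis; rewrite cos_atan, sin_atan; simpl in *.
set (s := sqrt (1 + Rsqr (y / x))).
assert (Hs : 0 < s).
{ apply sqrt_lt_R0; pose proof (Rle_0_sqr (y / x)); lra. }
assert (Em : Cmod (x, y) = x * s).
{ unfold Cmod; simpl; unfold s.
  rewrite <- (sqrt_Rsqr x) at 3 by lra.
  rewrite <- sqrt_mult_alt by apply Rle_0_sqr.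
  f_equal; unfold Rsqr; field; lra. }
rewrite Em; unfold RtoC, Cmult; simpl; f_equal; field; split; lra.
Qed.

(** Rotation by -theta turns convergence in R / 2 pi Z into linear inequalities, so that no
    representative of the argument has to be chosen afterwards. In both directions angles are cut
    off at 1, which keeps them below pi/2, where cosine is bounded below and tangent can be
    inverted. *)
Lemma arg_lim_sector (f : C -> C) (F : (C -> Prop) -> Prop) {FF : Filter F} theta :
  arg_lim f F theta <->
  forall eta, 0 < eta -> F (fun z => sector eta (f z * cis (- theta))%C).
Proof.
split.
- intros H eta He.
  set (e := Rmin (eta / 2) 1).
  assert (He0 : 0 < e) by (apply Rmin_pos; lra).
  assert (He1 : e <= eta / 2) by apply Rmin_l.
  assert (He2 : e <= 1) by apply Rmin_r.
  generalize (H (mkposreal e He0)); apply filter_imp; simpl; intros z (t & Ht & D).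
  apply is_arg_cis in Ht; destruct Ht as [N E].
  apply Cmod_gt_0 in N; rewrite E, <- Cmult_assoc, <- cis_plus.
  set (x := t + - theta); fold (t - theta) in x; fold x in D.
  unfold sector; rewrite im_scal_l, re_scal_l; simpl.
  rewrite Rabs_mult, (Rabs_pos_eq (Cmod (f z))) by lra.
  pose proof (Rabs_sin_le x) as S; pose proof (cos_ge x) as Cx.
  rewrite <- (pow2_abs x) in Cx.
  pose proof (Rabs_pos x).
  assert (1 / 2 <= cos x) by nra.
  assert (Rabs (sin x) < eta * cos x) by nra.
  nra.
- intros H [eps He].
  set (e := Rmin eps 1).
  assert (He0 : 0 < e) by (apply Rmin_pos; lra).
  assert (He1 : e <= eps) by apply Rmin_l.
  assert (He2 : e <= 1) by apply Rmin_r.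
  pose proof PI2_1 as HPI.
  assert (Ht : 0 < tan e) by (apply tan_gt_0; lra).
  generalize (H (tan e) Ht); apply filter_imp; simpl; intros z Hz.
  set (w := (f z * cis (- theta))%C) in *.
  pose proof (sector_Re _ _ Ht Hz) as Hr.
  assert (Ef : f z = (w * cis theta)%C).
  { unfold w; rewrite <- Cmult_assoc, <- cis_plus; replace (- theta + theta) with 0 by ring.
    rewrite cis_0; ring. }
  assert (Em : Cmod (f z) = Cmod w).
  { rewrite Ef, Cmod_mult, Cmod_cis; ring. }
  set (x := atan (Im w / Re w)).
  exists (theta + x); split.
  + apply is_arg_cis; split.
    * apply Cmod_gt_0; rewrite Em; apply Rlt_le_trans with (1 := Hr).
      apply Rle_trans with (1 := Rle_abs _), re_le_Cmod.
    * rewrite Em, Rplus_comm, cis_plus, Ef, (sector_polar _ _ Ht Hz) at 1; fold x; ring.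
  + replace (theta + x - theta) with x by ring.
    apply Rlt_le_trans with (2 := He1).
    assert (B : - tan e < Im w / Re w < tan e).
    { unfold sector in Hz; apply Rabs_def2 in Hz.
      split; [apply Rlt_div_r|apply Rlt_div_l]; lra. }
    apply Rabs_def1; unfold x.
    * rewrite <- (atan_tan e) by lra; now apply atan_increasing.
    * rewrite <- (atan_tan e) by lra; rewrite <- atan_opp; now apply atan_increasing.
Qed.

Lemma unimodular_cis c : Cmod c = 1 -> exists t, c = cis t.
Proof.
intros H; assert (H2 : Cmod c ^ 2 = 1) by (rewrite H; ring).
rewrite Cmod2_alt in H2; destruct c as [x y]; simpl in H2.
assert (Hx : -1 <= x <= 1) by nra.
destruct (Rle_dec 0 y) as [L|L].
- exists (acos x); unfold cis; rewrite cos_acos, sin_acos by exact Hx.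
  f_equal; rewrite <- (sqrt_Rsqr y L); f_equal; unfold Rsqr; lra.
- exists (- acos x); unfold cis; rewrite cos_neg, sin_neg, cos_acos, sin_acos by exact Hx.
  f_equal; rewrite <- (Ropp_involutive y) at 1; f_equal.
  rewrite <- (sqrt_Rsqr (- y)) by lra; f_equal; unfold Rsqr; lra.
Qed.

Lemma unimodular_conj c : Cmod c = 1 -> (Cconj c * c)%C = RtoC 1.
Proof. intros H; rewrite Cmult_comm, <- Cmod2_conj, H, pow1; reflexivity. Qed.

Global Instance stolz_filter_filter sigma M : Filter (stolz_filter sigma M).
Proof. apply within_filter, locally_filter. Qed.

Lemma stolz_filter_ball sigma M P :
  stolz_filter sigma M P <->
  exists d, 0 < d /\ forall z, stolz sigma M z -> Cmod (z - sigma)%C < d -> P z.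
Proof.
unfold stolz_filter, within; rewrite <- ball_filter_locally; unfold ball_filter.
split; intros (d & Hd & H); exists d; split; trivial; intros z; auto.
Qed.

Lemma stolz_dist sigma z : Cmod sigma = 1 -> 1 - Cmod z <= Cmod (z - sigma)%C.
Proof.
intros H; pose proof (Cmod_diff_le z sigma) as D; apply Rabs_le_between in D; lra.
Qed.

Lemma stolz_mono sigma M M' z : M <= M' -> stolz sigma M z -> stolz sigma M' z.
Proof. intros L [H1 H2]; split; trivial; unfold in_disk in H1; nra. Qed.

(** Within half the distance to the circle, 1 - |w| drops by at most a factor 2, while |w - sigma|
    grows by at most (1 - |z|) / 2; the quotient gives the aperture 2 M + 1. *)
Lemma stolz_ball sigma M z w :
  Cmod sigma = 1 -> stolz sigma M z -> Cmod (w - z)%C < (1 - Cmod z) / 2 ->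
  stolz sigma (2 * M + 1) w /\ Cmod (w - sigma)%C <= 2 * Cmod (z - sigma)%C.
Proof.
intros Hs [H1 H2] Hw; unfold in_disk in H1.
pose proof (Cmod_diff_le w z) as D; apply Rabs_le_between in D.
pose proof (stolz_dist sigma z Hs) as B.
pose proof (Cmod_triangle (w - z)%C (z - sigma)%C) as T.
replace (w - z + (z - sigma))%C with (w - sigma)%C in T by ring.
pose proof (Cmod_ge_0 (z - sigma)%C).
repeat split; unfold in_disk; try lra.
assert (0 < M) by nra.
nra.
Qed.

Lemma stolz_segment sigma M z t :
  Cmod sigma = 1 -> stolz sigma M z -> 0 <= t < 1 ->
  stolz sigma M (z + RtoC t * (sigma - z))%C /\
  Cmod (z + RtoC t * (sigma - z) - sigma)%C = (1 - t) * Cmod (z - sigma)%C.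
Proof.
intros Hs [H1 H2] Ht; unfold in_disk in H1.
assert (E : Cmod (z + RtoC t * (sigma - z) - sigma)%C = (1 - t) * Cmod (z - sigma)%C).
{ replace (z + RtoC t * (sigma - z) - sigma)%C with (RtoC (1 - t) * (z - sigma))%C
    by (rewrite RtoC_minus; ring).
  rewrite Cmod_mult, Cmod_R, Rabs_pos_eq; lra. }
assert (N : Cmod (z + RtoC t * (sigma - z))%C <= (1 - t) * Cmod z + t).
{ replace (z + RtoC t * (sigma - z))%C with (RtoC (1 - t) * z + RtoC t * sigma)%C
    by (rewrite RtoC_minus; ring).
  apply Rle_trans with (1 := Cmod_triangle _ _).
  rewrite !Cmod_mult, !Cmod_R, Hs, !Rabs_pos_eq; lra. }
split; [|exact E].
assert (0 < M).
{ pose proof (Cmod_ge_0 (z - sigma)%C); nra. }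
split; unfold in_disk.
- nra.
- rewrite E; nra.
Qed.

Lemma almost_hol_of_cdiff g : (forall z, in_disk z -> cdiff g z) -> almost_hol g.
Proof.
intros H z Hz; split; [now apply cdiff_cont, H|].
exists 1; split; [lra|]; intros w _ _ Hw; now apply H.
Qed.

(** Schwarz lemma for maps into the right half-plane: after the Cayley map that sends P(z) to 0, the
    derivative at the centre has modulus at most 1. That derivative is obtained as the diagonal
    value of the difference quotient. *)
Lemma positive_re_deriv_bound (P : C -> C) z r l :
  0 < r -> (forall w, Cmod (w - z)%C < r -> cdiff P w /\ 0 < Re (P w)) -> cderiv P z l ->
  Cmod l * r <= 2 * Re (P z).
Proof.
intros Hr HP Hl.
assert (Hz : Cmod (z - z)%C < r) by (replace (z - z)%C with (RtoC 0) by ring; now rewrite Cmod_0).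
destruct (HP z Hz) as [_ R0].
set (m := fun v : C => (z + RtoC r * v)%C).
set (g := fun v : C => ((P (m v) - P z) / (P (m v) + Cconj (P z)))%C).
assert (Hm : forall v, in_disk v -> Cmod (m v - z)%C < r).
{ intros v Hv; unfold m; replace (z + RtoC r * v - z)%C with (RtoC r * v)%C by ring.
  unfold in_disk in Hv; rewrite Cmod_mult, Cmod_R, Rabs_pos_eq by lra.
  rewrite <- (Rmult_1_r r) at 2; now apply Rmult_lt_compat_l. }
assert (Nz : forall w, 0 < Re w -> (w + Cconj (P z))%C <> RtoC 0).
{ intros w Hw E; apply (f_equal Re) in E; rewrite re_plus, re_conj in E; simpl in E; lra. }
assert (Dm : forall v, cderiv m v (RtoC r)).
{ intros v.
  apply (eq_ind (0 + (0 * v + RtoC r * 1))%C (fun l => cderiv m v l)); [|ring].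
  apply (cderiv_plus (fun _ => z) (fun v => RtoC r * v)%C); [apply cderiv_const|].
  apply (cderiv_mult (fun _ => RtoC r) (fun v => v)); [apply cderiv_const|apply cderiv_id]. }
assert (Dg : forall v, in_disk v -> cdiff g v).
{ intros v Hv; destruct (HP _ (Hm v Hv)) as [D Rv].
  assert (DP : cdiff (fun v => P (m v)) v) by (apply cdiff_comp; [exists (RtoC r); apply Dm|exact D]).
  apply cdiff_div; [now apply Nz| |].
  - apply cdiff_minus; [exact DP|apply cdiff_const].
  - apply cdiff_plus; [exact DP|apply cdiff_const]. }
assert (Hg : forall v, in_disk v -> in_disk (g v)).
{ intros v Hv; destruct (HP _ (Hm v Hv)) as [_ Rv].
  unfold in_disk, g; rewrite Cmod_div by now apply Nz.
  pose proof (Nz _ Rv) as N; apply Cmod_gt_0 in N.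
  apply Rlt_div_l; [exact N|]; rewrite Rmult_1_l.
  apply Rsqr_incrst_0; try apply Cmod_ge_0.
  rewrite !Rsqr_pow2, !Cmod2_alt.
  destruct (P (m v)) as [x y], (P z) as [x' y']; simpl in *; nra. }
assert (D0 : in_disk 0) by (unfold in_disk; rewrite Cmod_0; lra).
assert (L := hyp_diff_quot_le1 g (almost_hol_of_cdiff g Dg) Hg 0 0 D0 (Dg 0 D0) D0).
unfold hyp_diff_quot in L; destruct (Ceq_dec 0 0) as [_|N]; [|now elim N].
assert (m0 : m 0 = z) by (unfold m; ring).
assert (g0 : g 0 = RtoC 0).
{ unfold g; rewrite m0; unfold Cdiv; ring. }
assert (Pr : (P z + Cconj (P z))%C = RtoC (2 * Re (P z))).
{ destruct (P z) as [x y]; unfold Cconj, Cplus, RtoC; simpl; f_equal; ring. }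
assert (Pn : RtoC (2 * Re (P z)) <> RtoC 0) by (intros E; apply RtoC_inj in E; lra).
assert (DPm : cderiv (fun v => P (m v)) 0 (l * RtoC r)%C).
{ apply cderiv_comp; [apply Dm|now rewrite m0]. }
assert (dg : C_derive g 0 = (l * RtoC r / RtoC (2 * Re (P z)))%C).
{ apply cderiv_C_derive.
  apply (eq_ind ((l * RtoC r + 0) * / (P (m 0%C) + Cconj (P z)) + (P (m 0%C) - P z)
    * (- (l * RtoC r + 0) / ((P (m 0%C) + Cconj (P z)) * (P (m 0%C) + Cconj (P z)))))%C (fun l => cderiv g 0 l)).
  2: { rewrite m0, Pr; field; exact Pn. }
  apply (cderiv_mult (fun v => P (m v) - P z)%C (fun v => / (P (m v) + Cconj (P z)))%C).
  - apply (cderiv_plus (fun v => P (m v)) (fun _ => - P z)%C); [exact DPm|apply cderiv_const].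
  - apply (cderiv_inv (fun v => P (m v) + Cconj (P z))%C).
    + apply Nz; rewrite m0; exact R0.
    + apply (cderiv_plus (fun v => P (m v)) (fun _ => Cconj (P z))); [exact DPm|apply cderiv_const]. }
rewrite dg, g0, Cmod_0 in L.
replace (RtoC (1 - 0 ^ 2) / RtoC (1 - 0 ^ 2))%C with (RtoC 1) in L.
2: { rewrite <- RtoC_div by lra; f_equal; field. }
rewrite Cmult_1_r, Cmod_div, Cmod_mult, !Cmod_R, !Rabs_pos_eq in L by (trivial; lra).
apply Rle_div_l in L; lra.
Qed.

(** * Consequences of weak conformality *)

Lemma one_minus_conj_neq0 (tau w : C) : Cmod tau = 1 -> in_disk w -> (1 - Cconj tau * w)%C <> RtoC 0.
Proof.
intros Ht Hw E; apply Ceq_minus in E; apply (f_equal Cmod) in E.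
unfold in_disk in Hw; rewrite Cmod_1, Cmod_mult, Cmod_conj, Ht in E; lra.
Qed.

Lemma one_minus_conj_Re (tau w : C) : Cmod tau = 1 -> in_disk w -> 0 < Re (1 - Cconj tau * w)%C.
Proof.
intros Ht Hw; rewrite Re_minus; simpl (Re 1).
pose proof (re_le_Cmod (Cconj tau * w)%C) as A; pose proof (Rle_abs (Re (Cconj tau * w)%C)).
unfold in_disk in Hw; rewrite Cmod_mult, Cmod_conj, Ht in A; lra.
Qed.

Lemma one_minus_conj_eq (tau w : C) : Cmod tau = 1 -> (1 - Cconj tau * w)%C = (Cconj tau * (tau - w))%C.
Proof.
intros Ht; rewrite <- (unimodular_conj tau Ht) at 1; ring.
Qed.

Lemma Cmod_one_minus_conj (tau w : C) : Cmod tau = 1 -> Cmod (1 - Cconj tau * w)%C = Cmod (w - tau)%C.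
Proof.
intros Ht; rewrite one_minus_conj_eq, Cmod_mult, Cmod_conj, Ht, Cmod_sub_sym by trivial; ring.
Qed.

Definition boundary_quot (phi : C -> C) (sigma tau z : C) : C :=
  ((1 - Cconj tau * phi z) / (1 - Cconj sigma * z))%C.

Lemma tends_eventually_seq (u : nat -> R) (l : R) :
  tends eventually (fun n => RtoC (u n)) (RtoC l) <-> is_lim_seq u l.
Proof.
rewrite tends_R; split.
- intros H; apply is_lim_seq_spec; intros eps; exact (H eps (cond_pos eps)).
- intros H eps He; apply is_lim_seq_spec in H; exact (H (mkposreal eps He)).
Qed.

Section Weak.
Variables (phi : C -> C) (sigma : C).
Hypothesis hphi : holomorphic_self_map phi.
Hypothesis hsigma : Cmod sigma = 1.

Section FromWeak.
Variable tau : C.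
Hypothesis htau : Cmod tau = 1.
Hypothesis Hlim : angular_lim phi sigma tau.
Hypothesis Harg : angular_arg_lim (boundary_quot phi sigma tau) sigma 0.

Lemma boundary_quot_sector M eta :
  1 < M -> 0 < eta -> stolz_filter sigma M (fun z => sector eta (boundary_quot phi sigma tau z)).
Proof.
intros HM He.
generalize (proj1 (arg_lim_sector _ _ 0) (Harg M HM) eta He); apply filter_imp; intros z Hz.
rewrite Ropp_0, cis_0, Cmult_1_r in Hz; exact Hz.
Qed.

Lemma boundary_quot_cdiff z : in_disk z -> cdiff (boundary_quot phi sigma tau) z.
Proof.
intros Hz; apply cdiff_div.
- now apply one_minus_conj_neq0.
- apply cdiff_minus; [apply cdiff_const|].
  apply cdiff_mult; [apply cdiff_const|now apply self_map_cdiff].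
- apply cdiff_minus; [apply cdiff_const|].
  apply cdiff_mult; [apply cdiff_const|apply cdiff_id].
Qed.

(** Two computations of the derivative of 1 - conj(tau) phi, once directly and once as the product
    of the boundary quotient and 1 - conj(sigma) z. *)
Lemma boundary_quot_deriv z : in_disk z ->
  (Cconj tau * C_derive phi z)%C =
  (Cconj sigma * boundary_quot phi sigma tau z
    - C_derive (boundary_quot phi sigma tau) z * (1 - Cconj sigma * z))%C.
Proof.
intros Hz.
pose proof (cdiff_C_derive _ _ (boundary_quot_cdiff z Hz)) as DQ.
pose proof (cdiff_C_derive _ _ (self_map_cdiff phi hphi z Hz)) as Dphi.
set (Q' := C_derive (boundary_quot phi sigma tau) z) in *.
assert (D1 : cderiv (fun w => boundary_quot phi sigma tau w * (1 + (- Cconj sigma) * w))%C z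
   (Q' * (1 + (- Cconj sigma) * z) + boundary_quot phi sigma tau z * (0 + (0 * z + (- Cconj sigma) * 1)))%C).
{ apply (cderiv_mult _ (fun w => 1 + (- Cconj sigma) * w)%C); [exact DQ|].
  apply (cderiv_plus (fun _ => RtoC 1)); [apply cderiv_const|].
  apply (cderiv_mult (fun _ => (- Cconj sigma)%C) (fun w => w)); [apply cderiv_const|apply cderiv_id]. }
assert (D2 : cderiv (fun w => 1 + (- Cconj tau) * phi w)%C z
   (0 + (0 * phi z + (- Cconj tau) * C_derive phi z))%C).
{ apply (cderiv_plus (fun _ => RtoC 1)); [apply cderiv_const|].
  apply (cderiv_mult (fun _ => (- Cconj tau)%C) phi); [apply cderiv_const|exact Dphi]. }
assert (D3 : cderiv (fun w => 1 + (- Cconj tau) * phi w)%C z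
   (Q' * (1 + (- Cconj sigma) * z) + boundary_quot phi sigma tau z * (0 + (0 * z + (- Cconj sigma) * 1)))%C).
{ revert D1; apply cderiv_ext_loc.
  exists (1 - Cmod z); split; [unfold in_disk in Hz; lra|].
  intros w Hw; apply in_disk_ball in Hw.
  pose proof (one_minus_conj_neq0 sigma w hsigma Hw) as N.
  unfold boundary_quot.
  replace (1 + - Cconj sigma * w)%C with (1 - Cconj sigma * w)%C by ring.
  field; exact N. }
apply cderiv_C_derive in D2; apply cderiv_C_derive in D3; rewrite D2 in D3.
transitivity (- (0 + (0 * phi z + - Cconj tau * C_derive phi z)))%C; [ring|].
rewrite D3; ring.
Qed.

(* Rotating a thin sector into the right half-plane and applying the Schwarz lemma there
   makes the logarithmic derivative of the boundary quotient small. *)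
Lemma boundary_quot_deriv_small M eta :
  1 < M -> 0 < eta ->
  stolz_filter sigma M (fun z =>
    Cmod (C_derive (boundary_quot phi sigma tau) z) * (1 - Cmod z)
      <= 8 * eta * Cmod (boundary_quot phi sigma tau z)).
Proof.
intros HM He.
assert (HM' : 1 < 2 * M + 1) by lra.
pose proof (boundary_quot_sector (2 * M + 1) eta HM' He) as S.
apply stolz_filter_ball in S; destruct S as (d & Hd & S).
apply stolz_filter_ball; exists (d / 2); split; [lra|].
intros z Hz Hzd.
set (Q := boundary_quot phi sigma tau) in *.
assert (Hzd' : in_disk z) by apply Hz; unfold in_disk in Hzd'.
assert (Sz : sector eta (Q z)).
{ apply S; [|lra]; apply stolz_mono with M; [lra|exact Hz]. }
pose proof (sector_Re _ _ He Sz) as Rz.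
(* Multiplication by [c] carries the lower edge of the sector to the imaginary axis and the sector
   itself into the right half-plane. *)
set (c := ((eta, -1) : C)).
assert (B := positive_re_deriv_bound (fun w => c * Q w)%C z ((1 - Cmod z) / 2)
  (0 * Q z + c * C_derive Q z)%C).
assert (Rc : forall w, Re (c * w)%C = eta * Re w + Im w).
{ intros w; rewrite re_mult; simpl; ring. }
assert (B' : Cmod (0 * Q z + c * C_derive Q z)%C * ((1 - Cmod z) / 2) <= 2 * Re (c * Q z)%C).
{ apply B; [lra| |].
  - intros w Hw; destruct (stolz_ball sigma M z w hsigma Hz Hw) as [Sw Dw].
    assert (Qw : sector eta (Q w)) by (apply S; [exact Sw|lra]).
    split.
    + apply cdiff_mult; [apply cdiff_const|]; apply boundary_quot_cdiff; apply Sw.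
    + rewrite Rc; unfold sector in Qw; apply Rabs_def2 in Qw; lra.
  - apply (cderiv_mult (fun _ => c) Q); [apply cderiv_const|].
    apply cdiff_C_derive, boundary_quot_cdiff; apply Hz. }
replace (0 * Q z + c * C_derive Q z)%C with (c * C_derive Q z)%C in B' by ring.
rewrite Cmod_mult, Rc in B'.
unfold sector in Sz; apply Rabs_def2 in Sz.
assert (Lc : 1 <= Cmod c).
{ pose proof (im_le_Cmod c) as I; simpl in I; rewrite (Rabs_left (-1)) in I; lra. }
pose proof (Rle_trans _ _ _ (Rle_abs _) (re_le_Cmod (Q z))) as RQ.
pose proof (Cmod_ge_0 (C_derive Q z)) as P0.
assert (Cmod (C_derive Q z) * ((1 - Cmod z) / 2) <= Cmod c * Cmod (C_derive Q z) * ((1 - Cmod z) / 2)).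
{ apply Rmult_le_compat_r; [lra|]; nra. }
assert (eta * Re (Q z) <= eta * Cmod (Q z)) by (apply Rmult_le_compat_l; lra).
lra.
Qed.

(** For unimodular sigma and tau this is the Visser-Ostrowski quotient phi'(z) (sigma - z) / (tau -
    phi(z)). *)
Definition deriv_ratio z := (Cconj tau * sigma * C_derive phi z / boundary_quot phi sigma tau z)%C.

Lemma deriv_ratio_lim M : 1 < M -> tends (stolz_filter sigma M) deriv_ratio 1.
Proof.
intros HM eps He.
(* The factor 8 comes from the logarithmic derivative bound and the factor M from |z - sigma| < M (1
   - |z|); this leaves eps / 2. *)
set (eta := eps / (16 * M)).
assert (He' : 0 < eta) by (apply Rdiv_lt_0_compat; lra).
generalize (filter_and _ _ (boundary_quot_sector M eta HM He')
  (filter_and _ _ (boundary_quot_deriv_small M eta HM He')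
    (proj2 (stolz_filter_ball sigma M (stolz sigma M)) (ex_intro _ 1 (conj Rlt_0_1 (fun z H _ => H)))))).
apply filter_imp; intros z (Sz & Bz & Hz).
pose proof (sector_Re _ _ He' Sz) as Rz.
assert (Nq : boundary_quot phi sigma tau z <> RtoC 0).
{ intros E; rewrite E in Rz; simpl in Rz; lra. }
destruct Hz as [Hd Hz].
unfold deriv_ratio.
set (Q := boundary_quot phi sigma tau) in *; set (Q' := C_derive Q z) in *.
replace (Cconj tau * sigma * C_derive phi z / Q z - 1)%C
  with (- (sigma * (1 - Cconj sigma * z) * Q' / Q z))%C.
2: { replace (Cconj tau * sigma * C_derive phi z)%C with (sigma * (Cconj tau * C_derive phi z))%C by ring.
     rewrite boundary_quot_deriv by trivial; fold Q; fold Q'.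
     replace (sigma * (Cconj sigma * Q z - Q' * (1 - Cconj sigma * z)))%C
       with ((Cconj sigma * sigma) * Q z - sigma * (1 - Cconj sigma * z) * Q')%C by ring.
     rewrite (unimodular_conj sigma hsigma); field; exact Nq. }
rewrite Cmod_opp, Cmod_div, !Cmod_mult, hsigma, Cmod_one_minus_conj by trivial.
pose proof Nq as Nq'; apply Cmod_gt_0 in Nq'.
apply Rlt_div_l; [exact Nq'|].
unfold in_disk in Hd.
pose proof (Cmod_ge_0 Q').
assert (Cmod (z - sigma)%C * Cmod Q' <= M * (1 - Cmod z) * Cmod Q') by (apply Rmult_le_compat_r; lra).
assert (M * (Cmod Q' * (1 - Cmod z)) <= M * (8 * eta * Cmod (Q z))) by (apply Rmult_le_compat_l; lra).
replace (M * (8 * eta * Cmod (Q z))) with (eps / 2 * Cmod (Q z)) in * by (unfold eta; field; lra).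
nra.
Qed.

Lemma weak_ex_angular_arg_deriv : ex_angular_arg_lim (C_derive phi) sigma.
Proof.
intros M HM.
(* Since phi' equals tau conj(sigma) times [deriv_ratio] times the boundary quotient, the limit of
   its argument can only be that of tau conj(sigma). *)
destruct (unimodular_cis (tau * Cconj sigma)%C) as [theta Hth].
{ rewrite Cmod_mult, Cmod_conj, htau, hsigma; ring. }
assert (Hc : cis (- theta) = (Cconj tau * sigma)%C).
{ rewrite <- cis_conj, <- Hth, Cmult_conj, Cconj_conj; reflexivity. }
assert (S : forall eta, 0 < eta -> stolz_filter sigma M (fun z => sector eta (C_derive phi z * cis (- theta))%C)).
{ intros eta He.
  set (e := Rmin (1 / 2) (eta / 4)).
  assert (E0 : 0 < e) by (apply Rmin_pos; lra).
  assert (E1 : e <= 1 / 2) by apply Rmin_l.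
  assert (E2 : e <= eta / 4) by apply Rmin_r.
  generalize (filter_and _ _ (tends1_sector _ _ e E0 (deriv_ratio_lim M HM)) (boundary_quot_sector M e HM E0)).
  apply filter_imp; intros z [H1 H2].
  apply sector_mono with (2 * (e + e)); [lra|lra|].
  replace (C_derive phi z * cis (- theta))%C with (deriv_ratio z * boundary_quot phi sigma tau z)%C.
  - apply sector_mult; trivial; nra.
  - rewrite Hc; unfold deriv_ratio; field.
    intros E; pose proof (sector_Re _ _ E0 H2) as R2; rewrite E in R2; simpl in R2; lra. }
pose proof (S 1 Rlt_0_1) as S1; apply stolz_filter_ball in S1; destruct S1 as (d & Hd & S1).
exists d; split; [exact Hd|]; split.
- intros z Hz Hzd E; specialize (S1 z Hz Hzd).
  apply sector_Re in S1; [|lra]; rewrite E, Cmult_0_l in S1; simpl in S1; lra.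
- exists theta; apply arg_lim_sector; [apply stolz_filter_filter|exact S].
Qed.

End FromWeak.

(** * The radial points and the distortion along them *)

Definition radial_real (n : nat) : R := (3 ^ n - 1) / (3 ^ n + 1).
Definition radial (n : nat) : C := (RtoC (radial_real n) * sigma)%C.

Lemma pow3_ge1 n : 1 <= 3 ^ n.
Proof. apply pow_R1_Rle; lra. Qed.

Lemma radial_real_bounds n : 0 <= radial_real n < 1.
Proof.
pose proof (pow3_ge1 n); unfold radial_real; split.
- apply Rle_div_r; lra.
- apply Rlt_div_l; lra.
Qed.

Lemma Cmod_radial n : Cmod (radial n) = radial_real n.
Proof.
unfold radial; rewrite Cmod_mult, hsigma, Cmod_R, Rabs_pos_eq; [ring|apply radial_real_bounds].
Qed.

Lemma radial_disk n : in_disk (radial n).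
Proof. unfold in_disk; rewrite Cmod_radial; apply radial_real_bounds. Qed.

Lemma Cmod_radial_sigma n : Cmod (radial n - sigma)%C = 1 - radial_real n.
Proof.
unfold radial; replace (RtoC (radial_real n) * sigma - sigma)%C with (RtoC (radial_real n - 1) * sigma)%C
  by (rewrite RtoC_minus; ring).
pose proof (radial_real_bounds n).
rewrite Cmod_mult, hsigma, Cmod_R, Rabs_left; lra.
Qed.

Lemma radial_stolz M n : 1 < M -> stolz sigma M (radial n).
Proof.
intros HM; split; [apply radial_disk|].
rewrite Cmod_radial_sigma, Cmod_radial; pose proof (radial_real_bounds n); nra.
Qed.

Lemma radial_real_lim : is_lim_seq radial_real 1.
Proof.
apply is_lim_seq_ext with (fun n => 1 - 2 * / (3 ^ n + 1)).
{ intros n; unfold radial_real; pose proof (pow3_ge1 n); field; lra. }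
replace (Finite 1) with (Finite (1 - 2 * 0)) by (f_equal; ring).
apply is_lim_seq_minus'; [apply is_lim_seq_const|].
apply is_lim_seq_mult'; [apply is_lim_seq_const|].
apply (is_lim_seq_inv _ p_infty); [|easy].
apply is_lim_seq_le_p_loc with (fun n => 3 ^ n).
- exists O; intros n _; lra.
- apply is_lim_seq_geom_p; lra.
Qed.

Lemma radial_lim : filterlim radial eventually (locally sigma).
Proof.
apply tends_filterlim; [apply eventually_filter|].
apply tends_ext with (fun n => RtoC (radial_real n) * sigma)%C; [reflexivity|].
apply (eq_ind (RtoC 1 * sigma)%C (fun l => tends _ _ l)); [|ring].
apply tends_mult; [|apply tends_const].
apply tends_eventually_seq, radial_real_lim.
Qed.

Lemma radial_stolz_lim M : 1 < M -> filterlim radial eventually (stolz_filter sigma M).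
Proof.
intros HM P HP; unfold stolz_filter, within in HP.
generalize (radial_lim _ HP); unfold filtermap; apply filter_imp; intros n Hn.
apply Hn; now apply radial_stolz.
Qed.

Lemma radial_nontangential : nontangential_cv radial sigma.
Proof.
split; [apply radial_lim|]; exists 2; split; [lra|]; intros n; apply radial_stolz; lra.
Qed.

Lemma conj_RtoC_mult x c : Cconj (RtoC x * c)%C = (RtoC x * Cconj c)%C.
Proof. rewrite Cmult_conj; f_equal; unfold Cconj; simpl; now rewrite Ropp_0. Qed.

Lemma mob_radial n m :
  mob (radial n) (radial m) = (RtoC ((radial_real m - radial_real n) / (1 - radial_real n * radial_real m)) * sigma)%C.
Proof.
pose proof (radial_real_bounds n); pose proof (radial_real_bounds m).
assert (N : 1 - radial_real n * radial_real m <> 0) by nra.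
unfold mob, radial.
rewrite conj_RtoC_mult.
replace (1 - RtoC (radial_real n) * Cconj sigma * (RtoC (radial_real m) * sigma))%C
  with (1 - RtoC (radial_real n) * RtoC (radial_real m) * (Cconj sigma * sigma))%C by ring.
rewrite (unimodular_conj sigma hsigma), RtoC_div, !RtoC_minus, RtoC_mult by exact N.
field.
rewrite <- RtoC_mult, <- RtoC_minus; intros E; apply RtoC_inj in E; lra.
Qed.

Lemma mob_radial_succ n : mob (radial n) (radial (S n)) = (RtoC (1 / 2) * sigma)%C.
Proof.
rewrite mob_radial; do 2 f_equal; unfold radial_real.
pose proof (pow3_ge1 n); simpl; field; repeat split; nra.
Qed.

Lemma mob_radial_pred n : mob (radial (S n)) (radial n) = (RtoC (- (1 / 2)) * sigma)%C.
Proof.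
rewrite mob_radial; do 2 f_equal; unfold radial_real.
pose proof (pow3_ge1 n); simpl; field; repeat split; nra.
Qed.

Lemma radial_bounded_step : bounded_step radial.
Proof.
exists (ln 3); split; [rewrite <- ln_1; apply ln_increasing; lra|].
intros n; unfold hyp_dist; rewrite pseudo_hyp_mob, mob_radial_pred.
rewrite Cmod_mult, hsigma, Cmod_R, Rabs_Ropp, Rabs_pos_eq by lra.
replace ((1 + 1 / 2 * 1) / (1 - 1 / 2 * 1)) with 3 by field; lra.
Qed.

(** With v = 1 - conj(tau) phi one has 1 - |phi|^2 = 2 Re v - |v|^2, so at the radial point of
    modulus x the distortion is (1 + x) |[deriv_ratio]| / (2 Re v / |v| - |v|). The thin sectors
    give Re v / |v| -> 1, and the whole tends to 2 / 2. *)
Lemma weak_distortion_radial tau :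
  Cmod tau = 1 -> angular_lim phi sigma tau ->
  angular_arg_lim (boundary_quot phi sigma tau) sigma 0 ->
  is_lim_seq (fun n => hyp_distortion phi (radial n)) 1.
Proof.
intros Ht Hlim Harg.
assert (H12 : 1 < 2) by lra.
set (Q := boundary_quot phi sigma tau).
set (v := fun n => (1 - Cconj tau * phi (radial n))%C).
assert (Hv : tends eventually v 0).
{ apply (eq_ind (1 - Cconj tau * tau)%C (fun l => tends _ _ l)).
  2: { rewrite unimodular_conj by trivial; ring. }
  apply tends_minus; [apply tends_const|].
  apply tends_mult; [apply tends_const|].
  apply (tends_comp eventually (stolz_filter sigma 2) radial phi); [now apply radial_stolz_lim|].
  apply tends_filterlim; [apply stolz_filter_filter|now apply Hlim]. }
assert (HD : tends eventually (fun n => deriv_ratio tau (radial n)) 1).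
{ apply (tends_comp eventually (stolz_filter sigma 2) radial); [now apply radial_stolz_lim|].
  now apply deriv_ratio_lim. }
assert (Hvn : forall n, 0 < Cmod (v n)).
{ intros n; apply Cmod_gt_0, one_minus_conj_neq0; [exact Ht|apply self_map_disk; trivial; apply radial_disk]. }
assert (EQ : forall n, v n = (RtoC (1 - radial_real n) * Q (radial n))%C).
{ intros n; unfold Q, boundary_quot; fold (v n).
  replace (1 - Cconj sigma * radial n)%C with (RtoC (1 - radial_real n)).
  - field; intros E; apply RtoC_inj in E; pose proof (radial_real_bounds n); lra.
  - unfold radial; rewrite RtoC_minus.
    replace (Cconj sigma * (RtoC (radial_real n) * sigma))%C
      with (RtoC (radial_real n) * (Cconj sigma * sigma))%C by ring.
    rewrite unimodular_conj by trivial; ring. }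
assert (Hre : is_lim_seq (fun n => Re (v n) / Cmod (v n)) 1).
{ apply is_lim_seq_spec; intros [eps He].
  change (eventually (fun n => Rabs (Re (v n) / Cmod (v n) - 1) < eps)).
  generalize (radial_stolz_lim 2 H12 _ (boundary_quot_sector tau Harg 2 eps H12 He)).
  unfold filtermap; apply filter_imp; intros n Sn.
  pose proof (sector_Re _ _ He Sn) as R0; unfold sector in Sn; fold Q in Sn, R0.
  specialize (Hvn n).
  assert (S1 : Rabs (Im (v n)) < eps * Re (v n)).
  { rewrite EQ, im_scal_l, re_scal_l, Rabs_mult, Rabs_pos_eq by (pose proof (radial_real_bounds n); lra).
    pose proof (radial_real_bounds n); nra. }
  pose proof (Cmod_le_sum (v n)) as L.
  pose proof (Rle_trans _ _ _ (Rle_abs _) (re_le_Cmod (v n))) as L2.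
  assert (R1 : 0 < Re (v n)).
  { rewrite EQ, re_scal_l; pose proof (radial_real_bounds n); nra. }
  rewrite (Rabs_pos_eq (Re (v n))) in L by lra.
  apply Rabs_def1.
  - assert (Re (v n) / Cmod (v n) <= 1) by (apply Rle_div_l; lra); lra.
  - assert (1 - eps < Re (v n) / Cmod (v n)); [|lra].
    apply Rlt_div_r; [lra|]; nra. }
apply tends_Cmod in Hv; apply tends_Cmod in HD; rewrite Cmod_0 in Hv; rewrite Cmod_1 in HD.
apply tends_eventually_seq in Hv; apply tends_eventually_seq in HD.
apply is_lim_seq_ext with (fun n => (1 + radial_real n) * Cmod (deriv_ratio tau (radial n)) *
  / (2 * (Re (v n) / Cmod (v n)) - Cmod (v n))).
{ intros n.
  pose proof (radial_real_bounds n) as Rn; pose proof (Hvn n) as Vn.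
  assert (Nq : Q (radial n) <> RtoC 0).
  { intros E; specialize (EQ n); rewrite E, Cmult_0_r in EQ; rewrite EQ, Cmod_0 in Vn; lra. }
  unfold hyp_distortion, deriv_ratio; rewrite Cmod_radial.
  fold Q; rewrite Cmod_div, !Cmod_mult, Cmod_conj, Ht, hsigma by trivial.
  assert (Eq : Cmod (Q (radial n)) = Cmod (v n) / (1 - radial_real n)).
  { rewrite EQ, Cmod_mult, Cmod_R, Rabs_pos_eq by lra; field; lra. }
  rewrite Eq.
  assert (Ep : 1 - Cmod (phi (radial n)) ^ 2 = 2 * Re (v n) - Cmod (v n) ^ 2).
  { assert (Et : Cmod (phi (radial n)) = Cmod (1 - v n)%C).
    { unfold v; replace (1 - (1 - Cconj tau * phi (radial n)))%C with (Cconj tau * phi (radial n))%C by ring.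
      rewrite Cmod_mult, Cmod_conj, Ht; ring. }
    rewrite Et, !Cmod2_alt, Re_minus, Im_minus; simpl; ring. }
  rewrite Ep.
  assert (P1 : 0 < 2 * Re (v n) - Cmod (v n) ^ 2).
  { rewrite <- Ep; pose proof (self_map_disk phi hphi _ (radial_disk n)) as K.
    unfold in_disk in K; pose proof (Cmod_ge_0 (phi (radial n))); nra. }
  field; repeat split; lra. }
replace (Finite 1) with (Finite ((1 + 1) * 1 * / (2 * 1 - 0))) by (f_equal; field).
apply is_lim_seq_mult'.
- apply is_lim_seq_mult'; [|exact HD].
  apply is_lim_seq_plus'; [apply is_lim_seq_const|apply radial_real_lim].
- apply (is_lim_seq_inv _ (Finite (2 * 1 - 0))); [|intros E; injection E; lra].
  apply is_lim_seq_minus'; [|exact Hv].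
  apply is_lim_seq_mult'; [apply is_lim_seq_const|exact Hre].
Qed.

End Weak.

(** * Weak conformality from the argument of the derivative *)

Lemma cderiv_segment (f : C -> C) (z c k l : C) (t : R) :
  cderiv f (z + RtoC t * c)%C l ->
  derivable_pt_lim (fun s => Re (k * f (z + RtoC s * c)%C)%C) t (Re (k * l * c)%C).
Proof.
intros H eps He.
assert (HK : 0 < Cmod k * Cmod c + 1) by (pose proof (Cmod_ge_0 k); pose proof (Cmod_ge_0 c); nra).
assert (Hc1 : 0 < Cmod c + 1) by (pose proof (Cmod_ge_0 c); lra).
assert (He' : 0 < eps / (Cmod k * Cmod c + 1)) by now apply Rdiv_lt_0_compat.
destruct (cderiv_bound _ _ _ H _ He') as (d & Hd & B).
assert (Hd' : 0 < d / (Cmod c + 1)) by now apply Rdiv_lt_0_compat.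
exists (mkposreal _ Hd'); intros h Hh Hhd; simpl in Hhd.
apply Rlt_div_r in Hhd; [|exact Hc1].
assert (Ed : (z + RtoC (t + h) * c - (z + RtoC t * c))%C = (RtoC h * c)%C) by (rewrite RtoC_plus; ring).
specialize (B (z + RtoC (t + h) * c)%C); rewrite Ed, Cmod_mult, Cmod_R in B.
assert (P : 0 < Rabs h) by now apply Rabs_pos_lt.
pose proof (Cmod_ge_0 c) as C0; pose proof (Cmod_ge_0 k) as K0.
specialize (B ltac:(nra)).
set (X := (f (z + RtoC (t + h) * c) - f (z + RtoC t * c) - l * (RtoC h * c))%C) in *.
replace ((Re (k * f (z + RtoC (t + h) * c))%C - Re (k * f (z + RtoC t * c))%C) / h - Re (k * l * c)%C)
  with (Re (k * X)%C / h).
2: { unfold X.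
     replace (k * (f (z + RtoC (t + h) * c) - f (z + RtoC t * c) - l * (RtoC h * c)))%C
       with (k * f (z + RtoC (t + h) * c) - k * f (z + RtoC t * c) - RtoC h * (k * l * c))%C by ring.
     rewrite !Re_minus, re_scal_l; field; exact Hh. }
unfold Rdiv; rewrite Rabs_mult, Rabs_inv.
apply Rlt_div_l; [exact P|].
apply Rle_lt_trans with (1 := re_le_Cmod _); rewrite Cmod_mult.
apply Rle_lt_trans with (Cmod k * (eps / (Cmod k * Cmod c + 1) * (Rabs h * Cmod c))).
{ now apply Rmult_le_compat_l. }
replace (Cmod k * (eps / (Cmod k * Cmod c + 1) * (Rabs h * Cmod c)))
  with (eps * Rabs h * ((Cmod k * Cmod c) / (Cmod k * Cmod c + 1))) by (field; lra).
assert (Cmod k * Cmod c / (Cmod k * Cmod c + 1) < 1) by (apply Rlt_div_l; lra).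
assert (0 < eps * Rabs h) by (apply Rmult_lt_0_compat; lra).
rewrite <- (Rmult_1_r (eps * Rabs h)) at 2; now apply Rmult_lt_compat_l.
Qed.

Section FromArgDeriv.
Variables (phi : C -> C) (sigma tau : C).
Hypothesis hphi : holomorphic_self_map phi.
Hypothesis hsigma : Cmod sigma = 1.
Hypothesis htau : Cmod tau = 1.
Hypothesis Hlim : angular_lim phi sigma tau.

Lemma segment_tends M z :
  1 < M -> stolz sigma M z ->
  forall eps, 0 < eps -> exists t0, 1 / 2 < t0 < 1 /\ forall t, t0 < t < 1 ->
    Cmod (phi (z + RtoC t * (sigma - z)) - tau)%C < eps.
Proof.
intros HM Hz eps He.
assert (T : tends (stolz_filter sigma M) phi tau).
{ apply tends_filterlim; [apply stolz_filter_filter|now apply Hlim]. }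
specialize (T eps He); apply stolz_filter_ball in T; destruct T as (d & Hd & T).
set (D := Cmod (z - sigma)%C).
assert (D0 : 0 <= D) by apply Cmod_ge_0.
assert (P : 0 < d / (D + 1)) by (apply Rdiv_lt_0_compat; lra).
exists (Rmax (3 / 4) (1 - d / (D + 1))); split.
- split; [apply Rlt_le_trans with (2 := Rmax_l _ _); lra|apply Rmax_lub_lt; lra].
- intros t Ht.
  pose proof (Rmax_l (3 / 4) (1 - d / (D + 1))); pose proof (Rmax_r (3 / 4) (1 - d / (D + 1))).
  destruct (stolz_segment sigma M z t hsigma Hz) as [S E]; [lra|].
  apply T; [exact S|]; rewrite E; fold D.
  assert (L : 1 - t < d / (D + 1)) by lra.
  apply Rlt_div_r in L; [|lra]; nra.
Qed.

(** Mean value theorem on the half-open segment from z to sigma; the value at sigma is reached only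
    as an angular limit. Passing to that limit destroys strictness, which is rescued by the gain
    between the parameters 0 and 1/2. *)
Lemma boundary_increment_pos M z k :
  1 < M -> stolz sigma M z ->
  (forall w, stolz sigma M w -> Cmod (w - sigma)%C <= Cmod (z - sigma)%C ->
    0 < Re (k * C_derive phi w * (sigma - z))%C) ->
  0 < Re (k * (tau - phi z))%C.
Proof.
intros HM Hz Hk.
set (psi := fun t => Re (k * phi (z + RtoC t * (sigma - z)))%C).
assert (Hpsi : forall a b, 0 <= a < b -> b < 1 -> psi a < psi b).
{ intros a b Hab Hb.
  destruct (MVT_cor2 psi (fun t => Re (k * C_derive phi (z + RtoC t * (sigma - z)) * (sigma - z))%C) a b)
    as (c & Ec & Hc); [lra| |].
  - intros c Hc; apply cderiv_segment, cdiff_C_derive, self_map_cdiff; trivial.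
    apply (stolz_segment sigma M z c hsigma Hz); lra.
  - destruct (stolz_segment sigma M z c hsigma Hz) as [S E]; [lra|].
    assert (0 < Re (k * C_derive phi (z + RtoC c * (sigma - z)) * (sigma - z))%C).
    { apply Hk; [exact S|]; rewrite E; pose proof (Cmod_ge_0 (z - sigma)%C); nra. }
    nra. }
assert (P0 : psi 0 = Re (k * phi z)%C).
{ unfold psi; do 3 f_equal; ring. }
assert (P1 : psi 0 < psi (1 / 2)) by (apply Hpsi; lra).
assert (Ptau : psi (1 / 2) <= Re (k * tau)%C).
{ apply le_epsilon; intros eps He.
  assert (HK : 0 < Cmod k + 1) by (pose proof (Cmod_ge_0 k); lra).
  destruct (segment_tends M z HM Hz (eps / (Cmod k + 1))) as (t0 & Ht0 & T).
  { now apply Rdiv_lt_0_compat. }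
  set (t := (t0 + 1) / 2).
  specialize (T t ltac:(unfold t; lra)).
  apply Rlt_div_r in T; [|exact HK].
  assert (psi (1 / 2) < psi t) by (apply Hpsi; unfold t; lra).
  pose proof (re_le_Cmod (k * (phi (z + RtoC t * (sigma - z)) - tau))%C) as R.
  rewrite Cmod_mult in R.
  replace (Re (k * (phi (z + RtoC t * (sigma - z)) - tau))%C) with (psi t - Re (k * tau)%C) in R.
  2: { unfold psi; rewrite <- Re_minus; f_equal; ring. }
  apply Rabs_le_between in R.
  pose proof (Cmod_ge_0 (phi (z + RtoC t * (sigma - z)) - tau)%C); nra. }
replace (k * (tau - phi z))%C with (k * tau - k * phi z)%C by ring.
rewrite Re_minus; lra.
Qed.

(** If phi' lies in a rotated thin sector along the segment, so does its average (tau - phi(z)) /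
    (sigma - z); each of the two bounding half-planes is handled separately by s = 1 and s = -1. The
    direction [e] may depend on [M], as the limit of the argument does in the hypothesis. *)
Lemma arg_deriv_direction M :
  1 < M -> ex_angular_arg_lim (C_derive phi) sigma ->
  exists e, Cmod e = 1 /\ forall eta, 0 < eta ->
    stolz_filter sigma M (fun z => sector eta (boundary_quot phi sigma tau z * Cconj e)%C).
Proof.
intros HM Hex; destruct (Hex M HM) as (_ & _ & _ & theta & Harg).
exists (cis theta * Cconj tau * sigma)%C; split.
{ rewrite !Cmod_mult, Cmod_cis, Cmod_conj, htau, hsigma; ring. }
intros eta He.
pose proof (proj1 (arg_lim_sector _ _ theta) Harg eta He) as S.
apply stolz_filter_ball in S; destruct S as (d & Hd & S).
apply stolz_filter_ball; exists d; split; [exact Hd|]; intros z Hz Hzd.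
assert (Hzd' : in_disk z) by apply Hz.
assert (N : (sigma - z)%C <> RtoC 0).
{ intros E; apply Ceq_minus in E; unfold in_disk in Hzd'; rewrite <- E in Hzd'; lra. }
assert (Ns : Cconj sigma <> RtoC 0) by (apply Cmod_gt_0; rewrite Cmod_conj, hsigma; lra).
set (X := ((tau - phi z) / (sigma - z) * cis (- theta))%C).
replace (boundary_quot phi sigma tau z * Cconj (cis theta * Cconj tau * sigma))%C with X.
2: { unfold boundary_quot, X.
     rewrite !one_minus_conj_eq by trivial.
     rewrite !Cmult_conj, Cconj_conj, cis_conj.
     transitivity ((Cconj tau * tau) * (tau - phi z) / (sigma - z) * cis (- theta))%C.
     - rewrite unimodular_conj by trivial; field; exact N.
     - field; split; trivial. }
assert (L : forall s, s = 1 \/ s = -1 -> 0 < eta * Re X + s * Im X).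
{ intros s Hs; set (kk := ((eta, - s) : C)).
  replace (eta * Re X + s * Im X) with (Re (kk / (sigma - z) * cis (- theta) * (tau - phi z))%C).
  - apply boundary_increment_pos with M; trivial.
    intros w Hw Hwd.
    replace (kk / (sigma - z) * cis (- theta) * C_derive phi w * (sigma - z))%C
      with (kk * (C_derive phi w * cis (- theta)))%C by (field; exact N).
    specialize (S w Hw ltac:(lra)).
    rewrite re_mult; simpl (Re kk); simpl (Im kk).
    unfold sector in S; apply Rabs_def2 in S.
    destruct Hs as [-> | ->]; lra.
  - replace (kk / (sigma - z) * cis (- theta) * (tau - phi z))%C with (kk * X)%C
      by (unfold X; field; exact N).
    rewrite re_mult; simpl (Re kk); simpl (Im kk); ring. }
unfold sector; pose proof (L 1 (or_introl eq_refl)); pose proof (L (-1) (or_intror eq_refl)).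
apply Rabs_def1; lra.
Qed.

(* A Stolz region of large aperture contains points at which 1 - conj(sigma) z has argument
   close to pi/2 or -pi/2; since 1 - conj(tau) phi has positive real part, the limit
   direction of the quotient has to be close to 1. *)
Lemma direction_near_one M k e :
  1 < M -> 0 < k -> 2 * (1 + k) < M -> Cmod e = 1 ->
  (forall eta, 0 < eta ->
    stolz_filter sigma M (fun z => sector eta (boundary_quot phi sigma tau z * Cconj e)%C)) ->
  sector (2 / k) e.
Proof.
intros HM Hk HkM He S.
assert (B : forall s, s = 1 \/ s = -1 -> 0 <= Re e - s * k * Im e).
{ intros s Hs; apply le_epsilon; intros eps Heps.
  set (eta := eps / (2 * (1 + k))).
  assert (Heta : 0 < eta) by (apply Rdiv_lt_0_compat; lra).
  destruct (proj1 (stolz_filter_ball _ _ _) (S eta Heta)) as (d & Hd & S').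
  (* The point z is chosen so that 1 - conj(sigma) z = del (1 + i s k). The first bound on [del]
     gives 1 - |z| >= del / 2, so the aperture needed is at most 2 (1 + k); the second puts z within
     [d] of sigma. *)
  set (del := Rmin (/ (1 + k) ^ 2) (d / (2 * (1 + k)))).
  assert (D0 : 0 < del).
  { apply Rmin_pos; [apply Rinv_0_lt_compat, pow_lt; lra|apply Rdiv_lt_0_compat; lra]. }
  assert (D1 : del * (1 + k) ^ 2 <= 1).
  { apply Rle_trans with (/ (1 + k) ^ 2 * (1 + k) ^ 2); [|right; field; lra].
    apply Rmult_le_compat_r; [apply pow2_ge_0|apply Rmin_l]. }
  assert (D2 : del * (2 * (1 + k)) <= d) by (apply Rle_div_r; [lra|apply Rmin_r]).
  set (c := ((1, s * k) : C)).
  set (z := (sigma * (1 - RtoC del * c))%C).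
  assert (Ez : (1 - Cconj sigma * z)%C = (RtoC del * c)%C).
  { unfold z; replace (1 - Cconj sigma * (sigma * (1 - RtoC del * c)))%C
      with (1 - Cconj sigma * sigma * (1 - RtoC del * c))%C by ring.
    rewrite unimodular_conj by trivial; ring. }
  assert (s2 : s * s = 1) by (destruct Hs as [-> | ->]; ring).
  assert (Cc : Cmod c ^ 2 = 1 + k ^ 2).
  { rewrite Cmod2_alt; simpl; replace (s * k * (s * k * 1)) with (s * s * (k * k)) by ring.
    rewrite s2; ring. }
  assert (Cc' : Cmod c <= 1 + k).
  { pose proof (Cmod_ge_0 c); nra. }
  assert (Zs : Cmod (z - sigma)%C = del * Cmod c).
  { rewrite <- Cmod_one_minus_conj, Ez, Cmod_mult, Cmod_R, Rabs_pos_eq by (trivial; lra); reflexivity. }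
  assert (Z2 : Cmod z ^ 2 = 1 - 2 * del + del ^ 2 * Cmod c ^ 2).
  { unfold z; rewrite Cmod_mult, hsigma, Rmult_1_l, Cc, Cmod2_alt; simpl.
    replace (s * k) with (k * s) by ring.
    transitivity (1 - 2 * del + del * del * (1 + k * k * (s * s))); [ring|rewrite s2; ring]. }
  assert (Z1 : 1 - Cmod z >= del / 2).
  { pose proof (Cmod_ge_0 z).
    assert (L1 : del * (1 + k ^ 2) <= 1) by nra.
    assert (L2 : del ^ 2 * Cmod c ^ 2 <= del).
    { rewrite Cc; replace (del ^ 2 * (1 + k ^ 2)) with (del * (del * (1 + k ^ 2))) by ring.
      rewrite <- (Rmult_1_r del) at 3; apply Rmult_le_compat_l; lra. }
    assert (L3 : Cmod z ^ 2 <= 1 - del) by lra.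
    nra. }
  assert (Sz : stolz sigma M z).
  { split; [unfold in_disk; lra|].
    rewrite Zs; nra. }
  specialize (S' z Sz).
  assert (Hzd : Cmod (z - sigma)%C < d) by (rewrite Zs; nra).
  specialize (S' Hzd).
  set (X := (boundary_quot phi sigma tau z * Cconj e)%C) in *.
  pose proof (sector_Re _ _ Heta S') as RX.
  assert (P : 0 < Re (X * (e * c))%C).
  { assert (Q := one_minus_conj_Re tau (phi z) htau (self_map_disk phi hphi z (proj1 Sz))).
    replace (X * (e * c))%C with (RtoC (/ del) * (1 - Cconj tau * phi z))%C.
    - rewrite re_scal_l; apply Rmult_lt_0_compat; [now apply Rinv_0_lt_compat|exact Q].
    - unfold X, boundary_quot; rewrite Ez, RtoC_inv by lra.
      assert (Nd : RtoC del <> RtoC 0) by (intros E; apply RtoC_inj in E; lra).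
      assert (Nc : c <> RtoC 0) by (intros E; apply (f_equal Re) in E; simpl in E; lra).
      replace ((1 - Cconj tau * phi z) / (RtoC del * c) * Cconj e * (e * c))%C
        with ((Cconj e * e) * ((1 - Cconj tau * phi z) / RtoC del))%C by (field; split; trivial).
      rewrite unimodular_conj by trivial; field; exact Nd. }
  rewrite re_mult in P.
  assert (I : Rabs (Im (e * c)%C) <= 1 + k).
  { apply Rle_trans with (1 := im_le_Cmod _); rewrite Cmod_mult, He; lra. }
  assert (Rec : Re (e * c)%C = Re e - s * k * Im e) by (rewrite re_mult; simpl; ring).
  rewrite Rec in P.
  assert (I2 : Rabs (Im X * Im (e * c)%C) <= eta * Re X * (1 + k)).
  { rewrite Rabs_mult; unfold sector in S'; apply Rmult_le_compat; try apply Rabs_pos; lra. }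
  apply Rabs_le_between in I2.
  assert (E2 : eta * (1 + k) = eps / 2) by (unfold eta; field; lra).
  assert (P2 : 0 < Re X * (Re e - s * k * Im e + eps / 2)) by nra.
  nra. }
pose proof (B 1 (or_introl eq_refl)) as B1; pose proof (B (-1) (or_intror eq_refl)) as B2.
assert (E2 : Re e ^ 2 + Im e ^ 2 = 1) by (rewrite <- Cmod2_alt, He; ring).
assert (R0 : 0 < Re e).
(* The two inequalities give Re e >= k |Im e|; vanishing of Re e would force e = 0, against |e| =
   1. *)
{ destruct (Rle_lt_or_eq_dec 0 (Re e)) as [L|L]; [lra|exact L|].
  assert (Im e = 0) by nra. rewrite <- L, H in E2; lra. }
unfold sector.
assert (Kk : 2 / k * Re e = 2 * Re e / k) by (unfold Rdiv; ring).
rewrite Kk; apply Rlt_div_r; [exact Hk|].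
unfold Rabs; destruct (Rcase_abs (Im e)); lra.
Qed.

(** Instead of proving that the directions for different apertures agree, the aperture is enlarged
    for each [eta] until the direction itself lies in a sector thin enough for [eta]; the estimate
    then restricts to the original region. *)
Lemma arg_deriv_weak :
  ex_angular_arg_lim (C_derive phi) sigma ->
  angular_arg_lim (boundary_quot phi sigma tau) sigma 0.
Proof.
intros Hex M HM; apply arg_lim_sector; [apply stolz_filter_filter|].
rewrite Ropp_0; intros eta He.
set (a := Rmin (1 / 2) (eta / 4)).
assert (A0 : 0 < a) by (apply Rmin_pos; lra).
assert (A1 : a <= 1 / 2) by apply Rmin_l.
assert (A2 : a <= eta / 4) by apply Rmin_r.
set (k := 2 / a).
assert (Hk : 0 < k) by (apply Rdiv_lt_0_compat; lra).
set (M' := Rmax M (3 * (1 + k))).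
assert (M1 : M <= M') by apply Rmax_l.
assert (M2 : 3 * (1 + k) <= M') by apply Rmax_r.
destruct (arg_deriv_direction M') as (e & Ee & S); [lra|exact Hex|].
pose proof (direction_near_one M' k e ltac:(lra) Hk ltac:(lra) Ee S) as Se.
replace (2 / k) with a in Se by (unfold k; field; lra).
destruct (proj1 (stolz_filter_ball _ _ _) (S a A0)) as (d & Hd & S').
apply stolz_filter_ball; exists d; split; [exact Hd|]; intros z Hz Hzd.
specialize (S' z (stolz_mono _ _ _ _ M1 Hz) Hzd).
apply sector_mono with (2 * (a + a)); [lra|lra|].
rewrite cis_0.
replace (boundary_quot phi sigma tau z * 1)%C with (boundary_quot phi sigma tau z * Cconj e * e)%C.
- apply sector_mult; trivial; nra.
- rewrite <- Cmult_assoc, unimodular_conj by trivial; reflexivity.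
Qed.

End FromArgDeriv.

(** * Weak conformality from the hyperbolic distortion *)

(** A step of bounded length shrinks the distance to the circle by at most a fixed factor. The 4
    comes from using 1 - |z|^2 <= 2 (1 - |z|) at both points. *)
Lemma pseudo_hyp_boundary_dist z w r :
  in_disk z -> in_disk w -> pseudo_hyp z w <= r -> r < 1 ->
  (1 - r ^ 2) / 4 * (1 - Cmod z) <= 1 - Cmod w.
Proof.
intros Hz Hw Hr R1.
pose proof (mob_one_minus_sq w z Hw Hz) as E; change (Cmod (mob w z)) with (pseudo_hyp z w) in E.
pose proof (pseudo_hyp_lt1 z w Hz Hw) as P.
unfold in_disk in *; pose proof (Cmod_ge_0 z); pose proof (Cmod_ge_0 w).
assert (L : 1 - Cmod z <= Cmod (1 - Cconj w * z)%C).
{ pose proof (Cmod_diff_le 1 (Cconj w * z)%C) as D.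
  rewrite Cmod_1, Cmod_mult, Cmod_conj in D; apply Rabs_le_between in D; nra. }
assert (L2 : (1 - Cmod z) ^ 2 <= Cmod (1 - Cconj w * z)%C ^ 2) by (apply pow_incr; lra).
assert (Hr2 : 0 <= 1 - r ^ 2 <= 1 - pseudo_hyp z w ^ 2) by nra.
assert (B : (1 - r ^ 2) * (1 - Cmod z) ^ 2 <= (1 - Cmod w ^ 2) * (1 - Cmod z ^ 2)).
{ rewrite <- E; apply Rmult_le_compat; try lra; apply pow2_ge_0. }
assert (U1 : 1 - Cmod w ^ 2 <= 2 * (1 - Cmod w)) by nra.
assert (U2 : 1 - Cmod z ^ 2 <= 2 * (1 - Cmod z)) by nra.
assert (U : (1 - Cmod w ^ 2) * (1 - Cmod z ^ 2) <= (2 * (1 - Cmod w)) * (2 * (1 - Cmod z))).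
{ apply Rmult_le_compat; nra. }
assert (V : (1 - Cmod z) * ((1 - r ^ 2) * (1 - Cmod z)) <= (1 - Cmod z) * (4 * (1 - Cmod w))) by nra.
apply Rmult_le_reg_l in V; lra.
Qed.

(** Two nontangential points with comparable distances to the circle satisfy |1 - conj(z) y| <= (2 +
    M + M') (1 - |z|), which bounds 1 minus the squared pseudo-hyperbolic distance from below. *)
Lemma stolz_pseudo_hyp_bound sigma M M' c z y :
  Cmod sigma = 1 -> 0 < c -> 1 < M -> 1 < M' ->
  stolz sigma M' z -> stolz sigma M y ->
  c * (1 - Cmod z) <= 1 - Cmod y <= 1 - Cmod z ->
  pseudo_hyp y z <= sqrt (1 - c / (2 + M + M') ^ 2).
Proof.
intros Hs Hc HM HM' [Hz1 Hz2] [Hy1 Hy2] Hzy.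
pose proof (mob_one_minus_sq z y Hz1 Hy1) as E; change (Cmod (mob z y)) with (pseudo_hyp y z) in E.
pose proof (pseudo_hyp_lt1 y z Hy1 Hz1) as P.
unfold in_disk in *; pose proof (Cmod_ge_0 z); pose proof (Cmod_ge_0 y).
set (K := 2 + M + M').
assert (HK : 0 < K) by (unfold K; lra).
assert (L : Cmod (1 - Cconj z * y)%C <= K * (1 - Cmod z)).
{ replace (1 - Cconj z * y)%C with ((1 - Cconj z * z) + Cconj z * ((z - sigma) - (y - sigma)))%C by ring.
  apply Rle_trans with (1 := Cmod_triangle _ _).
  rewrite RtoC_one_minus_sq, Cmod_R, Rabs_pos_eq, Cmod_mult, Cmod_conj by nra.
  pose proof (Cmod_triangle (z - sigma)%C (- (y - sigma))%C) as T; rewrite Cmod_opp in T.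
  change (z - sigma + - (y - sigma))%C with (z - sigma - (y - sigma))%C in T.
  pose proof (Cmod_ge_0 (z - sigma - (y - sigma))%C).
  assert (Cmod z * Cmod (z - sigma - (y - sigma))%C <= 1 * Cmod (z - sigma - (y - sigma))%C)
    by (apply Rmult_le_compat_r; lra).
  assert (M * (1 - Cmod y) <= M * (1 - Cmod z)) by (apply Rmult_le_compat_l; lra).
  assert (1 - Cmod z ^ 2 <= 2 * (1 - Cmod z)) by nra.
  unfold K; lra. }
assert (L2 : Cmod (1 - Cconj z * y)%C ^ 2 <= (K * (1 - Cmod z)) ^ 2).
{ apply pow_incr; split; [apply Cmod_ge_0|exact L]. }
rewrite <- (sqrt_pow2 (pseudo_hyp y z)) by lra.
apply sqrt_le_1_alt.
assert (P2 : 0 <= 1 - pseudo_hyp y z ^ 2) by nra.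
assert (B : (1 - Cmod z ^ 2) * (1 - Cmod y ^ 2) <= (1 - pseudo_hyp y z ^ 2) * (K * (1 - Cmod z)) ^ 2).
{ rewrite <- E; now apply Rmult_le_compat_l. }
assert (U : (1 - Cmod z) * (c * (1 - Cmod z)) <= (1 - Cmod z ^ 2) * (1 - Cmod y ^ 2)).
{ apply Rmult_le_compat; nra. }
assert (V : c * (1 - Cmod z) ^ 2 <= (1 - pseudo_hyp y z ^ 2) * K ^ 2 * (1 - Cmod z) ^ 2) by nra.
apply Rmult_le_reg_r in V; [|apply pow_lt; lra].
assert (W : c / K ^ 2 <= 1 - pseudo_hyp y z ^ 2) by (apply Rle_div_l; [now apply pow_lt|lra]).
lra.
Qed.

Lemma first_switch (P : nat -> Prop) N k :
  ~ P N -> P (N + k)%nat -> exists n, (N <= n)%nat /\ ~ P n /\ P (S n).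
Proof.
intros HN; induction k as [|k IH]; intros Hk.
- rewrite Nat.add_0_r in Hk; now elim HN.
- destruct (classic (P (N + k)%nat)) as [Y|Y]; [now apply IH|].
  exists (N + k)%nat; split; [lia|split; [exact Y|]].
  now rewrite Nat.add_succ_r in Hk.
Qed.

(** A discrete intermediate value argument: the boundary distances of z_n tend to 0 and drop by a
    bounded factor per step, so past any N some term has nearly the boundary distance of w. The
    radius d = 1 - |z_N| ensures that the drop below that distance happens after N. *)
Lemma sequence_covers_stolz sigma (z : nat -> C) M M' r0 :
  Cmod sigma = 1 -> 1 < M -> 1 < M' -> 0 <= r0 < 1 ->
  filterlim z eventually (locally sigma) -> (forall n, stolz sigma M (z n)) ->
  (forall n, pseudo_hyp (z n) (z (S n)) <= r0) ->
  exists r, 0 <= r < 1 /\ forall N, exists d, 0 < d /\ forall w, stolz sigma M' w ->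
    Cmod (w - sigma)%C < d -> exists n, (N <= n)%nat /\ pseudo_hyp (z n) w <= r.
Proof.
intros Hs HM HM' Hr0 Hlim Hst Hstep.
set (c := (1 - r0 ^ 2) / 4).
assert (Hc : 0 < c) by (unfold c; nra).
exists (sqrt (1 - c / (2 + M + M') ^ 2)); split.
{ split; [apply sqrt_pos|].
  rewrite <- sqrt_1 at 2; apply sqrt_lt_1_alt; split.
  - assert (c / (2 + M + M') ^ 2 <= 1); [|lra].
    apply Rle_div_l; [apply pow_lt; lra|]; unfold c; nra.
  - assert (0 < c / (2 + M + M') ^ 2); [|lra].
    apply Rdiv_lt_0_compat; [exact Hc|apply pow_lt; lra]. }
intros N; exists (1 - Cmod (z N)); split.
{ destruct (Hst N) as [D _]; unfold in_disk in D; lra. }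
intros w Hw Hwd.
pose proof (stolz_dist sigma w Hs) as Dw.
set (P := fun n => 1 - Cmod (z n) <= 1 - Cmod w).
assert (HN : ~ P N) by (unfold P; lra).
assert (Hk : exists k, P (N + k)%nat).
{ apply tends_filterlim in Hlim; [|apply eventually_filter].
  assert (W1 : 0 < 1 - Cmod w) by (destruct Hw as [D _]; unfold in_disk in D; lra).
  destruct (Hlim _ W1) as [n0 H0]; exists n0; unfold P.
  specialize (H0 (N + n0)%nat ltac:(lia)).
  pose proof (stolz_dist sigma (z (N + n0)%nat) Hs); lra. }
destruct Hk as [k Hk].
destruct (first_switch P N k HN Hk) as (n & Hn & H1 & H2).
exists (S n); split; [lia|].
apply stolz_pseudo_hyp_bound with (sigma := sigma); trivial.
split; [|exact H2].
pose proof (pseudo_hyp_boundary_dist (z n) (z (S n)) r0 (proj1 (Hst n)) (proj1 (Hst (S n))) (Hstep n) ltac:(lra)) as B.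
fold c in B; unfold P in H1.
apply Rle_trans with (2 := B); apply Rmult_le_compat_l; lra.
Qed.

(* The reciprocal of the Poisson kernel; its level sets are the horocycles at tau. *)
Definition horo (tau p : C) : R := Cmod (tau - p)%C ^ 2 / (1 - Cmod p ^ 2).

Lemma in_disk_sq p : in_disk p -> 0 < 1 - Cmod p ^ 2.
Proof. unfold in_disk; pose proof (Cmod_ge_0 p); nra. Qed.

Lemma unimodular_sub_neq0 tau p : Cmod tau = 1 -> in_disk p -> (tau - p)%C <> RtoC 0.
Proof.
intros Ht Hp E; apply Ceq_minus in E; unfold in_disk in Hp; rewrite <- E in Hp; lra.
Qed.

Lemma horo_lower tau p : Cmod tau = 1 -> in_disk p -> (1 - Cmod p) / 2 <= horo tau p.
Proof.
intros Ht Hp; pose proof (in_disk_sq p Hp) as Q; unfold horo.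
pose proof (Cmod_diff_le tau p) as D; rewrite Ht in D; apply Rabs_le_between in D.
unfold in_disk in Hp; pose proof (Cmod_ge_0 p).
apply (Rle_div_r ((1 - Cmod p) / 2) _ _ Q).
assert ((1 - Cmod p) ^ 2 <= Cmod (tau - p)%C ^ 2) by (apply pow_incr; lra).
nra.
Qed.

Lemma horo_pos tau p : Cmod tau = 1 -> in_disk p -> 0 < horo tau p.
Proof.
intros Ht Hp; pose proof (horo_lower tau p Ht Hp); unfold in_disk in Hp; lra.
Qed.

Lemma one_minus_conj_unimodular_neq0 tau p : Cmod tau = 1 -> in_disk p -> (1 - Cconj p * tau)%C <> RtoC 0.
Proof.
intros Ht Hp; apply Cmod_gt_0; rewrite Cmod_one_minus_sym.
apply Cmod_gt_0; now apply one_minus_conj_neq0.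
Qed.

Lemma Cmod_mob_unimodular tau p : Cmod tau = 1 -> in_disk p -> Cmod (mob p tau) = 1.
Proof.
intros Ht Hp; unfold mob.
pose proof (one_minus_conj_unimodular_neq0 tau p Ht Hp) as N.
rewrite Cmod_div, Cmod_one_minus_sym, Cmod_one_minus_conj, Cmod_sub_sym by trivial.
field; apply Rgt_not_eq, Cmod_gt_0; rewrite Cmod_gt_0, Cmod_sub_sym, <- Cmod_gt_0.
now apply unimodular_sub_neq0.
Qed.

(** Conformal invariance of the Poisson kernel: the ratio of its reciprocals at u and p is the
    reciprocal kernel in the frame centred at p. *)
Lemma horo_mob tau p u :
  Cmod tau = 1 -> in_disk p -> in_disk u ->
  horo tau u = horo tau p * (Cmod (mob p tau - mob p u)%C ^ 2 / (1 - Cmod (mob p u) ^ 2)).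
Proof.
intros Ht Hp Hu.
pose proof (one_minus_conj_unimodular_neq0 tau p Ht Hp) as N1.
pose proof (disk_one_minus u p Hu Hp) as N2.
pose proof (in_disk_sq p Hp) as Qp; pose proof (in_disk_sq u Hu) as Qu.
pose proof (unimodular_sub_neq0 tau p Ht Hp) as N3.
pose proof (mob_one_minus_sq p u Hp Hu) as E.
assert (D : (mob p tau - mob p u)%C = ((tau - u) * RtoC (1 - Cmod p ^ 2) / ((1 - Cconj p * tau) * (1 - Cconj p * u)))%C).
{ rewrite <- RtoC_one_minus_sq; unfold mob; field; split; trivial. }
assert (T : Cmod (1 - Cconj p * tau)%C = Cmod (tau - p)%C).
{ now rewrite Cmod_one_minus_sym, Cmod_one_minus_conj, Cmod_sub_sym. }
rewrite D, Cmod_div, !Cmod_mult, Cmod_R, Rabs_pos_eq, T by (try apply Cmult_neq_0; trivial; lra).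
apply Cmod_gt_0 in N2; apply Cmod_gt_0 in N3.
assert (F : 1 - Cmod (mob p u) ^ 2 = (1 - Cmod p ^ 2) * (1 - Cmod u ^ 2) / Cmod (1 - Cconj p * u)%C ^ 2).
{ rewrite <- E; field; lra. }
rewrite F; unfold horo; field; repeat split; lra.
Qed.

Lemma sq_sub_unimodular t v : Cmod t = 1 -> Cmod (t - v)%C ^ 2 = 1 + Cmod v ^ 2 - 2 * Re (Cconj t * v)%C.
Proof.
intros Ht; assert (E : Cmod t ^ 2 = 1) by (rewrite Ht; ring).
rewrite !Cmod2_alt, Re_minus, Im_minus, re_mult, re_conj, im_conj in *.
nra.
Qed.

(** An error of at most 1/3 leaves s_{n+2} >= 3 s_{n+1} - s_n. One non-decreasing step thus makes
    the next at least a doubling, and so on forever. *)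
Lemma recurrence_growth (s : nat -> R) N :
  (forall n, 0 < s n) ->
  (forall n, (N <= n)%nat -> Rabs (s (S (S n)) / s (S n) + s n / s (S n) - 10 / 3) <= 1 / 3) ->
  s N <= s (S N) -> forall k, 2 ^ k * s (S N) <= s (S N + k)%nat.
Proof.
intros Hs Hrec H0.
assert (G : forall k, s (N + k)%nat <= s (S (N + k)) /\ 2 ^ k * s (S N) <= s (S (N + k))).
{ induction k as [|k [IH1 IH2]].
  - rewrite Nat.add_0_r; simpl; lra.
  - rewrite Nat.add_succ_r.
    specialize (Hrec (N + k)%nat ltac:(lia)); apply Rabs_le_between in Hrec.
    pose proof (Hs (S (N + k))) as P.
    assert (3 * s (S (N + k)) - s (N + k)%nat <= s (S (S (N + k)))).
    { assert (E : s (S (S (N + k))) / s (S (N + k)) + s (N + k)%nat / s (S (N + k))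
        = (s (S (S (N + k))) + s (N + k)%nat) / s (S (N + k))) by (field; lra).
      rewrite E in Hrec.
      assert (L : 3 <= (s (S (S (N + k))) + s (N + k)%nat) / s (S (N + k))) by lra.
      apply Rle_div_r in L; lra. }
    simpl; lra. }
intros k; apply G.
Qed.

Lemma doubling_unbounded (u : nat -> R) (b : R) :
  0 < u O -> (forall n, 2 * u n <= u (S n)) -> exists n, b < u n.
Proof.
intros H0 H.
assert (G : forall n, 2 ^ n * u O <= u n).
{ induction n as [|n IH]; [simpl; lra|]; specialize (H n); simpl; lra. }
destruct (Pow_x_infinity 2 ltac:(rewrite Rabs_pos_eq; lra) (Rabs b / u O + 1)) as [n Hn].
exists n; specialize (Hn n (Nat.le_refl n)).
rewrite Rabs_pos_eq in Hn by (apply pow_le; lra).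
assert (L : Rabs b / u O < 2 ^ n) by lra.
apply Rlt_div_l in L; [|exact H0].
specialize (G n); pose proof (Rle_abs b); lra.
Qed.

(* The fixed point 1/3 of r -> 10/3 - 1/r is repelling, so a bounded orbit must converge to it. *)
Lemma recurrence_decay (s E : nat -> R) N0 :
  (forall n, 0 < s n) -> is_lim_seq E 0 ->
  (forall n, Rabs (s (S (S n)) / s (S n) + s n / s (S n) - 10 / 3) <= E n) ->
  (forall n, (N0 <= n)%nat -> s (S n) <= s n) ->
  is_lim_seq (fun n => s (S n) / s n) (1 / 3).
Proof.
intros Hs HE Hrec Hdec.
(* For the deviation d_n the recurrence reads d_{n+1} (d_n + 1/3) = 3 d_n, up to an error [E n]
   times d_n + 1/3. A deviation of modulus at least eps > [E n] would double at every step, which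
   -1/3 < d_n <= 2/3 forbids. *)
set (d := fun n => s (S n) / s n - 1 / 3).
assert (Hd : forall n, - (1 / 3) < d n).
{ intros n; unfold d; pose proof (Rdiv_lt_0_compat _ _ (Hs (S n)) (Hs n)); lra. }
assert (Hd2 : forall n, (N0 <= n)%nat -> d n <= 2 / 3).
{ intros n Hn; unfold d; assert (s (S n) / s n <= 1); [|lra].
  apply Rle_div_l; [apply Hs|]; specialize (Hdec n Hn); lra. }
assert (Hr : forall n, Rabs (d (S n) * (d n + 1 / 3) - 3 * d n) <= E n * (d n + 1 / 3)).
{ intros n; specialize (Hrec n); specialize (Hd n).
  replace (d (S n) * (d n + 1 / 3) - 3 * d n) with
    ((s (S (S n)) / s (S n) + s n / s (S n) - 10 / 3) * (d n + 1 / 3)).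
  - rewrite Rabs_mult, (Rabs_pos_eq (d n + 1 / 3)) by lra.
    apply Rmult_le_compat_r; lra.
  - unfold d; pose proof (Hs n); pose proof (Hs (S n)); field; lra. }
apply is_lim_seq_spec; intros [eps He].
change (eventually (fun n => Rabs (d n) < eps)).
apply is_lim_seq_spec in HE; destruct (HE (mkposreal eps He)) as [N1 H1].
change (forall n, (N1 <= n)%nat -> Rabs (E n - 0) < eps) in H1.
exists (max N0 N1); intros n Hn.
assert (HEm : forall m, (n <= m)%nat -> E m < eps).
{ intros m Hm; specialize (H1 m ltac:(lia)); apply Rabs_def2 in H1; lra. }
apply Rnot_le_lt; intros L.
destruct (Rle_dec 0 (d n)) as [S|S].
- rewrite Rabs_pos_eq in L by exact S.
  assert (G : forall k, eps <= d (n + k)%nat /\ 2 * d (n + k)%nat <= d (n + Datatypes.S k)%nat).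
  { assert (step : forall m, (n <= m)%nat -> eps <= d m -> 2 * d m <= d (Datatypes.S m)).
    { intros m Hm Lm; specialize (Hr m); apply Rabs_le_between in Hr.
      pose proof (Hd m); pose proof (Hd2 m ltac:(lia)); pose proof (HEm m Hm).
      assert (E m * (d m + 1 / 3) <= eps * (d m + 1 / 3)) by (apply Rmult_le_compat_r; lra).
      assert (eps * (d m + 1 / 3) <= d m * (d m + 1 / 3)) by (apply Rmult_le_compat_r; lra).
      assert (Q : (2 * d m) * (d m + 1 / 3) <= d (Datatypes.S m) * (d m + 1 / 3)) by nra.
      apply Rmult_le_reg_r in Q; lra. }
    induction k as [|k [IH1 IH2]].
    - rewrite Nat.add_0_r, Nat.add_1_r; split; [exact L|now apply step].
    - rewrite !Nat.add_succ_r in *; split; [lra|].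
      apply step; [lia|lra]. }
  destruct (doubling_unbounded (fun k => d (n + k)%nat) (2 / 3)) as [k Hk].
  + rewrite Nat.add_0_r; lra.
  + intros k; apply G.
  + specialize (Hd2 (n + k)%nat ltac:(lia)); lra.
- rewrite Rabs_left in L by lra.
  assert (G : forall k, eps <= - d (n + k)%nat /\ 2 * - d (n + k)%nat <= - d (n + Datatypes.S k)%nat).
  { assert (step : forall m, (n <= m)%nat -> eps <= - d m -> 2 * - d m <= - d (Datatypes.S m)).
    { intros m Hm Lm; specialize (Hr m); apply Rabs_le_between in Hr.
      pose proof (Hd m); pose proof (HEm m Hm).
      assert (E m * (d m + 1 / 3) <= eps * (d m + 1 / 3)) by (apply Rmult_le_compat_r; lra).
      assert (eps * (d m + 1 / 3) <= - d m * (1 / 3)) by nra.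
      assert (Q : (2 * - d m) * (d m + 1 / 3) <= - d (Datatypes.S m) * (d m + 1 / 3)) by nra.
      apply Rmult_le_reg_r in Q; lra. }
    induction k as [|k [IH1 IH2]].
    - rewrite Nat.add_0_r, Nat.add_1_r; split; [exact L|now apply step].
    - rewrite !Nat.add_succ_r in *; split; [lra|].
      apply step; [lia|lra]. }
  destruct (doubling_unbounded (fun k => - d (n + k)%nat) (1 / 3)) as [k Hk].
  + rewrite Nat.add_0_r; lra.
  + intros k; apply G.
  + specialize (Hd (n + k)%nat); lra.
Qed.

Lemma halving_lim (u e : nat -> R) :
  (forall n, 0 <= u n) -> is_lim_seq e 0 ->
  eventually (fun n => u (S n) <= (u n + e n) / 2) -> is_lim_seq u 0.
Proof.
intros Hu He [N1 H1]; apply is_lim_seq_spec; intros [eps Heps].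
change (eventually (fun n => Rabs (u n - 0) < eps)).
apply is_lim_seq_spec in He.
destruct (He (mkposreal (eps / 2) ltac:(lra))) as [N2 H2].
change (forall n, (N2 <= n)%nat -> Rabs (e n - 0) < eps / 2) in H2.
set (N := max N1 N2).
assert (G : forall k, u (N + k)%nat <= eps / 2 + u N / 2 ^ k).
{ induction k as [|k IH].
  - rewrite Nat.add_0_r; simpl; lra.
  - rewrite Nat.add_succ_r.
    specialize (H1 (N + k)%nat ltac:(lia)); specialize (H2 (N + k)%nat ltac:(lia)).
    apply Rabs_def2 in H2.
    replace (u N / 2 ^ S k) with (u N / 2 ^ k / 2) by (simpl; field; apply pow_nonzero; lra).
    lra. }
destruct (Pow_x_infinity 2 ltac:(rewrite Rabs_pos_eq; lra) (2 * u N / eps + 1)) as [K HK].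
exists (N + K)%nat; intros n Hn.
replace n with (N + (n - N))%nat by lia.
specialize (HK (n - N)%nat ltac:(lia)); specialize (G (n - N)%nat).
assert (P : 0 < 2 ^ (n - N)) by (apply pow_lt; lra).
rewrite Rabs_pos_eq in HK by lra.
assert (L : 2 * u N / eps < 2 ^ (n - N)) by lra.
apply Rlt_div_l in L; [|exact Heps].
assert (u N / 2 ^ (n - N) < eps / 2) by (apply Rlt_div_l; lra).
rewrite Rminus_0_r, Rabs_pos_eq by apply Hu; lra.
Qed.

(* Isometry from the disk to the right half-plane, sending tau to infinity. *)
Definition cay (tau u : C) : C := ((tau + u) / (tau - u))%C.

Lemma cay_Re tau u : Cmod tau = 1 -> in_disk u -> Re (cay tau u) = / horo tau u.
Proof.
intros Ht Hu; pose proof (unimodular_sub_neq0 tau u Ht Hu) as N.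
pose proof (in_disk_sq u Hu) as Q; pose proof N as N'; apply Cmod_gt_0 in N'.
assert (E : cay tau u = (((tau + u) * Cconj (tau - u)) * RtoC (/ Cmod (tau - u) ^ 2))%C).
{ rewrite RtoC_inv by nra; rewrite Cmod2_conj; unfold cay; field; split; trivial.
  intros Z; apply (f_equal Cconj) in Z; rewrite Cconj_conj in Z; apply N; rewrite Z.
  unfold Cconj; simpl; now rewrite Ropp_0. }
rewrite E, re_scal_r; unfold horo.
assert (E2 : Re ((tau + u) * Cconj (tau - u))%C = 1 - Cmod u ^ 2).
{ assert (T : Cmod tau ^ 2 = 1) by (rewrite Ht; ring).
  rewrite !Cmod2_alt in *; destruct tau, u; simpl in *; nra. }
rewrite E2; field; split; lra.
Qed.

(** With om = conj(T_p tau) T_p(u) and X = [cay tau p], the right side is Re X (1 + om) / (1 - om) +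
    i Im X: changing the frame is an affine map of the half-plane, because tau sits at infinity. *)
Lemma mob_cay tau p u : Cmod tau = 1 -> in_disk p -> in_disk u ->
  (1 - Cconj (mob p tau) * mob p u)%C <> RtoC 0 /\
  cay tau u = ((cay tau p + Cconj (mob p tau) * mob p u * Cconj (cay tau p))
     / (1 - Cconj (mob p tau) * mob p u))%C.
Proof.
intros Ht Hp Hu.
assert (N : (1 - Cconj (mob p tau) * mob p u)%C <> RtoC 0).
{ apply one_minus_conj_neq0; [now apply Cmod_mob_unimodular|now apply pseudo_hyp_lt1]. }
split; [exact N|].
pose proof (unimodular_sub_neq0 tau p Ht Hp) as N1.
pose proof (unimodular_sub_neq0 tau u Ht Hu) as N2.
pose proof (one_minus_conj_unimodular_neq0 tau p Ht Hp) as N3.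
pose proof (disk_one_minus u p Hu Hp) as N4.
assert (Tn : tau <> RtoC 0) by (apply Cmod_gt_0; lra).
assert (Tc : Cconj tau = (/ tau)%C).
{ rewrite <- (Cmult_1_l (/ tau)), <- (unimodular_conj tau Ht); field; exact Tn. }
assert (Ec : Cconj (mob p tau) = ((1 - Cconj p * tau) / (tau - p))%C).
{ unfold mob; rewrite Cdiv_conj, !Cminus_conj, Cmult_conj, Cconj_conj by exact N3.
  replace (Cconj 1) with (RtoC 1) by (unfold Cconj; simpl; now rewrite Ropp_0).
  rewrite Tc; field; split; trivial. }
assert (Ecay : Cconj (cay tau p) = ((1 + Cconj p * tau) / (1 - Cconj p * tau))%C).
{ unfold cay; rewrite Cdiv_conj, Cminus_conj, Cplus_conj by exact N1.
  rewrite Tc; field; repeat split; trivial. }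
rewrite Ec in N |- *; rewrite Ecay; unfold cay, mob in *.
field; repeat split; trivial.
intros Z; apply N.
transitivity (((tau - p) * (1 - Cconj p * u) - (1 - Cconj p * tau) * (u - p))
  / ((tau - p) * (1 - Cconj p * u)))%C; [field; split; trivial|].
rewrite Z; unfold Cdiv; ring.
Qed.

(** * The images of the radial points and their horocyclic recurrence *)

Section Orbit.
Variables (phi : C -> C) (sigma : C).
Hypothesis hphi : holomorphic_self_map phi.
Hypothesis hsigma : Cmod sigma = 1.

Let x := radial sigma.
Let p (n : nat) : C := phi (x n).

Lemma distortion_radial (z : nat -> C) :
  (forall n, in_disk (z n)) -> bounded_step z -> nontangential_cv z sigma ->
  is_lim_seq (fun n => hyp_distortion phi (z n)) 1 ->
  is_lim_seq (fun n => contraction phi (x n) (x n)) 1.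
Proof.
intros Hz Hb [Hlim (M & HM & Hst)] HD.
destruct (bounded_step_pseudo_hyp z Hz Hb) as (r0 & Hr0 & Hstep).
destruct (sequence_covers_stolz sigma z M 2 r0) as (r & Hr & Hcov); trivial; [lra|lra|].
set (K := ((1 + r) / (1 - r)) ^ 2).
assert (HK : 0 < K) by (apply pow_lt, Rdiv_lt_0_compat; lra).
apply is_lim_seq_spec; intros [eps He].
change (eventually (fun n => Rabs (contraction phi (x n) (x n) - 1) < eps)).
apply is_lim_seq_spec in HD.
assert (HeK : 0 < eps / K) by now apply Rdiv_lt_0_compat.
destruct (HD (mkposreal _ HeK)) as [N HN].
change (forall n, (N <= n)%nat -> Rabs (hyp_distortion phi (z n) - 1) < eps / K) in HN.
destruct (Hcov N) as (d & Hd & Hc).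
assert (Hx : stolz_filter sigma 2 (fun w => Cmod (w - sigma)%C < d)).
{ apply stolz_filter_ball; exists d; split; trivial. }
generalize (radial_stolz_lim sigma hsigma 2 ltac:(lra) _ Hx); unfold filtermap; apply filter_imp.
intros n Hn; fold x in Hn.
destruct (Hc (x n)) as (m & Hm & Hr'); [apply radial_stolz; [exact hsigma|lra]|exact Hn|].
specialize (HN m Hm).
rewrite hyp_distortion_contraction in HN by trivial.
assert (Hxn : in_disk (x n)) by now apply radial_disk.
rewrite pseudo_hyp_sym in Hr' by trivial.
pose proof (contraction_diag_transfer phi hphi (z m) (x n) r (Hz m) Hxn Hr' ltac:(lra)) as B.
pose proof (contraction_bounds phi hphi (x n) (x n) Hxn Hxn) as C1.
pose proof (contraction_bounds phi hphi (z m) (z m) (Hz m) (Hz m)) as C2.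
fold K in B; apply Rabs_def2 in HN.
assert (K * (1 - contraction phi (z m) (z m)) < K * (eps / K)) by (apply Rmult_lt_compat_l; lra).
replace (K * (eps / K)) with eps in * by (field; lra).
apply Rabs_def1; lra.
Qed.

Hypothesis Hx1 : is_lim_seq (fun n => contraction phi (x n) (x n)) 1.

Lemma radial_point_disk n : in_disk (x n).
Proof. now apply radial_disk. Qed.

Lemma orbit_disk n : in_disk (p n).
Proof. apply self_map_disk; [exact hphi|apply radial_point_disk]. Qed.

Lemma pseudo_hyp_x_succ n : pseudo_hyp (x (S n)) (x n) = 1 / 2.
Proof.
rewrite pseudo_hyp_mob; unfold x; rewrite mob_radial_succ, Cmod_mult, hsigma, Cmod_R, Rabs_pos_eq by (trivial; lra).
ring.
Qed.

Let G n w := hyp_diff_quot phi (x n) w.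

Section NearRadial.
Variable r : R.
Hypothesis Hr : 0 <= r < 1.

(* Convergence as n tends to infinity, uniformly on the hyperbolic disks of radius r
   around the radial points. *)
Definition disk_filter (P : nat * C -> Prop) : Prop :=
  exists N, forall n z, (N <= n)%nat -> in_disk z -> pseudo_hyp z (x n) <= r -> P (n, z).

Global Instance disk_filter_filter : Filter disk_filter.
Proof.
split.
- now exists O.
- intros P Q (N & H) (N' & H'); exists (max N N'); intros n z Hn Hz Hp.
  split; [apply H|apply H']; trivial; lia.
- intros P Q HPQ (N & H); exists N; intros n z Hn Hz Hp; auto.
Qed.

Lemma disk_filter_seq (u : nat -> C) l :
  tends eventually u l -> tends disk_filter (fun nz => u (fst nz)) l.
Proof.
intros H eps He; destruct (H eps He) as [N HN]; exists N; intros n z Hn _ _; now apply HN.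
Qed.

Lemma diff_quot_near_center : tends disk_filter (fun nz => G (fst nz) (snd nz) - G (fst nz) (x (fst nz)))%C 0.
Proof.
apply tends_le with (fun nz : nat * C =>
  (RtoC (2 * r / (1 - r)) * (1 - RtoC (contraction phi (x (fst nz)) (x (fst nz)))))%C).
- apply (disk_filter_seq (fun n => RtoC (2 * r / (1 - r)) * (1 - RtoC (contraction phi (x n) (x n))))%C).
  apply (eq_ind (RtoC (2 * r / (1 - r)) * (1 - RtoC 1))%C (fun l => tends eventually _ l)); [|ring].
  apply tends_mult; [apply tends_const|].
  apply tends_minus; [apply tends_const|]; now apply tends_eventually_seq.
- exists O; intros n z _ Hz Hp; simpl.
  replace (G n z - G n (x n) - 0)%C with (G n z - G n (x n))%C by ring.
  pose proof (contraction_bounds phi hphi (x n) (x n) (radial_point_disk n) (radial_point_disk n)).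
  rewrite <- RtoC_minus, <- RtoC_mult, Cmod_R, Rabs_pos_eq.
  + apply hyp_diff_quot_stable; trivial; try apply radial_point_disk; lra.
  + apply Rmult_le_pos; [apply Rmult_le_pos; [lra|left; apply Rinv_0_lt_compat; lra]|lra].
Qed.

Lemma diff_quot_near_center_seq (w : nat -> C) :
  (forall n, in_disk (w n)) -> (forall n, pseudo_hyp (w n) (x n) <= r) ->
  tends eventually (fun n => G n (w n) - G n (x n))%C 0.
Proof.
intros Hw Hp eps He; destruct (diff_quot_near_center eps He) as [N HN]; exists N; intros n Hn.
exact (HN n (w n) Hn (Hw n) (Hp n)).
Qed.

End NearRadial.

Lemma Cmod_diff_quot_center : tends eventually (fun n => RtoC (Cmod (G n (x n)))) 1.
Proof. apply tends_eventually_seq; exact Hx1. Qed.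

Lemma tends_Cmod_of_diff (f g : nat -> C) (l : R) :
  tends eventually (fun n => f n - g n)%C 0 -> tends eventually (fun n => RtoC (Cmod (g n))) (RtoC l) ->
  tends eventually (fun n => RtoC (Cmod (f n))) (RtoC l).
Proof.
intros H1 H2.
apply tends_ext with (fun n => RtoC (Cmod (f n) - Cmod (g n)) + RtoC (Cmod (g n)))%C.
{ intros n; rewrite RtoC_minus; ring. }
apply (eq_ind (0 + RtoC l)%C (fun m => tends eventually _ m)); [|ring].
apply tends_plus; [|exact H2].
apply tends_le with (1 := H1); apply filter_forall; intros n.
replace (RtoC (Cmod (f n) - Cmod (g n)) - 0)%C with (RtoC (Cmod (f n) - Cmod (g n))) by ring.
rewrite Cmod_R; apply Cmod_diff_le.
Qed.

Let vf n := mob (p n) (p (S n)).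
Let vb n := mob (p (S n)) (p n).

Lemma forward_step_eq n : vf n = (G n (x (S n)) * (RtoC (1 / 2) * sigma))%C.
Proof.
unfold vf, p; rewrite mob_hyp_diff_quot by (trivial; apply radial_point_disk).
unfold G, x; now rewrite mob_radial_succ.
Qed.

Lemma backward_step_eq n : vb n = (G (S n) (x n) * (RtoC (- (1 / 2)) * sigma))%C.
Proof.
unfold vb, p; rewrite mob_hyp_diff_quot by (trivial; apply radial_point_disk).
unfold G, x; now rewrite mob_radial_pred.
Qed.

Lemma diff_quot_succ_center : tends eventually (fun n => G n (x (S n)) - G n (x n))%C 0.
Proof.
apply diff_quot_near_center_seq with (1 / 2); [lra|intros; apply radial_point_disk|].
intros n; rewrite pseudo_hyp_x_succ; lra.
Qed.

Lemma diff_quot_pred_center : tends eventually (fun n => G (S n) (x n) - G (S n) (x (S n)))%C 0.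
Proof.
(* The uniform estimate requires centre and point to carry the same index, so the claim is proved
   with [pred n] and shifted afterwards. At n = 0 the point is the centre itself, at distance 0. *)
assert (H : tends eventually (fun n => G n (x (pred n)) - G n (x n))%C 0).
{ apply diff_quot_near_center_seq with (1 / 2); [lra|intros; apply radial_point_disk|].
  intros [|n]; simpl.
  - rewrite pseudo_hyp_mob; unfold mob; replace (x 0 - x 0)%C with (RtoC 0) by ring.
    unfold Cdiv; rewrite Cmult_0_l, Cmod_0; lra.
  - rewrite pseudo_hyp_sym, pseudo_hyp_x_succ by apply radial_point_disk; lra. }
intros eps He; destruct (H eps He) as [N HN]; exists N; intros n Hn.
apply (HN (S n)); lia.
Qed.

Lemma tends_shift (f : nat -> C) l : tends eventually f l -> tends eventually (fun n => f (S n)) l.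
Proof.
intros H eps He; destruct (H eps He) as [N HN]; exists N; intros n Hn; apply HN; lia.
Qed.

Lemma Cmod_forward_step_lim : tends eventually (fun n => RtoC (Cmod (vf n))) (RtoC (1 / 2)).
Proof.
apply tends_ext with (fun n => RtoC (Cmod (G n (x (S n)))) * RtoC (1 / 2))%C.
{ intros n; rewrite forward_step_eq, !Cmod_mult, hsigma, Cmod_R, Rabs_pos_eq, Rmult_1_r by lra.
  now rewrite RtoC_mult. }
apply (eq_ind (1 * RtoC (1 / 2))%C (fun m => tends eventually _ m)); [|ring].
apply tends_mult; [|apply tends_const].
exact (tends_Cmod_of_diff _ _ 1 diff_quot_succ_center Cmod_diff_quot_center).
Qed.

Lemma Cmod_backward_step_lim : tends eventually (fun n => RtoC (Cmod (vb n))) (RtoC (1 / 2)).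
Proof.
apply tends_ext with (fun n => RtoC (Cmod (G (S n) (x n))) * RtoC (1 / 2))%C.
{ intros n; rewrite backward_step_eq, !Cmod_mult, hsigma, Cmod_R, Rabs_Ropp, Rabs_pos_eq, Rmult_1_r by lra.
  now rewrite RtoC_mult. }
apply (eq_ind (1 * RtoC (1 / 2))%C (fun m => tends eventually _ m)); [|ring].
apply tends_mult; [|apply tends_const].
exact (tends_Cmod_of_diff _ _ 1 diff_quot_pred_center (tends_shift _ _ Cmod_diff_quot_center)).
Qed.

(** Seen from p_{n+1}, both neighbours are given by the same nearly constant quotient, multiplied by
    sigma/2 forwards and by -sigma/2 backwards. *)
Lemma steps_opposite : tends eventually (fun n => vf (S n) + vb n)%C 0.
Proof.
apply tends_ext with (fun n => ((G (S n) (x (S (S n))) - G (S n) (x (S n)))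
   - (G (S n) (x n) - G (S n) (x (S n)))) * (RtoC (1 / 2) * sigma))%C.
{ intros n; rewrite forward_step_eq, backward_step_eq, RtoC_opp; ring. }
apply (eq_ind ((0 - 0) * (RtoC (1 / 2) * sigma))%C (fun m => tends eventually _ m)); [|ring].
apply tends_mult; [|apply tends_const].
apply tends_minus; [exact (tends_shift _ _ diff_quot_succ_center)|exact diff_quot_pred_center].
Qed.

(* In the frame centred at p (n+1) the neighbours p n and p (n+2) become nearly opposite
   points of modulus nearly 1/2; for exactly opposite points the sum of ratios is 10/3. *)
Lemma horo_recurrence :
  exists E : nat -> R, is_lim_seq E 0 /\ forall tau, Cmod tau = 1 -> forall n,
    Rabs (horo tau (p (S (S n))) / horo tau (p (S n)) + horo tau (p n) / horo tau (p (S n)) - 10 / 3) <= E n.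
Proof.
set (a := fun n => Cmod (vf (S n))); set (b := fun n => Cmod (vb n)).
(* [al] and [be] tend to 4/3, and 2 (1 + 1/4) 4/3 = 10/3 makes [A] vanish in the limit. All
   dependence on tau is in the term -2 Re (conj(t) B) with |t| = 1, hence a bound uniform in tau. *)
set (al := fun n => / (1 - a n ^ 2)); set (be := fun n => / (1 - b n ^ 2)).
set (A := fun n => (1 + a n ^ 2) * al n + (1 + b n ^ 2) * be n - 10 / 3).
set (B := fun n => (vf (S n) * RtoC (al n) + vb n * RtoC (be n))%C).
assert (La : is_lim_seq a (1 / 2)) by (apply tends_eventually_seq; exact (tends_shift _ _ Cmod_forward_step_lim)).
assert (Lb : is_lim_seq b (1 / 2)) by (apply tends_eventually_seq; exact Cmod_backward_step_lim).
assert (Lsq : forall u : nat -> R, is_lim_seq u (1 / 2) -> is_lim_seq (fun n => u n ^ 2) (1 / 4)).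
{ intros u Hu; apply is_lim_seq_ext with (fun n => u n * u n); [intros; ring|].
  replace (Finite (1 / 4)) with (Finite (1 / 2 * (1 / 2))) by (f_equal; field).
  now apply is_lim_seq_mult'. }
assert (Linv : forall u : nat -> R, is_lim_seq u (1 / 2) -> is_lim_seq (fun n => / (1 - u n ^ 2)) (4 / 3)).
{ intros u Hu; replace (Finite (4 / 3)) with (Rbar_inv (Finite (1 - 1 / 4))) by (simpl; f_equal; field).
  apply is_lim_seq_inv; [|intros E; injection E; lra].
  apply is_lim_seq_minus'; [apply is_lim_seq_const|now apply Lsq]. }
assert (Lal : is_lim_seq al (4 / 3)) by now apply Linv.
assert (Lbe : is_lim_seq be (4 / 3)) by now apply Linv.
assert (LA : is_lim_seq A 0).
{ unfold A; replace (Finite 0) with (Finite ((1 + 1 / 4) * (4 / 3) + (1 + 1 / 4) * (4 / 3) - 10 / 3)) by (f_equal; field).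
  apply is_lim_seq_minus'; [|apply is_lim_seq_const].
  apply is_lim_seq_plus'; apply is_lim_seq_mult'; trivial;
    (apply is_lim_seq_plus'; [apply is_lim_seq_const|now apply Lsq]). }
assert (Hvb : forall n, b n < 1).
{ intros n; exact (proj2 (pseudo_hyp_lt1 (p n) (p (S n)) (orbit_disk n) (orbit_disk (S n)))). }
assert (Hva : forall n, a n < 1).
{ intros n; exact (proj2 (pseudo_hyp_lt1 (p (S (S n))) (p (S n)) (orbit_disk _) (orbit_disk _))). }
assert (LB : tends eventually B 0).
{ apply tends_ext with (fun n => (vf (S n) + vb n) * RtoC (al n) + RtoC (be n - al n) * vb n)%C.
  { intros n; unfold B; rewrite RtoC_minus; ring. }
  apply (eq_ind (0 * RtoC (4 / 3) + 0)%C (fun m => tends eventually _ m)); [|ring].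
  apply tends_plus.
  - apply tends_mult; [exact steps_opposite|now apply tends_eventually_seq].
  - apply tends_bounded_mult with 1.
    + apply tends_eventually_seq; replace (Finite 0) with (Finite (4 / 3 - 4 / 3)) by (f_equal; ring).
      now apply is_lim_seq_minus'.
    + apply filter_forall; intros n; specialize (Hvb n); unfold b in Hvb; lra. }
apply tends_Cmod in LB; rewrite Cmod_0 in LB; apply tends_eventually_seq in LB.
exists (fun n => Rabs (A n) + 2 * Cmod (B n)); split.
{ replace (Finite 0) with (Finite (0 + 2 * 0)) by (f_equal; ring).
  apply is_lim_seq_plus'.
  - apply (is_lim_seq_abs _ (Finite 0)) in LA; simpl in LA; now rewrite Rabs_R0 in LA.
  - apply is_lim_seq_mult'; [apply is_lim_seq_const|exact LB]. }
intros tau Ht n.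
set (t := mob (p (S n)) tau).
assert (Ht1 : Cmod t = 1) by (apply Cmod_mob_unimodular; [exact Ht|apply orbit_disk]).
pose proof (horo_pos tau (p (S n)) Ht (orbit_disk _)) as Hp.
rewrite (horo_mob tau (p (S n)) (p (S (S n)))) by (trivial; apply orbit_disk).
rewrite (horo_mob tau (p (S n)) (p n)) by (trivial; apply orbit_disk).
fold (vf (S n)) (vb n) t.
rewrite !sq_sub_unimodular by exact Ht1.
fold (a n) (b n).
assert (Pa : 0 < 1 - a n ^ 2) by (pose proof (Hva n); pose proof (Cmod_ge_0 (vf (S n))) as Q; fold (a n) in Q; nra).
assert (Pb : 0 < 1 - b n ^ 2) by (pose proof (Hvb n); pose proof (Cmod_ge_0 (vb n)) as Q; fold (b n) in Q; nra).
match goal with |- Rabs ?e <= _ => replace e with (A n - 2 * Re (Cconj t * B n)%C) end.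
2: { unfold A, B.
     replace (Cconj t * (vf (S n) * RtoC (al n) + vb n * RtoC (be n)))%C
       with ((Cconj t * vf (S n)) * RtoC (al n) + (Cconj t * vb n) * RtoC (be n))%C by ring.
     rewrite re_plus, !re_scal_r; unfold al, be; field; repeat split; lra. }
apply Rle_trans with (1 := Rabs_triang _ _).
rewrite Rabs_Ropp, Rabs_mult, (Rabs_pos_eq 2) by lra.
pose proof (re_le_Cmod (Cconj t * B n)%C) as Q; rewrite Cmod_mult, Cmod_conj, Ht1 in Q; lra.
Qed.

(* tau is a cluster point of the radial projections of p n. If horo tau (p n) ever increased
   it would increase geometrically, and so would horo tau' (p n) for all tau' near tau; but it
   is at most 1 when tau' is the radial projection of p n. *)
Lemma horo_decay :
  exists tau, Cmod tau = 1 /\ is_lim_seq (fun n => horo tau (p (S n)) / horo tau (p n)) (1 / 3).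
Proof.
destruct horo_recurrence as (E & LE & HE).
(* At p_n = 0 any unimodular default would do, as [horo] equals 1 at the origin. *)
set (pr := fun n => if Ceq_dec (p n) 0 then RtoC 1 else (p n / RtoC (Cmod (p n)))%C).
assert (Hpr : forall n, Cmod (pr n) = 1 /\ horo (pr n) (p n) <= 1).
{ intros n; unfold pr, horo; destruct (Ceq_dec (p n) 0) as [Z|Z].
  - rewrite Z, Cmod_1, Cmod_0; split; [reflexivity|].
    replace (1 - 0)%C with (RtoC 1) by ring; rewrite Cmod_1; lra.
  - pose proof Z as Z'; apply Cmod_gt_0 in Z'.
    assert (Zr : RtoC (Cmod (p n)) <> RtoC 0) by (intros Q; apply RtoC_inj in Q; lra).
    pose proof (orbit_disk n) as D; pose proof (in_disk_sq _ D) as D2; unfold in_disk in D.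
    split.
    + rewrite Cmod_div, Cmod_R, Rabs_pos_eq by (trivial; lra); field; lra.
    + replace (p n / RtoC (Cmod (p n)) - p n)%C with (p n * RtoC (/ Cmod (p n) - 1))%C.
      2: { rewrite RtoC_minus, RtoC_inv by lra; field; exact Zr. }
      rewrite Cmod_mult, Cmod_R, Rabs_pos_eq.
      * apply Rle_div_l; [exact D2|].
        replace (Cmod (p n) * (/ Cmod (p n) - 1)) with (1 - Cmod (p n)) by (field; lra); nra.
      * assert (1 <= / Cmod (p n)) by (rewrite <- Rinv_1; apply Rinv_le_contravar; lra); lra. }
destruct (complex_cluster pr 1) as [tau Hcl].
{ intros n; rewrite (proj1 (Hpr n)); lra. }
assert (Ht : Cmod tau = 1).
{ apply cond_eq; intros eps He; destruct (Hcl eps He O) as (n & _ & Hn).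
  pose proof (Cmod_diff_le (pr n) tau) as D; rewrite (proj1 (Hpr n)) in D.
  rewrite <- Rabs_Ropp, Ropp_minus_distr; lra. }
exists tau; split; [exact Ht|].
apply is_lim_seq_spec in LE; destruct (LE (mkposreal (1 / 3) ltac:(lra))) as [N0 HN0].
change (forall n, (N0 <= n)%nat -> Rabs (E n - 0) < 1 / 3) in HN0.
assert (HE3 : forall n, (N0 <= n)%nat -> E n <= 1 / 3).
{ intros n Hn; specialize (HN0 n Hn); apply Rabs_def2 in HN0; lra. }
apply recurrence_decay with (s := fun n => horo tau (p n)) (E := E) (N0 := N0).
- intros n; apply horo_pos; [exact Ht|apply orbit_disk].
- apply is_lim_seq_spec; exact LE.
- now apply HE.
- intros N HN; apply Rnot_lt_le; intros L.
  assert (T : forall n, tends (ball_filter tau) (fun w => RtoC (horo w (p n))) (RtoC (horo tau (p n)))).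
  { intros n; unfold horo, Rdiv.
    pose proof (in_disk_sq _ (orbit_disk n)) as D.
    apply tends_ext with (fun w => RtoC (Cmod (w - p n)) * RtoC (Cmod (w - p n)) * RtoC (/ (1 - Cmod (p n) ^ 2)))%C.
    { intros w; rewrite !RtoC_mult, RtoC_pow; ring. }
    rewrite RtoC_mult, RtoC_pow.
    replace (RtoC (Cmod (tau - p n)) ^ 2)%C with (RtoC (Cmod (tau - p n)) * RtoC (Cmod (tau - p n)))%C by ring.
    apply tends_mult; [apply tends_mult|apply tends_const];
      apply tends_Cmod, tends_minus; (apply tends_id || apply tends_const). }
  assert (Td : tends (ball_filter tau) (fun w => RtoC (horo w (p (S N)) - horo w (p N)))
    (RtoC (horo tau (p (S N)) - horo tau (p N)))).
  { apply tends_ext with (fun w => RtoC (horo w (p (S N))) - RtoC (horo w (p N)))%C.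
    { intros w; now rewrite RtoC_minus. }
    rewrite RtoC_minus; apply tends_minus; apply T. }
  destruct (proj1 (tends_R _ _) Td (horo tau (p (S N)) - horo tau (p N)) ltac:(lra)) as (d & Hd & Hdd).
  (* [c] bounds [horo] at [p (S N)] from below for every boundary point. The number of doublings
     that forces a value above 1 can therefore be fixed before [pr m] is chosen. *)
  set (c := (1 - Cmod (p (S N))) / 2).
  assert (Hc : 0 < c) by (pose proof (orbit_disk (S N)) as D; unfold in_disk in D; unfold c; lra).
  destruct (Pow_x_infinity 2 ltac:(rewrite Rabs_pos_eq; lra) (/ c + 1)) as [K HK].
  destruct (Hcl d Hd (S N + K)%nat) as (m & Hm & Hmd).
  specialize (Hdd _ Hmd); apply Rabs_def2 in Hdd.
  destruct (Hpr m) as [U1 U2].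
  pose proof (recurrence_growth (fun n => horo (pr m) (p n)) N) as Gr; cbv beta in Gr.
  specialize (Gr (fun n => horo_pos _ _ U1 (orbit_disk n))).
  assert (G1 := Gr (fun n Hn => Rle_trans _ _ _ (HE (pr m) U1 n) (HE3 n ltac:(lia))) ltac:(lra) (m - S N)%nat).
  replace (S N + (m - S N))%nat with m in G1 by lia.
  pose proof (horo_lower (pr m) (p (S N)) U1 (orbit_disk _)) as Lw; fold c in Lw.
  specialize (HK (m - S N)%nat ltac:(lia)); rewrite Rabs_pos_eq in HK by (apply pow_le; lra).
  assert (H2 : / c * c < 2 ^ (m - S N) * c) by (apply Rmult_lt_compat_r; lra).
  rewrite Rinv_l in H2 by lra.
  assert (2 ^ (m - S N) * c <= 2 ^ (m - S N) * horo (pr m) (p (S N))).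
  { apply Rmult_le_compat_l; [apply pow_le; lra|exact Lw]. }
  lra.
Qed.


(** * Asymptotic dilation in the half-plane with tau at infinity *)

Section Endpoint.
Variable tau : C.
Hypothesis htau : Cmod tau = 1.
Hypothesis Hdecay : is_lim_seq (fun n => horo tau (p (S n)) / horo tau (p n)) (1 / 3).

Let t n := mob (p n) tau.
Let w n := (Cconj (t n) * vf n)%C.

Lemma Cmod_endpoint_in_frame n : Cmod (t n) = 1.
Proof. apply Cmod_mob_unimodular; [exact htau|apply orbit_disk]. Qed.

(** The modulus of w_n tends to 1/2, and the horocyclic ratio (1 + |w|^2 - 2 Re w) / (1 - |w|^2)
    tends to 1/3, which forces Re w -> 1/2. Hence |w - 1/2|^2 is an expression in these two
    quantities that tends to 0. *)
Lemma next_point_in_frame_lim : tends eventually w (RtoC (1 / 2)).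
Proof.
set (a := fun n => Cmod (vf n) ^ 2).
set (rho := fun n => horo tau (p (S n)) / horo tau (p n)).
assert (Ha : is_lim_seq a (1 / 4)).
{ apply is_lim_seq_ext with (fun n => Cmod (vf n) * Cmod (vf n)); [intros n; unfold a; ring|].
  replace (Finite (1 / 4)) with (Finite (1 / 2 * (1 / 2))) by (f_equal; field).
  apply is_lim_seq_mult'; apply tends_eventually_seq; exact Cmod_forward_step_lim. }
assert (Hsq : forall n, Cmod (w n - RtoC (1 / 2))%C ^ 2 = a n - (1 + a n - rho n * (1 - a n)) / 2 + 1 / 4).
{ intros n.
  assert (Hv : 0 < 1 - a n).
  { apply in_disk_sq; exact (proj2 (pseudo_hyp_lt1 (p (S n)) (p n) (orbit_disk _) (orbit_disk _))). }
  assert (Er : rho n * (1 - a n) = 1 + a n - 2 * Re (w n)).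
  { unfold rho, w, t; rewrite (horo_mob tau (p n) (p (S n))) by (trivial; apply orbit_disk).
    fold (vf n); rewrite sq_sub_unimodular by apply Cmod_endpoint_in_frame; fold (a n).
    pose proof (horo_pos tau (p n) htau (orbit_disk n)); field; lra. }
  assert (Ew : Cmod (w n) ^ 2 = a n).
  { unfold w; rewrite Cmod_mult, Cmod_conj, Cmod_endpoint_in_frame; unfold a; ring. }
  rewrite Er, <- Ew, !Cmod2_alt, Re_minus, Im_minus; generalize (w n); intros [q1 q2]; simpl; field. }
assert (L : is_lim_seq (fun n => a n - (1 + a n - rho n * (1 - a n)) / 2 + 1 / 4) 0).
{ replace (Finite 0) with (Finite (1 / 4 - (1 + 1 / 4 - 1 / 3 * (1 - 1 / 4)) / 2 + 1 / 4)) by (f_equal; field).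
  unfold Rdiv at 5.
  apply is_lim_seq_plus'; [|apply is_lim_seq_const].
  apply is_lim_seq_minus'; [exact Ha|].
  apply is_lim_seq_mult'; [|apply is_lim_seq_const].
  apply is_lim_seq_minus'; [apply is_lim_seq_plus'; [apply is_lim_seq_const|exact Ha]|].
  apply is_lim_seq_mult'; [exact Hdecay|].
  apply is_lim_seq_minus'; [apply is_lim_seq_const|exact Ha]. }
intros eps He; apply is_lim_seq_spec in L.
assert (He2 : 0 < eps ^ 2) by now apply pow_lt.
destruct (L (mkposreal _ He2)) as [N HN]; exists N; intros n Hn; specialize (HN n Hn).
change (Rabs (a n - (1 + a n - rho n * (1 - a n)) / 2 + 1 / 4 - 0) < eps ^ 2) in HN.
rewrite <- Hsq in HN; apply Rabs_def2 in HN.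
apply Rsqr_incrst_0; [rewrite !Rsqr_pow2; lra|apply Cmod_ge_0|lra].
Qed.

Let height n := Re (cay tau (p n)).
(** The tangent of the argument of the image point in the half-plane; its limit 0 expresses that the
    orbit approaches tau in the radial direction. *)
Let Y n := Im (cay tau (p n)) / height n.

Lemma height_pos n : 0 < height n.
Proof.
unfold height; rewrite cay_Re by (trivial; apply orbit_disk).
apply Rinv_0_lt_compat, horo_pos; [exact htau|apply orbit_disk].
Qed.

Let om n u := (Cconj (t n) * mob (p n) u)%C.

Lemma cay_frame n u : in_disk u ->
  (1 - om n u)%C <> RtoC 0 /\ cay tau u = (RtoC (height n) * ((1 + om n u) / (1 - om n u) + Ci * RtoC (Y n)))%C.
Proof.
intros Hu; destruct (mob_cay tau (p n) u htau (orbit_disk n) Hu) as [N E].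
fold (t n) in N, E; fold (om n u) in N, E; split; [exact N|].
pose proof (height_pos n) as P.
assert (EX : cay tau (p n) = (RtoC (height n) * (1 + Ci * RtoC (Y n)))%C).
{ unfold Y; rewrite RtoC_div by lra.
  assert (Xn : RtoC (height n) <> RtoC 0) by (intros Z; apply RtoC_inj in Z; lra).
  transitivity (RtoC (height n) + Ci * RtoC (Im (cay tau (p n))))%C; [|field; exact Xn].
  unfold height; destruct (cay tau (p n)) as [a b]; unfold Ci, RtoC, Cplus, Cmult; simpl; f_equal; ring. }
assert (EXc : Cconj (cay tau (p n)) = (RtoC (height n) * (1 - Ci * RtoC (Y n)))%C).
{ rewrite EX, conj_RtoC_mult; f_equal.
  apply injective_projections; simpl; ring. }
rewrite E, EXc, EX; field; exact N.
Qed.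

Lemma frame_step_lim : tends eventually (fun n => (1 + w n) / (1 - w n))%C (RtoC 3).
Proof.
assert (N : (1 - RtoC (1 / 2))%C <> RtoC 0).
{ rewrite <- RtoC_minus; intros Z; apply RtoC_inj in Z; lra. }
apply (eq_ind ((1 + RtoC (1 / 2)) / (1 - RtoC (1 / 2)))%C (fun l => tends eventually _ l)).
- apply tends_div; [exact N| |].
  + apply tends_plus; [apply tends_const|apply next_point_in_frame_lim].
  + apply tends_minus; [apply tends_const|apply next_point_in_frame_lim].
- rewrite <- RtoC_minus, <- RtoC_plus, <- RtoC_div by lra; f_equal; field.
Qed.

Let A n := ((1 + w n) / (1 - w n))%C.

Lemma frame_step_Re_ge2 : eventually (fun n => 2 <= Re (A n)).
Proof.
destruct (frame_step_lim 1 Rlt_0_1) as [N HN]; exists N; intros n Hn; specialize (HN n Hn); fold (A n) in HN.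
pose proof (re_le_Cmod (A n - RtoC 3)%C) as R; rewrite Re_minus in R; simpl (Re (RtoC 3)) in R.
apply Rabs_le_between in R; lra.
Qed.

Lemma height_succ n : height (S n) = height n * Re (A n) /\ Im (cay tau (p (S n))) = height n * (Im (A n) + Y n).
Proof.
destruct (cay_frame n (p (S n)) (orbit_disk _)) as [N E].
change (om n (p (S n))) with (w n) in E; fold (A n) in E.
split.
- unfold height at 1; rewrite E, re_scal_l, re_plus; simpl (Re (Ci * _)%C); ring.
- rewrite E, im_scal_l, im_plus; simpl (Im (Ci * _)%C); ring.
Qed.

Lemma inv_height_lim : is_lim_seq (fun n => / height n) 0.
Proof.
apply halving_lim with (fun _ => 0).
- intros n; left; apply Rinv_0_lt_compat, height_pos.
- apply is_lim_seq_const.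
- generalize frame_step_Re_ge2; apply filter_imp; intros n Hn.
  rewrite (proj1 (height_succ n)), Rinv_mult, Rplus_0_r; unfold Rdiv.
  apply Rmult_le_compat_l; [left; apply Rinv_0_lt_compat, height_pos|].
  apply Rinv_le_contravar; lra.
Qed.

(** One step sends Y to (Im A + Y) / Re A, where Im A -> 0 and Re A is eventually at least 2, so the
    slope is halved up to a vanishing error. *)
Lemma slope_lim : is_lim_seq Y 0.
Proof.
apply is_lim_seq_abs_0.
apply halving_lim with (fun n => Rabs (Im (A n))).
- intros n; apply Rabs_pos.
- apply (is_lim_seq_abs_0 (fun n => Im (A n))).
  apply tends_eventually_seq; exact (tends_Im _ _ frame_step_lim).
- generalize frame_step_Re_ge2; apply filter_imp; intros n Hn.
  unfold Y; rewrite (proj2 (height_succ n)), (proj1 (height_succ n)).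
  fold (Y n); pose proof (height_pos n).
  replace (height n * (Im (A n) + Y n) / (height n * Re (A n))) with ((Im (A n) + Y n) * / Re (A n)) by (field; lra).
  rewrite Rabs_mult, (Rabs_pos_eq (/ Re (A n))) by (left; apply Rinv_0_lt_compat; lra).
  pose proof (Rabs_triang (Im (A n)) (Y n)).
  unfold Rdiv; apply Rmult_le_compat.
  + apply Rabs_pos.
  + left; apply Rinv_0_lt_compat; lra.
  + lra.
  + apply Rinv_le_contravar; lra.
Qed.

Section Uniform.
Variable r : R.
Hypothesis Hr : 0 <= r < 1.

Let v (nz : nat * C) := (Cconj sigma * mob (x (fst nz)) (snd nz))%C.
Let W (nz : nat * C) := om (fst nz) (phi (snd nz)).
Let mu (nz : nat * C) := (Cconj (t (fst nz)) * sigma * G (fst nz) (snd nz))%C.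

Lemma image_frame_eq n z : in_disk z -> W (n, z) = (mu (n, z) * v (n, z))%C.
Proof.
intros Hz; unfold W, om, mu, v; simpl fst; simpl snd.
unfold p; rewrite mob_hyp_diff_quot by (trivial; apply radial_point_disk); fold (G n z).
transitivity (Cconj (t n) * (G n z * mob (x n) z) * (Cconj sigma * sigma))%C; [|ring].
rewrite unimodular_conj by trivial; ring.
Qed.

(** At the next radial point the multiplier is exactly 2 w_n, which tends to 1; near constancy of
    the difference quotient spreads this over the whole disk. The modulus alone would leave a
    unimodular factor undetermined. *)
Lemma multiplier_lim : tends (disk_filter r) mu 1.
Proof.
set (c := fun n => (Cconj (t n) * sigma)%C).
assert (Hc : forall n, Cmod (c n) = 1).
{ intros n; unfold c; rewrite Cmod_mult, Cmod_conj, Cmod_endpoint_in_frame, hsigma; ring. }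
apply tends_ext with (fun nz : nat * C =>
  (G (fst nz) (snd nz) - G (fst nz) (x (fst nz))) * c (fst nz)
  + ((G (fst nz) (x (fst nz)) - G (fst nz) (x (S (fst nz)))) * c (fst nz) + RtoC 2 * w (fst nz)))%C.
{ intros [n z]; simpl; unfold mu, c, w; simpl; rewrite forward_step_eq, RtoC_div by lra; field. }
apply (eq_ind (0 + (0 + RtoC 2 * RtoC (1 / 2)))%C (fun l => tends (disk_filter r) _ l)).
2: { rewrite <- RtoC_mult, !Cplus_0_l; f_equal; field. }
apply tends_plus; [|apply tends_plus].
- apply tends_bounded_mult with 1; [|apply filter_forall; intros nz; rewrite Hc; lra].
  now apply diff_quot_near_center.
- apply tends_bounded_mult with 1; [|apply filter_forall; intros nz; rewrite Hc; lra].
  apply (disk_filter_seq r (fun n => G n (x n) - G n (x (S n)))%C).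
  apply (eq_ind (- RtoC 0)%C (fun l => tends eventually _ l)); [|ring].
  apply tends_ext with (fun n => - (G n (x (S n)) - G n (x n)))%C; [intros; ring|].
  apply tends_opp, diff_quot_succ_center.
- apply tends_mult; [apply tends_const|exact (disk_filter_seq r w _ next_point_in_frame_lim)].
Qed.

Lemma domain_frame_bound n z : pseudo_hyp z (x n) <= r -> Cmod (v (n, z)) <= r.
Proof.
intros Hp; unfold v; rewrite Cmod_mult, Cmod_conj, hsigma, Rmult_1_l; exact Hp.
Qed.

Lemma image_frame_bound n z : in_disk z -> pseudo_hyp z (x n) <= r -> Cmod (W (n, z)) <= r.
Proof.
intros Hz Hp; unfold W, om; simpl; rewrite Cmod_mult, Cmod_conj, Cmod_endpoint_in_frame, Rmult_1_l.
change (Cmod (mob (p n) (phi z))) with (pseudo_hyp (phi z) (phi (x n))).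
rewrite pseudo_hyp_contraction by (trivial; apply radial_point_disk).
pose proof (contraction_bounds phi hphi (x n) z (radial_point_disk n) Hz).
pose proof (pseudo_hyp_lt1 z (x n) Hz (radial_point_disk n)); nra.
Qed.

Lemma Cmod_one_minus_ge u : Cmod u <= r -> 1 - r <= Cmod (1 - u)%C /\ 1 - r <= Cmod (1 + u)%C.
Proof.
intros Hu; pose proof (Cmod_diff_le 1 u) as D; pose proof (Cmod_diff_le 1 (- u)%C) as D'.
rewrite Cmod_1 in D, D'; rewrite Cmod_opp in D'.
replace (1 - - u)%C with (1 + u)%C in D' by ring.
apply Rabs_le_between in D; apply Rabs_le_between in D'; lra.
Qed.

Lemma neq0_of_Cmod_ge u : 1 - r <= Cmod u -> u <> RtoC 0.
Proof. intros H; apply Cmod_gt_0; lra. Qed.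

Let IB nz := ((1 - v nz) / (1 + v nz))%C.

Lemma inv_cay_bound : disk_filter r (fun nz => Cmod (IB nz) <= 2 / (1 - r)).
Proof.
exists O; intros n z _ Hz Hp; pose proof (domain_frame_bound n z Hp) as B.
destruct (Cmod_one_minus_ge _ B) as [_ B2].
unfold IB; rewrite Cmod_div by now apply neq0_of_Cmod_ge.
pose proof (Cmod_triangle 1 (- v (n, z))%C) as T; rewrite Cmod_1, Cmod_opp in T.
apply Rmult_le_compat.
- apply Cmod_ge_0.
- left; apply Rinv_0_lt_compat; lra.
- change (1 - v (n, z))%C with (1 + - v (n, z))%C; lra.
- apply Rinv_le_contravar; lra.
Qed.

(** [D1] and [D2] measure how far [cay sigma z + 1] and [cay tau (phi z) + 1] are from [3 ^ n] and
    [height n] times the common factor (1 + v) / (1 - v). The summand 1 enters because 1 - conj(s) u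
    = 2 / (cay s u + 1). *)
Let D1 nz := (1 + RtoC (/ 3 ^ fst nz) * IB nz)%C.
Let D2 nz := (1 + ((1 + W nz) / (1 - W nz) + Ci * RtoC (Y (fst nz)) - (1 + v nz) / (1 - v nz)
   + RtoC (/ height (fst nz))) * IB nz)%C.

Lemma domain_defect_lim : tends (disk_filter r) D1 1.
Proof.
apply (eq_ind (1 + 0)%C (fun l => tends (disk_filter r) _ l)); [|ring].
apply tends_plus; [apply tends_const|].
apply tends_bounded_mult with (2 / (1 - r)); [|apply inv_cay_bound].
apply (disk_filter_seq r (fun n => RtoC (/ 3 ^ n))).
apply tends_eventually_seq.
apply is_lim_seq_ext with (fun n => (/ 3) ^ n); [intros n; apply pow_inv|].
apply is_lim_seq_geom; rewrite Rabs_pos_eq; lra.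
Qed.

Lemma image_defect_lim : tends (disk_filter r) D2 1.
Proof.
apply (eq_ind (1 + 0)%C (fun l => tends (disk_filter r) _ l)); [|ring].
apply tends_plus; [apply tends_const|].
apply tends_bounded_mult with (2 / (1 - r)); [|apply inv_cay_bound].
(* The two Cayley images differ by 2 (W - v) / ((1 - W) (1 - v)) with W = mu v, so the multiplier
   limit applies while the denominators stay bounded away from 0. *)
apply tends_ext_loc with (fun nz => (mu nz - 1) * (RtoC 2 * v nz / ((1 - W nz) * (1 - v nz)))
   + (Ci * RtoC (Y (fst nz)) + RtoC (/ height (fst nz))))%C.
{ exists O; intros n z _ Hz Hp.
  destruct (Cmod_one_minus_ge _ (domain_frame_bound n z Hp)) as [B1 _].
  destruct (Cmod_one_minus_ge _ (image_frame_bound n z Hz Hp)) as [B2 _].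
  apply neq0_of_Cmod_ge in B1; apply neq0_of_Cmod_ge in B2.
  simpl fst.
  replace ((mu (n, z) - 1) * (RtoC 2 * v (n, z) / ((1 - W (n, z)) * (1 - v (n, z)))))%C
    with (RtoC 2 * (W (n, z) - v (n, z)) / ((1 - W (n, z)) * (1 - v (n, z))))%C.
  - replace (RtoC 2) with (1 + 1)%C by (rewrite <- RtoC_plus; f_equal; ring).
    field; split; trivial.
  - rewrite image_frame_eq by trivial; field; rewrite <- image_frame_eq by trivial; split; trivial. }
apply (eq_ind (0 + (Ci * 0 + 0))%C (fun l => tends (disk_filter r) _ l)); [|ring].
apply tends_plus; [|apply tends_plus].
- apply tends_bounded_mult with (2 * r / ((1 - r) * (1 - r))); [exact (tends_sub0 _ _ multiplier_lim)|].
  exists O; intros n z _ Hz Hp.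
  pose proof (domain_frame_bound n z Hp) as B0.
  destruct (Cmod_one_minus_ge _ B0) as [B1 _].
  destruct (Cmod_one_minus_ge _ (image_frame_bound n z Hz Hp)) as [B2 _].
  rewrite Cmod_div, !Cmod_mult, Cmod_R, Rabs_pos_eq
    by (try apply Cmult_neq_0; try (now apply neq0_of_Cmod_ge); lra).
  apply Rmult_le_compat.
  + apply Rmult_le_pos; [lra|apply Cmod_ge_0].
  + left; apply Rinv_0_lt_compat; apply Rmult_lt_0_compat; lra.
  + lra.
  + apply Rinv_le_contravar; [apply Rmult_lt_0_compat; lra|apply Rmult_le_compat; lra].
- apply tends_mult; [apply tends_const|].
  apply (disk_filter_seq r (fun n => RtoC (Y n))); apply tends_eventually_seq, slope_lim.
- apply (disk_filter_seq r (fun n => RtoC (/ height n))); apply tends_eventually_seq, inv_height_lim.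
Qed.

Lemma mob_radial_sigma n : mob (x n) sigma = sigma.
Proof.
pose proof (radial_real_bounds n).
assert (N : (1 - RtoC (radial_real n))%C <> RtoC 0).
{ rewrite <- RtoC_minus; intros Z; apply RtoC_inj in Z; lra. }
unfold mob, x, radial; rewrite conj_RtoC_mult, <- Cmult_assoc, unimodular_conj by trivial.
field; exact N.
Qed.

Lemma cay_radial n : cay sigma (x n) = RtoC (3 ^ n).
Proof.
pose proof (pow3_ge1 n); pose proof (radial_real_bounds n).
assert (Sn : sigma <> RtoC 0) by (apply Cmod_gt_0; lra).
assert (N : (1 - RtoC (radial_real n))%C <> RtoC 0).
{ rewrite <- RtoC_minus; intros Z; apply RtoC_inj in Z; lra. }
transitivity (RtoC ((1 + radial_real n) / (1 - radial_real n))).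
- rewrite RtoC_div, RtoC_plus, RtoC_minus by lra; unfold cay, x, radial; field; split; trivial.
  intros Z; apply N.
  assert (Z' : (sigma * (1 - RtoC (radial_real n)))%C = RtoC 0) by (rewrite <- Z; ring).
  destruct (Ceq_dec (1 - RtoC (radial_real n))%C 0) as [Q|Q]; [exact Q|].
  elim (Cmult_neq_0 _ _ Sn Q Z').
- f_equal; unfold radial_real; field; lra.
Qed.

Lemma cay_one_minus s u : Cmod s = 1 -> in_disk u ->
  (cay s u + 1)%C <> RtoC 0 /\ (1 - Cconj s * u)%C = (RtoC 2 / (cay s u + 1))%C.
Proof.
intros Hs Hu; pose proof (unimodular_sub_neq0 s u Hs Hu) as N.
assert (Sn : s <> RtoC 0) by (apply Cmod_gt_0; lra).
assert (E : (cay s u + 1)%C = (RtoC 2 * s / (s - u))%C).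
{ unfold cay; replace (RtoC 2) with (1 + 1)%C by (rewrite <- RtoC_plus; f_equal; ring); field; exact N. }
assert (T : RtoC 2 <> RtoC 0) by (intros Z; apply RtoC_inj in Z; lra).
split.
- rewrite E; apply Cmult_neq_0; [now apply Cmult_neq_0|].
  intros Z; apply (f_equal (Cmult (s - u))) in Z; rewrite Cinv_r, Cmult_0_r in Z by exact N.
  now apply C1_nz.
- rewrite E, one_minus_conj_eq by exact Hs.
  assert (Ec : Cconj s = (/ s)%C).
  { rewrite <- (Cmult_1_l (/ s)), <- (unimodular_conj s Hs); field; exact Sn. }
  rewrite Ec; field; repeat split; trivial.
Qed.

(** The common factor (1 + v) / (1 - v) cancels in the boundary quotient, leaving a positive number
    times [D1 / D2]. In 1 - conj(tau) phi the factor 1 / [height n] forces convergence to 0. *)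
Lemma frame_facts n z : in_disk z -> pseudo_hyp z (x n) <= r ->
  D2 (n, z) <> RtoC 0 /\ (1 - Cconj tau * phi z)%C = (RtoC (/ height n) * (RtoC 2 * (/ D2 (n, z) * IB (n, z))))%C /\ boundary_quot phi sigma tau z = (RtoC (3 ^ n * / height n) * (D1 (n, z) / D2 (n, z)))%C.
Proof.
intros Hz Hp.
destruct (Cmod_one_minus_ge _ (domain_frame_bound n z Hp)) as [B1 B1'].
apply neq0_of_Cmod_ge in B1; apply neq0_of_Cmod_ge in B1'.
pose proof (height_pos n) as Xp; pose proof (pow3_ge1 n) as P3.
assert (Xn : RtoC (height n) <> RtoC 0) by (intros Z; apply RtoC_inj in Z; lra).
assert (Tn : RtoC (3 ^ n) <> RtoC 0) by (intros Z; apply RtoC_inj in Z; lra).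
assert (T2 : RtoC 2 <> RtoC 0) by (intros Z; apply RtoC_inj in Z; lra).
pose proof (self_map_disk phi hphi z Hz) as Hpz.
destruct (cay_frame n (phi z) Hpz) as [NW EF]; change (om n (phi z)) with (W (n, z)) in NW, EF.
assert (F2 : (cay tau (phi z) + 1)%C = (RtoC (height n) * ((1 + v (n, z)) / (1 - v (n, z))) * D2 (n, z))%C).
{ rewrite EF; unfold D2, IB; simpl fst; rewrite RtoC_inv by lra; field; repeat split; trivial. }
destruct (mob_cay sigma (x n) z hsigma (radial_point_disk n) Hz) as [NS ES].
rewrite mob_radial_sigma in NS, ES; change (Cconj sigma * mob (x n) z)%C with (v (n, z)) in NS, ES.
assert (C3 : Cconj (RtoC (3 ^ n)) = RtoC (3 ^ n)) by (unfold Cconj; simpl; now rewrite Ropp_0).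
rewrite cay_radial, C3 in ES.
assert (F1 : (cay sigma z + 1)%C = (RtoC (3 ^ n) * ((1 + v (n, z)) / (1 - v (n, z))) * D1 (n, z))%C).
{ rewrite ES; unfold D1, IB; simpl fst; rewrite RtoC_inv by lra; field; repeat split; trivial. }
destruct (cay_one_minus tau (phi z) htau Hpz) as [M1 M2].
destruct (cay_one_minus sigma z hsigma Hz) as [M3 M4].
assert (ND2 : D2 (n, z) <> RtoC 0) by (intros Z; rewrite F2, Z, Cmult_0_r in M1; now apply M1).
assert (ND1 : D1 (n, z) <> RtoC 0) by (intros Z; rewrite F1, Z, Cmult_0_r in M3; now apply M3).
split; [exact ND2|split].
- rewrite M2, F2, RtoC_inv by lra; unfold IB; field; repeat split; trivial.
- unfold boundary_quot; rewrite M2, M4, F2, F1, RtoC_mult, RtoC_inv by lra; field; repeat split; trivial.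
Qed.

Lemma disk_filter_quot_sector eta : 0 < eta ->
  disk_filter r (fun nz => sector eta (boundary_quot phi sigma tau (snd nz))).
Proof.
intros He.
assert (L : tends (disk_filter r) (fun nz => D1 nz / D2 nz)%C 1).
{ apply (eq_ind (1 / 1)%C (fun l => tends (disk_filter r) _ l)); [|field; exact C1_nz].
  apply tends_div; [exact C1_nz|exact domain_defect_lim|exact image_defect_lim]. }
destruct (tends1_sector _ _ eta He L) as [N HN]; exists N; intros n z Hn Hz Hp; simpl.
destruct (frame_facts n z Hz Hp) as (_ & _ & E); rewrite E.
specialize (HN n z Hn Hz Hp); unfold sector in *.
assert (P : 0 < 3 ^ n * / height n).
{ apply Rmult_lt_0_compat; [apply pow_lt; lra|apply Rinv_0_lt_compat, height_pos]. }
rewrite im_scal_l, re_scal_l, Rabs_mult, Rabs_pos_eq by lra; nra.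
Qed.

Lemma disk_filter_phi_lim : tends (disk_filter r) (fun nz => phi (snd nz)) tau.
Proof.
assert (L : tends (disk_filter r) (fun nz => RtoC (/ height (fst nz)) * (RtoC 2 * (/ D2 nz * IB nz)))%C 0).
{ apply tends_bounded_mult with (2 * ((Cmod (/ 1) + 1) * (2 / (1 - r)))).
  - apply (disk_filter_seq r (fun n => RtoC (/ height n))); apply tends_eventually_seq, inv_height_lim.
  - generalize (filter_and _ _ inv_cay_bound (tends_bound _ _ (tends_inv _ _ C1_nz image_defect_lim))).
    apply filter_imp; intros nz [H1 H2].
    rewrite !Cmod_mult, Cmod_R, (Rabs_pos_eq 2) by lra.
    apply Rmult_le_compat_l; [lra|].
    apply Rmult_le_compat; trivial; apply Cmod_ge_0. }
intros eps He; destruct (L eps He) as [N HN]; exists N; intros n z Hn Hz Hp; simpl.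
specialize (HN n z Hn Hz Hp); simpl fst in HN.
destruct (frame_facts n z Hz Hp) as (_ & E & _); rewrite <- E in HN.
replace (1 - Cconj tau * phi z - 0)%C with (1 - Cconj tau * phi z)%C in HN by ring.
now rewrite Cmod_one_minus_conj in HN by exact htau.
Qed.

End Uniform.

Lemma weakly_conformal_endpoint : weakly_conformal phi sigma.
Proof.
(* The radial sequence itself has step 1/2 and covers every Stolz region, so statements uniform on
   hyperbolic disks around its points become angular limits. *)
assert (Hcov : forall M, 1 < M -> exists r, 0 <= r < 1 /\ forall P : C -> Prop,
  disk_filter r (fun nz => P (snd nz)) -> stolz_filter sigma M P).
{ intros M HM.
  destruct (sequence_covers_stolz sigma x 2 M (1 / 2) hsigma) as (r & Hr & Hc); trivial; try lra.
  - now apply radial_lim.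
  - intros n; apply radial_stolz; [exact hsigma|lra].
  - intros n; rewrite pseudo_hyp_sym, pseudo_hyp_x_succ by apply radial_point_disk; lra.
  - exists r; split; [exact Hr|]; intros P (N & HN).
    destruct (Hc N) as (d & Hd & K).
    apply stolz_filter_ball; exists d; split; [exact Hd|]; intros z Hz Hzd.
    destruct (K z Hz Hzd) as (n & Hn & Hp).
    apply (HN n z Hn); [apply Hz|].
    rewrite pseudo_hyp_sym by (apply radial_point_disk || apply Hz); exact Hp. }
exists tau; split; [|split; [exact htau|]].
- intros M HM; destruct (Hcov M HM) as (r & Hr & H).
  apply tends_filterlim; [apply stolz_filter_filter|]; intros eps He.
  apply H; exact (disk_filter_phi_lim r Hr eps He).
- intros M HM; destruct (Hcov M HM) as (r & Hr & H).
  apply arg_lim_sector; [apply stolz_filter_filter|]; intros eta He.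
  apply H; rewrite Ropp_0.
  generalize (disk_filter_quot_sector r Hr eta He); intros (N & HN); exists N.
  intros n z Hn Hz Hp; simpl; rewrite cis_0, Cmult_1_r; exact (HN n z Hn Hz Hp).
Qed.

End Endpoint.
End Orbit.

Theorem mainTheorem2 (phi : C -> C) (sigma : C)
  (hphi : holomorphic_self_map phi) (hsigma : Cmod sigma = 1) :
  (weakly_conformal phi sigma <->
    exists z : nat -> C,
      (forall n : nat, in_disk (z n)) /\
      bounded_step z /\ nontangential_cv z sigma /\
      is_lim_seq (fun n => hyp_distortion phi (z n)) 1) /\
  (weakly_conformal phi sigma <->
    exists z : nat -> C,
      (forall n : nat, in_disk (z n)) /\
      bounded_step z /\ nontangential_cv z sigma /\
      is_lim_seq (fun n => hyp_quotient phi (z n) (z (S n))) 1) /\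
  (weakly_conformal phi sigma <->
    (exists tau : C, angular_lim phi sigma tau /\ Cmod tau = 1) /\
    ex_angular_arg_lim (C_derive phi) sigma).
Proof.
assert (weak_a : weakly_conformal phi sigma ->
  is_lim_seq (fun n => hyp_distortion phi (radial sigma n)) 1).
{ intros (tau & Hlim & Ht & Harg); exact (weak_distortion_radial phi sigma hphi hsigma tau Ht Hlim Harg). }
assert (a_weak : forall z : nat -> C, (forall n, in_disk (z n)) -> bounded_step z ->
  nontangential_cv z sigma -> is_lim_seq (fun n => hyp_distortion phi (z n)) 1 ->
  weakly_conformal phi sigma).
{ intros z Hz Hb Hn HD.
  pose proof (distortion_radial phi sigma hphi hsigma z Hz Hb Hn HD) as Hx1.
  destruct (horo_decay phi sigma hphi hsigma Hx1) as (tau & Ht & Hdecay).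
  exact (weakly_conformal_endpoint phi sigma hphi hsigma Hx1 tau Ht Hdecay). }
pose proof (radial_disk sigma hsigma) as Hrd.
pose proof (radial_bounded_step sigma hsigma) as Hrb.
pose proof (radial_nontangential sigma hsigma) as Hrn.
split; [|split]; split.
- intros Hw; exists (radial sigma); auto.
- intros (z & Hz & Hb & Hn & HD); now apply (a_weak z).
- intros Hw; exists (radial sigma); split; [|split; [|split]]; trivial.
  apply distortion_quotient_equiv; auto.
- intros (z & Hz & Hb & Hn & HQ); apply (a_weak z); trivial.
  now apply distortion_quotient_equiv.
- intros (tau & Hlim & Ht & Harg); split; [now exists tau|].
  exact (weak_ex_angular_arg_deriv phi sigma hphi hsigma tau Ht Harg).
- intros ((tau & Hlim & Ht) & Hex); exists tau; split; [exact Hlim|split; [exact Ht|]].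
  exact (arg_deriv_weak phi sigma tau hphi hsigma Ht Hlim Hex).
Qed.
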